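(* Let $E\subset\mathbb{R}^2$ be a self-affine set of Kakeya type, i.e. the invariant set of an affine iterated function system of Kakeya type $\{A_i+a_i\}_{i\in I}$, let $P$ be the topological pressure of $(A_i)_{i\in I}$, and let $t$ be such that $P(t)=0$. Then the Minkowski dimension of $E$ exists and $$\dim_M(E)=t\ge 1 .$$ In particular, $\dim_M$ is a continuous function when restricted to the class of affine iterated function systems of Kakeya type: for each fixed $\kappa\ge2$, the map sending an affine IFS of Kakeya type with $\kappa$ maps to the Minkowski dimension of its invariant set is continuous.
   Context: Words: $I=\{1,\dots,\kappa\}$ with $\kappa\ge 2$; $I^*=\bigcup_{n\ge1}I^n$; for $\mathtt{i}=(i_1,\dots,i_n)\in I^n$ put $A_{\mathtt{i}}=A_{i_1}\cdots A_{i_n}$. Singular values: for a contractive invertible $A\in\mathbb{R}^{2\times2}$, $1>\|A\|=\alpha_1(A)\ge\alpha_2(A)>0$ are the square roots of the eigenvalues of $A^*A$ ($A^*$ the transpose), and $\theta_1(A),\theta_2(A)$ are corresponding normalized eigenvectors of $A^*A$. The singular value function is $\varphi^t(A)=\alpha_1(A)^t$ for $0\le t<1$, $\varphi^t(A)=\alpha_1(A)\alpha_2(A)^{t-1}$ for $1\le t<2$, and $\varphi^t(A)=|\det A|^{t/2}$ for $t\ge2$. The topological pressure is $P(t)=\lim_{n\to\infty}\frac1n\log\sum_{\mathtt{i}\in I^n}\varphi^t(A_{\mathtt{i}})$, $t\ge0$; the limit exists, $P$ is continuous and strictly decreasing, and it has a unique zero $t>0$. Affine IFS: a collection $\{A_i+a_i\}_{i\in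 I}$ of maps $x\mapsto A_ix+a_i$ of $\mathbb{R}^2$, with $A_i$ invertible, $\|A_i\|\le\overline{\alpha}<1$, $a_i\in\mathbb{R}^2$. Its invariant set is the unique nonempty compact $E$ with $E=\bigcup_{i\in I}(A_i+a_i)(E)$. IFSs with $\kappa$ maps are topologized as a subset of $(GL_2(\mathbb{R})\times\mathbb{R}^2)^\kappa$. Cone: for $\theta\in S^1$ (the unit circle) and $0\le\beta\le\pi$, $X(\theta,\beta)=\{x\in\mathbb{R}^2: x\ne0,\ \cos(\beta/2)<|\theta\cdot x|/|x|\}$, with closure $\overline{X(\theta,\beta)}$. Kakeya type: the affine IFS $\{A_i+a_i\}_{i\in I}$ (with $\|A_i\|\le\overline{\alpha}<1$) is of Kakeya type, and its invariant set $E$ is a self-affine set of Kakeya type, if both of the following hold. (1) There exist $\theta\in S^1$ and $0<\beta<\pi/2$ such that $A_i(\overline{X(\theta,\beta)}\setminus\{0\})\subset X(\theta,\beta)$ and $A_i^*(\overline{X(\theta,\beta)}\setminus\{0\})\subset X(\theta,\beta)$ for all $i\in I$, and $A_i(\overline{X(\theta,\beta)})\cap A_j(\overline{X(\theta,\beta)})=\{0\}$ for $i\ne j$. (2) There is a constant $\varrho>0$ such that $\mathcal{L}^1(\{\theta_1(A_{\mathtt{i}})\cdot x: x\in E\})\ge\varrho$ for all $\mathtt{i}\in I^*$, where $\mathcal{L}^1$ is Lebesgue measure on $\mathbb{R}$. *)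

(* Defs.v *)
From HB Require Import structures.
From mathcomp Require Import all_boot all_order all_algebra.
From mathcomp Require Import all_classical all_reals all_analysis.

Set Implicit Arguments.
Unset Strict Implicit.
Unset Printing Implicit Defensive.

Import Order.TTheory GRing.Theory Num.Theory.
Import numFieldTopology.Exports numFieldNormedType.Exports.

Local Open Scope classical_set_scope.
Local Open Scope ring_scope.

Section Euclidean_plane.
Context {R : realType}.
Implicit Types (x y : 'cV[R]_2) (A : 'M[R]_2) (E : set 'cV[R]_2).

Definition dot x y : R := (x^T *m y) 0 0.

(* The library norm on matrices is the max norm; this is the Euclidean one.
   Both induce the library topology of 'cV[R]_2. *)
Definition enorm x : R := Num.sqrt (dot x x).

Definition opnorm A : R := sup [set enorm (A *m x) | x in [set x | enorm x = 1]].

(* [eigenvalue] is about row eigenvectors, which makes no difference for the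
   symmetric matrix A^T A.  Its spectrum has one or two elements, so its sup
   and inf are the larger and the smaller eigenvalue, also when the eigenvalue
   is double. *)
Definition gram_spectrum A : set R := [set l | eigenvalue (A^T *m A) l].

Definition alpha1 A : R := Num.sqrt (sup (gram_spectrum A)).

Definition alpha2 A : R := Num.sqrt (inf (gram_spectrum A)).

(* A choice of normalized eigenvector: it is determined up to sign when
   alpha2 A < alpha1 A, and is an arbitrary unit vector otherwise. *)
Definition theta1 A : 'cV[R]_2 :=
  xget 0 [set v | enorm v = 1 /\ A^T *m A *m v = (alpha1 A) ^+ 2 *: v].

Definition sing_val_fun (t : R) A : R :=
  if t < 1 then alpha1 A `^ t
  else if t < 2 then alpha1 A * alpha2 A `^ (t - 1)
  else `|\det A| `^ (t / 2).

Definition cone (theta : 'cV[R]_2) (beta : R) : set 'cV[R]_2 :=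
  [set x | x != 0 /\ cos (beta / 2) < `|dot theta x| / enorm x].

Definition coverable E (r : R) (n : nat) : Prop :=
  exists c : 'I_n -> 'cV[R]_2, E `<=` [set x | exists i, enorm (x - c i) <= r].

(* An infimum of natural numbers, hence a minimum, for bounded E and r > 0. *)
Definition covering_number E (r : R) : R :=
  inf [set n%:R | n in [set n | coverable E r n]].

Definition minkowski_ratio E (r : R) : R :=
  ln (covering_number E r) / - ln r.

Definition has_minkowski_dim E : Prop := cvg (minkowski_ratio E r @[r --> 0^'+]).

Definition minkowski_dim E : R := lim (minkowski_ratio E r @[r --> 0^'+]).

End Euclidean_plane.

(* The pair (A, a) stands for the map x |-> A x + a; {ptws _ -> _} carries the
   product topology. *)
Definition affine_maps (R : realType) (kappa : nat) :=
  {ptws 'I_kappa -> ('M[R]_2 * 'cV[R]_2)%type}.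

Section Affine_IFS.
Context {R : realType} {kappa : nat}.
Implicit Types (f : affine_maps R kappa) (i j : 'I_kappa).

Definition linpart f i : 'M[R]_2 := (f i).1.

Definition transpart f i : 'cV[R]_2 := (f i).2.

Definition affine_IFS f : Prop :=
  exists2 abar : R, abar < 1 &
    forall i, linpart f i \in unitmx /\ opnorm (linpart f i) <= abar.

Definition word_mx f (w : seq 'I_kappa) : 'M[R]_2 := \prod_(i <- w) linpart f i.

Definition pressure f (t : R) : R :=
  limn (fun n : nat =>
    ln (\sum_(w : n.-tuple 'I_kappa) sing_val_fun t (word_mx f w)) / n%:R).

Definition is_invariant_set f (E : set 'cV[R]_2) : Prop :=
  [/\ E !=set0, compact E &
      E = \bigcup_i [set linpart f i *m x + transpart f i | x in E]].

(* For an affine IFS there is exactly one such set. *)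
Definition invariant_set f : set 'cV[R]_2 := xget set0 [set E | is_invariant_set f E].

Definition cone_condition f : Prop :=
  exists (theta : 'cV[R]_2) (beta : R),
    let X := cone theta beta in
    [/\ enorm theta = 1,
        0 < beta < pi / 2,
        forall i, mulmx (linpart f i) @` (closure X `\ 0) `<=` X,
        forall i, mulmx (linpart f i)^T @` (closure X `\ 0) `<=` X &
        forall i j, i != j ->
          (mulmx (linpart f i) @` closure X) `&` (mulmx (linpart f j) @` closure X)
          = [set 0]].

Definition projection_condition f : Prop :=
  exists2 rho : R, 0 < rho &
    forall w : seq 'I_kappa, (0 < size w)%N ->
      (rho%:E <= lebesgue_measure
                   [set dot (theta1 (word_mx f w)) x | x in invariant_set f])%E.

Definition kakeya_type f : Prop :=
  [/\ affine_IFS f, cone_condition f & projection_condition f].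

End Affine_IFS.

(* Main.v *)
(* The cone condition makes [alpha1 A] comparable to the entry of [A] along the
   axis of the cone, for all products [A].  So [alpha1], and with it the singular
   value function, is multiplicative along words up to a constant, and the
   pressure vanishes at [t] exactly when the sums of the singular value function
   over the words of length [n] stay between 1 and a constant.

   Cut each word when [alpha2] drops below [r].  The invariant set [E] is covered
   by the images of [E] under these words, which lie in tubes of width about [r]
   and length about [alpha1]; hence its covering number is at most of the order
   of the sum [V] of [alpha1 / r], which is comparable to [r^-t].  For the lower
   bound, disjointness of the image cones separates the directions of the tubes,
   and Cordoba's L2 argument for the Kakeya maximal function applies: cut the
   plane into columns of width [r] and let [H] be the number of pairs of a tube
   and a column which it meets.  By Cauchy-Schwarz [H^2] is at most the covering
   number times [H + V log(1/r)], up to a constant, and [V] is at most of order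
   [H] because the projections of [E] have measure bounded below.

   The zero lies in [1, 2): projecting [E] shows that the sums of [alpha1] do not
   tend to 0, while separation of the directions makes those of [|det|] tend to 0.
   It depends continuously on the system because it is pinned down by strict
   inequalities on words of a single length, the constants depending only on the
   cone, which serves all nearby systems as well. *)

Require Import Defs.
From mathcomp Require Import all_boot all_order all_algebra.
From mathcomp Require Import all_classical all_reals all_analysis.
From mathcomp Require Import ring lra zify.

Import Order.TTheory GRing.Theory Num.Theory.
Import numFieldTopology.Exports numFieldNormedType.Exports.

Local Open Scope classical_set_scope.
Local Open Scope ring_scope.

Set Implicit Arguments.
Unset Strict Implicit.
Unset Printing Implicit Defensive.

(** * Singular values in the plane *)

(** In the orthonormal basis adapted to the cone both off-diagonal entries are at most [s < 1] times
    the leading one, [s] being the tangent of half the aperture; so the leading entry of a product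
    cannot cancel. Invariance of the cone is reduced to finitely many strict inequalities on
    entries, [strict_cone]. They survive perturbation with the same axis and the same [s], and the
    constant of quasimultiplicativity depends on [s] alone.

    The obstacle to the lower bound is that the tubes differ widely in length. An image cone
    contains an interval of slopes of radius about |det| / alpha1^2, which is about r / alpha1 for a
    stopped word, so separation improves as tubes get shorter. Pairs are therefore charged to the
    longer tube: among the tubes that are not longer, the slopes are uniformly separated and a
    harmonic sum yields the logarithm. A ball does not know the column of the points in it;
    recording a hit by its ball and its column modulo 4 repairs this. The projections enter through
    (A theta1) . (A z) = alpha1^2 (theta1 . z), which turns closeness of images into closeness of
    projections at scale r / alpha1. *)

Section Plane.
Context {R : realType}.
Implicit Types (x y z : 'cV[R]_2) (A B : 'M[R]_2) (c : R).

Lemma sum_ord2 (F : 'I_2 -> R) : \sum_(i < 2) F i = F 0 + F 1.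
Proof.
by rewrite big_ord_recl big_ord1; congr (_ + F _); apply/val_inj.
Qed.

Lemma ord2P (P : 'I_2 -> Prop) : P 0 -> P 1 -> forall i, P i.
Proof.
move=> P0 P1 [[|[|//]] lt]; [rewrite (_ : Ordinal lt = 0)|rewrite (_ : Ordinal lt = 1)] => //;
  exact/val_inj.
Qed.

Lemma cV2P x y : x 0 0 = y 0 0 -> x 1 0 = y 1 0 -> x = y.
Proof.
move=> e0 e1; apply/matrixP => i j; rewrite (ord1 j).
by move: i; apply: ord2P.
Qed.

Lemma le_of_eq (a b : R) : a = b -> a <= b.
Proof. by move=> ->. Qed.

Lemma cVDE x y i : (x + y) i 0 = x i 0 + y i 0.
Proof. by rewrite mxE. Qed.

Lemma cVZE c x i : (c *: x) i 0 = c * x i 0.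
Proof. by rewrite mxE. Qed.

Lemma mulmxv2 A x i : (A *m x) i 0 = A i 0 * x 0 0 + A i 1 * x 1 0.
Proof. by rewrite mxE sum_ord2. Qed.

Lemma mulmx2 A B i j : (A *m B) i j = A i 0 * B 0 j + A i 1 * B 1 j.
Proof. by rewrite mxE sum_ord2. Qed.

Lemma det2 A : \det A = A 0 0 * A 1 1 - A 0 1 * A 1 0.
Proof.
rewrite (expand_det_row _ 0) sum_ord2 /cofactor !det_mx11 !mxE /=.
rewrite expr0 mul1r expr1 mulN1r mulrN.
by congr (_ * A _ _ - _ * A _ _); apply/val_inj.
Qed.

Lemma dotE x y : dot x y = x 0 0 * y 0 0 + x 1 0 * y 1 0.
Proof. by rewrite /dot mxE sum_ord2 !mxE. Qed.

Lemma dotC x y : dot x y = dot y x.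
Proof. by rewrite !dotE; ring. Qed.

Lemma dotDr x y z : dot x (y + z) = dot x y + dot x z.
Proof. by rewrite !dotE !mxE; ring. Qed.

Lemma dotBr x y z : dot x (y - z) = dot x y - dot x z.
Proof. by rewrite !dotE !mxE; ring. Qed.

Lemma dotZr c x y : dot x (c *: y) = c * dot x y.
Proof. by rewrite !dotE !mxE; ring. Qed.

Lemma dotZl c x y : dot (c *: x) y = c * dot x y.
Proof. by rewrite !dotE !mxE; ring. Qed.

Lemma dot_mulmx A x y : dot x (A *m y) = dot (A^T *m x) y.
Proof. by rewrite !dotE !mulmxv2 !mxE; ring. Qed.

Lemma dotxx_ge0 x : 0 <= dot x x.
Proof. by rewrite dotE -!expr2 addr_ge0 ?sqr_ge0. Qed.

Lemma enorm_ge0 x : 0 <= enorm x.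
Proof. exact: sqrtr_ge0. Qed.

Lemma sqr_enorm x : enorm x ^+ 2 = dot x x.
Proof. by rewrite sqr_sqrtr ?dotxx_ge0. Qed.

Lemma enorm_eq0 x : (enorm x == 0) = (x == 0).
Proof.
apply/idP/eqP => [|->]; last by rewrite /enorm dotE !mxE !mul0r addr0 sqrtr0.
rewrite sqrtr_eq0 dotE -!expr2 => h.
have : x 0 0 ^+ 2 + x 1 0 ^+ 2 == 0 by rewrite eq_le h addr_ge0 ?sqr_ge0.
rewrite paddr_eq0 ?sqr_ge0 // !sqrf_eq0 => /andP[/eqP x0 /eqP x1].
by apply: cV2P; rewrite ?x0 ?x1 mxE.
Qed.

Lemma enorm_gt0 x : (0 < enorm x) = (x != 0).
Proof. by rewrite lt_def enorm_ge0 andbT enorm_eq0. Qed.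

Lemma enormZ c x : enorm (c *: x) = `|c| * enorm x.
Proof. by rewrite /enorm dotZl dotZr mulrA -expr2 sqrtrM ?sqr_ge0 // sqrtr_sqr. Qed.

Lemma enormN x : enorm (- x) = enorm x.
Proof. by rewrite -scaleN1r enormZ normrN1 mul1r. Qed.

Lemma enorm_le x c : 0 <= c -> (enorm x <= c) = (dot x x <= c ^+ 2).
Proof. by move=> c0; rewrite -sqr_enorm ler_pXn2r ?nnegrE ?enorm_ge0. Qed.

Lemma dot_le x y : `|dot x y| <= enorm x * enorm y.
Proof.
rewrite -(ler_pXn2r (_ : 0 < 2)%N) ?nnegrE ?mulr_ge0 ?enorm_ge0 //.
rewrite exprMn !sqr_enorm real_normK ?num_real // !dotE.
have := sqr_ge0 (x 0 0 * y 1 0 - x 1 0 * y 0 0); nra.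
Qed.

Lemma enormD x y : enorm (x + y) <= enorm x + enorm y.
Proof.
rewrite enorm_le ?addr_ge0 ?enorm_ge0 // sqrrD !sqr_enorm.
have := le_trans (ler_norm _) (dot_le x y).
by rewrite dotDr [dot (x + y) x]dotC [dot (x + y) y]dotC !dotDr (dotC y x); lra.
Qed.

Lemma enormB_le x y z : enorm (x - z) <= enorm (x - y) + enorm (y - z).
Proof. by rewrite -[x - z](subrKA y) enormD. Qed.

(* The symmetric matrix [A^T A] has characteristic polynomial
   [l^2 - tr l + det], whose discriminant is a sum of two squares. *)
Definition gram_disc A : R :=
  \tr (A^T *m A) ^+ 2 - 4 * \det A ^+ 2.

(** For [e] equal to 1 and -1, the larger and the smaller root of that polynomial. *)
Definition gram_root A (e : R) : R := (\tr (A^T *m A) + e * Num.sqrt (gram_disc A)) / 2.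

Lemma mxtrace2 A : \tr A = A 0 0 + A 1 1.
Proof. by rewrite /mxtrace sum_ord2. Qed.

Lemma gram_discE A : gram_disc A = ((A^T *m A) 0 0 - (A^T *m A) 1 1) ^+ 2 +
   4 * (A^T *m A) 0 1 ^+ 2.
Proof. by rewrite /gram_disc mxtrace2 det2 !mulmx2 !mxE; ring. Qed.

Lemma gram_disc_ge0 A : 0 <= gram_disc A.
Proof.
rewrite gram_discE; have := sqr_ge0 ((A^T *m A) 0 0 - (A^T *m A) 1 1).
by have := sqr_ge0 ((A^T *m A) 0 1); lra.
Qed.

Lemma sub_scalar_mxE A c i j : (A - c%:M) i j = A i j - c *+ (i == j).
Proof. by rewrite !mxE. Qed.

(** The two linear factors multiply out to the determinant of [A^T A - l], and a zero determinant,
    like an eigenvalue, is witnessed by a row vector which this matrix kills. *)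
Lemma gram_spectrumE A l :
  gram_spectrum A l <-> l = gram_root A 1 \/ l = gram_root A (-1).
Proof.
have -> : gram_spectrum A l <-> (l - gram_root A 1) * (l - gram_root A (-1)) = 0.
  have -> : (l - gram_root A 1) * (l - gram_root A (-1)) = \det (A^T *m A - l%:M).
    rewrite det2 /gram_root !sub_scalar_mxE /= !mulr1n !mulr0n !subr0.
    set D := Num.sqrt _; have DE : D ^+ 2 = gram_disc A by rewrite sqr_sqrtr ?gram_disc_ge0.
    transitivity ((l - \tr (A^T *m A) / 2) ^+ 2 - D ^+ 2 / 4); first by field.
    by rewrite DE gram_discE mxtrace2 !mulmx2 !mxE; field.
  split.
    move/eigenvalueP => [v vE v0]; apply/eqP/det0P; exists v => //.
    by rewrite mulmxBr vE mul_mx_scalar subrr.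
  move/eqP/det0P => [v v0 vE]; apply/eigenvalueP; exists v => //.
  by apply/eqP; rewrite -subr_eq0 -mul_mx_scalar -mulmxBr vE.
split=> [/eqP|[|] ->]; rewrite ?subrr ?mul0r ?mulr0 //.
by rewrite mulf_eq0 !subr_eq0 => /orP[] /eqP ->; [left|right].
Qed.

Lemma gram_root_le A : gram_root A (-1) <= gram_root A 1.
Proof. by rewrite /gram_root; have := sqrtr_ge0 (gram_disc A); lra. Qed.

Lemma gram_root_ge0 A : 0 <= gram_root A (-1).
Proof.
rewrite /gram_root mulr_ge0 // mulN1r subr_ge0.
have tr0 : 0 <= \tr (A^T *m A).
  by rewrite mxtrace2 !mulmx2 !mxE -!expr2 !addr_ge0 ?sqr_ge0.
rewrite -[leRHS](ger0_norm tr0) -sqrtr_sqr ler_sqrt ?sqr_ge0 //.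
by rewrite /gram_disc lerBlDr lerDl mulr_ge0 ?sqr_ge0 ?ler0n.
Qed.

Lemma sqr_alpha1 A : alpha1 A ^+ 2 = gram_root A 1.
Proof.
have -> : alpha1 A = Num.sqrt (gram_root A 1).
  congr Num.sqrt; apply/le_anti/andP; split.
    apply: ge_sup; first by exists (gram_root A 1); apply/gram_spectrumE; left.
    by move=> l /gram_spectrumE[] ->; rewrite ?gram_root_le.
  apply: ub_le_sup; last by apply/gram_spectrumE; left.
  by exists (gram_root A 1) => l /gram_spectrumE[] ->; rewrite ?gram_root_le.
by rewrite sqr_sqrtr // (le_trans (gram_root_ge0 A)) // gram_root_le.
Qed.

Lemma sqr_alpha2 A : alpha2 A ^+ 2 = gram_root A (-1).
Proof.
have -> : alpha2 A = Num.sqrt (gram_root A (-1)).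
  congr Num.sqrt; apply/le_anti/andP; split.
    apply: ge_inf; last by apply/gram_spectrumE; right.
    by exists (gram_root A (-1)) => l /gram_spectrumE[] ->; rewrite ?gram_root_le.
  apply: lb_le_inf; first by exists (gram_root A 1); apply/gram_spectrumE; left.
  by move=> l /gram_spectrumE[] ->; rewrite ?gram_root_le.
by rewrite sqr_sqrtr // gram_root_ge0.
Qed.

Lemma alpha1_ge0 A : 0 <= alpha1 A. Proof. exact: sqrtr_ge0. Qed.
Lemma alpha2_ge0 A : 0 <= alpha2 A. Proof. exact: sqrtr_ge0. Qed.

Lemma alpha1E A : alpha1 A = Num.sqrt (gram_root A 1).
Proof. by rewrite -sqr_alpha1 sqrtr_sqr ger0_norm ?alpha1_ge0. Qed.

Lemma alpha1M2 A : alpha1 A * alpha2 A = `|\det A|.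
Proof.
apply/eqP; rewrite -(@eqrXn2 _ 2) ?mulr_ge0 ?alpha1_ge0 ?alpha2_ge0 //.
rewrite exprMn sqr_alpha1 sqr_alpha2 real_normK ?num_real // /gram_root.
set D := Num.sqrt _; have DE : D ^+ 2 = gram_disc A by rewrite sqr_sqrtr ?gram_disc_ge0.
apply/eqP; transitivity ((\tr (A^T *m A) ^+ 2 - D ^+ 2) / 4); first by field.
by rewrite DE /gram_disc; field.
Qed.

Lemma alpha2_le1 A : alpha2 A <= alpha1 A.
Proof.
by rewrite -(@ler_pXn2r _ 2) ?nnegrE ?alpha1_ge0 ?alpha2_ge0 // sqr_alpha1 sqr_alpha2 gram_root_le.
Qed.

(** The matrix [g - A^T A] has determinant zero and nonnegative trace, hence is positive
    semidefinite. *)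
Lemma enorm_mulmx A x : enorm (A *m x) <= alpha1 A * enorm x.
Proof.
rewrite enorm_le ?mulr_ge0 ?alpha1_ge0 ?enorm_ge0 //.
rewrite exprMn sqr_alpha1 sqr_enorm.
set g := gram_root A 1.
have : (A^T *m A - g%:M) 0 0 * (A^T *m A - g%:M) 1 1 = (A^T *m A) 0 1 ^+ 2.
  apply/eqP; rewrite -subr_eq0; apply/eqP.
  have/gram_spectrumE : g = g \/ g = gram_root A (-1) by left.
  rewrite -/(gram_spectrum A g) => /eigenvalueP[v vE v0].
  have : \det (A^T *m A - g%:M) = 0.
    by apply/eqP/det0P; exists v => //; rewrite mulmxBr vE mul_mx_scalar subrr.
  rewrite det2 => <-; rewrite !sub_scalar_mxE /= !mulr0n !subr0.
  by rewrite !mulmx2 !mxE; ring.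
have t : (A^T *m A) 0 0 + (A^T *m A) 1 1 <= 2 * g.
  by rewrite /g /gram_root mxtrace2; have := sqrtr_ge0 (gram_disc A); lra.
rewrite !sub_scalar_mxE /= !mulr1n !dotE !mulmxv2.
rewrite !mulmx2 in t *; rewrite !mxE in t *.
move: t; move: (A 0 0) (A 0 1) (A 1 0) (A 1 1) (x 0 0) (x 1 0) g => a b c d p q g t e.
set P := g - (a * a + c * c); set Q := g - (b * b + d * d); set S := a * b + c * d.
have e' : P * Q = S ^+ 2 by rewrite /P /Q /S -e; ring.
have PQ : 0 <= P + Q by rewrite /P /Q; lra.
rewrite -subr_ge0.
have -> : g * (p * p + q * q) - ((a * p + b * q) * (a * p + b * q) + (c * p + d * q) * (c * p + d * q))
   = P * p ^+ 2 - 2 * S * p * q + Q * q ^+ 2 by rewrite /P /Q /S; ring.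
have P0 : 0 <= P by rewrite leNgt; apply/negP => ?; have := sqr_ge0 S; nra.
have Q0 : 0 <= Q by rewrite leNgt; apply/negP => ?; have := sqr_ge0 S; nra.
have [PZ|PN] := eqVneq P 0.
  have : S ^+ 2 = 0 by rewrite -e' PZ mul0r.
  by move/eqP; rewrite sqrf_eq0 => /eqP ->; rewrite PZ; have := sqr_ge0 q; nra.
have P1 : 0 < P by rewrite lt_def PN.
(* Completing the square after multiplication by [P]; the remainder carries the vanishing
   determinant. *)
rewrite -(pmulr_rge0 _ P1).
have -> : P * (P * p ^+ 2 - 2 * S * p * q + Q * q ^+ 2) = (P * p - S * q) ^+ 2 + (P * Q - S ^+ 2) * q ^+ 2 by ring.
by rewrite e' subrr mul0r addr0 sqr_ge0.
Qed.

(** The maximum is reached at an eigenvector of the larger root; with [enorm_mulmx] this identifies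
    [alpha1] with the Euclidean operator norm. *)
Lemma alpha1_attained A : exists2 x, enorm x = 1 & enorm (A *m x) = alpha1 A.
Proof.
have /gram_spectrumE : gram_root A 1 = gram_root A 1 \/ gram_root A 1 = gram_root A (-1) by left.
move=> /eigenvalueP[v vE v0].
have u0 : v^T != 0 by rewrite -trmx0 (inj_eq trmx_inj).
have uE : A^T *m A *m v^T = gram_root A 1 *: v^T.
  by apply/trmx_inj; rewrite linearZ /= !trmx_mul !trmxK vE.
set n := enorm v^T; have n0 : 0 < n by rewrite enorm_gt0.
exists (n^-1 *: v^T); first by rewrite enormZ gtr0_norm ?invr_gt0 // mulVf ?gt_eqF.
apply/eqP; rewrite -(@eqrXn2 _ 2) ?enorm_ge0 ?alpha1_ge0 //.
rewrite sqr_alpha1 sqr_enorm dot_mulmx mulmxA -scalemxAr uE !dotZl dotZr -sqr_enorm -/n.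
by apply/eqP; field; rewrite gt_eqF.
Qed.

Lemma alpha1_le A c : (forall x, enorm (A *m x) <= c * enorm x) -> alpha1 A <= c.
Proof. by move=> h; have [x x1 <-] := alpha1_attained A; rewrite -[c]mulr1 -x1. Qed.

Lemma alpha1_le_opnorm A : alpha1 A <= opnorm A.
Proof.
have [x x1 <-] := alpha1_attained A; apply: ub_le_sup; last by exists x.
exists (alpha1 A) => _ [y y1 <-]; have := enorm_mulmx A y.
by rewrite y1 mulr1.
Qed.

Lemma alpha1M A B : alpha1 (A *m B) <= alpha1 A * alpha1 B.
Proof.
apply: alpha1_le => x; rewrite -mulmxA -mulrA.
by rewrite (le_trans (enorm_mulmx _ _)) // ler_wpM2l ?alpha1_ge0 ?enorm_mulmx.
Qed.

Lemma alpha1_1 : alpha1 (1%:M : 'M[R]_2) = 1.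
Proof. by have [x x1 <-] := alpha1_attained 1%:M; rewrite mul1mx. Qed.

Lemma det_le_alpha1 A : `|\det A| <= alpha1 A ^+ 2.
Proof. by rewrite -alpha1M2 expr2 ler_wpM2l ?alpha1_ge0 ?alpha2_le1. Qed.

Lemma alpha1_gt0 A : A \in unitmx -> 0 < alpha1 A.
Proof.
rewrite unitmxE unitfE -normr_gt0 => d0; rewrite lt_def alpha1_ge0 andbT.
by apply: contraL d0 => /eqP e; rewrite -leNgt (le_trans (det_le_alpha1 A)) // e expr0n.
Qed.

End Plane.

(** * Matrices preserving a cone *)

Section Cone_coordinates.
Context {R : realType}.
Variables (th : 'cV[R]_2).
Implicit Types (x y z : 'cV[R]_2) (A B : 'M[R]_2) (c s : R).

Definition perp : 'cV[R]_2 := \col_i (if i == 0 then - th 1 0 else th 0 0).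

(** The four entries of [A] in the orthonormal basis [th], [perp]. *)
Definition m11 A := dot th (A *m th).
Definition m12 A := dot th (A *m perp).
Definition m21 A := dot perp (A *m th).
Definition m22 A := dot perp (A *m perp).

Definition closed_cone s : set 'cV[R]_2 := [set x | `|dot perp x| <= s * `|dot th x|].

Definition cone_inv s A := forall x, closed_cone s x -> closed_cone s (A *m x).

(** Slope, over the axis of the cone, of the image of the axis; it serves as the direction of the
    tube into which [A] sends a bounded set. *)
Definition slope A := m21 A / m11 A.

(** Every direction whose slope is within this distance of [slope A] lies in the image cone, see
    [slope_near_mem]. *)
Definition slope_radius s A := s * `|\det A| / (2 * m11 A ^+ 2).

(* The entry along the axis dominates; it is then comparable to [alpha1 A]. *)
Definition diag_dominant s A := [/\ m11 A != 0, `|m12 A| <= s * `|m11 A|,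
  `|m21 A| <= s * `|m11 A| & `|m22 A| <= 3 * `|m11 A|].

(** The axis and the two boundary rays are sent strictly inside the cone. These are finitely many
    strict inequalities in the entries, hence an open condition on [A]. *)
Definition half_strict s A := [/\ `|m21 A| < s * `|m11 A|,
  `|m21 A + s * m22 A| < s * `|m11 A + s * m12 A| &
  `|m21 A - s * m22 A| < s * `|m11 A - s * m12 A|].

Definition strict_cone s A := half_strict s A /\ half_strict s A^T.

Lemma perpE : perp 0 0 = - th 1 0 /\ perp 1 0 = th 0 0.
Proof. by rewrite !mxE. Qed.

Lemma m11T A : m11 A^T = m11 A.
Proof. by rewrite /m11 dot_mulmx trmxK dotC. Qed.
Lemma m21T A : m21 A^T = m12 A.
Proof. by rewrite /m21 dot_mulmx trmxK dotC. Qed.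

Hypothesis th1 : enorm th = 1.

Lemma th_sqr : th 0 0 * th 0 0 + th 1 0 * th 1 0 = 1.
Proof. by have := sqr_enorm th; rewrite th1 expr1n dotE. Qed.

Lemma dot_th_th : dot th th = 1.
Proof. by rewrite dotE th_sqr. Qed.

Lemma dot_perp_perp : dot perp perp = 1.
Proof. by rewrite dotE; have [-> ->] := perpE; rewrite mulrNN addrC th_sqr. Qed.

Lemma dot_th_perp : dot th perp = 0.
Proof. by rewrite dotE; have [-> ->] := perpE; ring. Qed.

Lemma dot_perp_th : dot perp th = 0.
Proof. by rewrite dotC dot_th_perp. Qed.

Lemma enorm_perp : enorm perp = 1.
Proof. by rewrite /enorm dot_perp_perp sqrtr1. Qed.

Lemma decomp x : x = dot th x *: th + dot perp x *: perp.
Proof.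
have [p0 p1] := perpE.
apply: cV2P; rewrite !cVDE !cVZE !dotE p0 p1.
  by rewrite -[LHS]mul1r -th_sqr; ring.
by rewrite -[LHS]mul1r -th_sqr; ring.
Qed.

Lemma dot_th_mul A x : dot th (A *m x) = m11 A * dot th x + m12 A * dot perp x.
Proof.
rewrite {1}[x]decomp mulmxDr -!scalemxAr dotDr !dotZr.
by rewrite /m11 /m12; ring.
Qed.

Lemma dot_perp_mul A x : dot perp (A *m x) = m21 A * dot th x + m22 A * dot perp x.
Proof.
rewrite {1}[x]decomp mulmxDr -!scalemxAr dotDr !dotZr.
by rewrite /m21 /m22; ring.
Qed.

Lemma sqr_enorm_coord x : enorm x ^+ 2 = dot th x ^+ 2 + dot perp x ^+ 2.
Proof.
rewrite sqr_enorm {2}[x]decomp dotDr !dotZr ![dot x _]dotC.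
by ring.
Qed.

Lemma enorm_le_coord x : enorm x <= `|dot th x| + `|dot perp x|.
Proof.
rewrite -(ler_pXn2r (_ : 0 < 2)%N) ?nnegrE ?enorm_ge0 ?addr_ge0 //.
rewrite sqr_enorm_coord -(real_normK (num_real (dot th x))) -(real_normK (num_real (dot perp x))).
by have := mulr_ge0 (normr_ge0 (dot th x)) (normr_ge0 (dot perp x)); nra.
Qed.

Lemma dot_th_le x : `|dot th x| <= enorm x.
Proof. by have := dot_le th x; rewrite th1 mul1r. Qed.

Lemma dot_perp_le x : `|dot perp x| <= enorm x.
Proof. by have := dot_le perp x; rewrite enorm_perp mul1r. Qed.

Lemma coord_inj x y : dot th x = dot th y -> dot perp x = dot perp y -> x = y.
Proof. by move=> h h'; rewrite [x]decomp [y]decomp h h'. Qed.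

Lemma dot_th_comb a b : dot th (a *: th + b *: perp) = a.
Proof. by rewrite dotDr !dotZr dot_th_th dot_th_perp; ring. Qed.

Lemma dot_perp_comb a b : dot perp (a *: th + b *: perp) = b.
Proof. by rewrite dotDr !dotZr dot_perp_th dot_perp_perp; ring. Qed.

Lemma m11M A B : m11 (A *m B) = m11 A * m11 B + m12 A * m21 B.
Proof. by rewrite {1}/m11 -mulmxA dot_th_mul. Qed.

Lemma det_coord A : \det A = m11 A * m22 A - m12 A * m21 A.
Proof.
have [p0 p1] := perpE.
rewrite /m11 /m12 /m21 /m22 !dotE !mulmxv2 p0 p1 det2.
transitivity ((th 0 0 * th 0 0 + th 1 0 * th 1 0) ^+ 2 *
   (A 0 0 * A 1 1 - A 0 1 * A 1 0)); first by rewrite th_sqr; ring.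
by ring.
Qed.

Lemma m11_le A : `|m11 A| <= alpha1 A.
Proof. by rewrite (le_trans (dot_th_le _)) // -[leRHS]mulr1 -th1 enorm_mulmx. Qed.

(** * Consequences of the dominance of the leading entry *)

Section Dominance.
Variable s : R.
Hypotheses (s0 : 0 < s) (s1 : s < 1).

(** The images of the axis under [A] and its transpose bound the off-diagonal entries, and the image
    of a boundary ray bounds the last one. If the leading entry were zero, all four would be,
    against invertibility. *)
Lemma cone_inv_dominant A : A \in unitmx -> cone_inv s A -> cone_inv s A^T -> diag_dominant s A.
Proof.
move=> Au iA iAT.
have kth : closed_cone s th.
  by rewrite /closed_cone /= dot_perp_th normr0 mulr_ge0 // ltW.
have h21 : `|m21 A| <= s * `|m11 A| by exact: iA kth.
have h12 : `|m12 A| <= s * `|m11 A|.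
  by have := iAT _ kth; rewrite /closed_cone /= -/(m21 A^T) -/(m11 A^T) m21T m11T.
have h22 : `|m22 A| <= 3 * `|m11 A|.
  have := iA (1 *: th + s *: perp); rewrite /closed_cone /= dot_th_comb dot_perp_comb.
  rewrite dot_th_mul dot_perp_mul dot_th_comb dot_perp_comb !mulr1 normr1 mulr1 gtr0_norm //.
  move/(_ (lexx _)) => h.
  have k1 : `|m22 A| * s <= s * (3 * `|m11 A|).
    have e1 : `|m22 A| * s <= `|m21 A + m22 A * s| + `|m21 A|.
      rewrite -{1}(gtr0_norm s0) -normrM.
      by have := ler_normB (m21 A + m22 A * s) (m21 A); rewrite addrAC subrr add0r.
    have e2 : `|m11 A + m12 A * s| <= `|m11 A| + `|m12 A| * s.
      by rewrite (le_trans (ler_normD _ _)) // normrM (gtr0_norm s0).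
    have e3 := ler_wpM2l (ltW s0) e2.
    have e4 : `|m12 A| * s <= `|m11 A|.
      rewrite (le_trans (ler_piMr (normr_ge0 _) (ltW s1))) //.
      by rewrite (le_trans h12) // ler_piMl // ltW.
    have := ler_wpM2l (ltW s0) e4.
    by move: e1 e3 h h21; rewrite mulrDr; lra.
  by rewrite mulrC ler_pM2l in k1.
split=> //; apply: contraTN isT => /eqP z.
move: h12 h21 h22; rewrite z normr0 !mulr0 !normr_le0 => /eqP a /eqP b /eqP c.
by have := Au; rewrite unitmxE unitfE det_coord z a b c !mul0r subrr eqxx.
Qed.

(** The two coordinates of an image are at most 2 and 4 times the leading entry times the norm;
    hence 6. *)
Lemma dominant_alpha1 A : diag_dominant s A -> alpha1 A <= 6 * `|m11 A|.
Proof.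
move=> [_ a b c]; apply: alpha1_le => x.
rewrite (le_trans (enorm_le_coord _)) // dot_th_mul dot_perp_mul.
have h1 := dot_th_le x; have h2 := dot_perp_le x.
have n0 := normr_ge0 (m11 A).
have e1 : `|m11 A * dot th x + m12 A * dot perp x| <= 2 * `|m11 A| * enorm x.
  rewrite (le_trans (ler_normD _ _)) // !normrM.
  have := ler_pM (normr_ge0 (m11 A)) (normr_ge0 _) (lexx _) h1.
  have := ler_pM (normr_ge0 (m12 A)) (normr_ge0 _) (le_trans a (ler_piMl n0 (ltW s1))) h2.
  by lra.
have e2 : `|m21 A * dot th x + m22 A * dot perp x| <= 4 * `|m11 A| * enorm x.
  rewrite (le_trans (ler_normD _ _)) // !normrM.
  have := ler_pM (normr_ge0 (m22 A)) (normr_ge0 _) c h2.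
  have := ler_pM (normr_ge0 (m21 A)) (normr_ge0 _) (le_trans b (ler_piMl n0 (ltW s1))) h1.
  by lra.
by lra.
Qed.

(** The leading entry of the product is the product of the leading entries plus a product of
    off-diagonal ones, which is smaller by the factor [s ^+ 2]. *)
Lemma dominant_m11M A B : diag_dominant s A -> diag_dominant s B ->
  (1 - s ^+ 2) * (`|m11 A| * `|m11 B|) <= `|m11 (A *m B)|.
Proof.
move=> [_ a _ _] [_ _ b _]; rewrite m11M.
have h : `|m12 A * m21 B| <= s ^+ 2 * (`|m11 A| * `|m11 B|).
  rewrite normrM (le_trans (ler_pM _ _ a b)) //.
  by apply: le_of_eq; ring.
have := lerB_normD (m11 A * m11 B) (m12 A * m21 B).
by rewrite normrM; lra.
Qed.

Lemma dominant_alpha1M A B : diag_dominant s A -> diag_dominant s B ->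
  (1 - s ^+ 2) / 36 * (alpha1 A * alpha1 B) <= alpha1 (A *m B).
Proof.
move=> aA aB; apply: le_trans (m11_le _); apply: le_trans (dominant_m11M aA aB).
have hA := dominant_alpha1 aA; have hB := dominant_alpha1 aB.
have h := ler_pM (alpha1_ge0 A) (alpha1_ge0 B) hA hB.
have p : 0 < 1 - s ^+ 2 by rewrite subr_gt0 exprn_ilt1 // ltW.
rewrite -mulrA ler_pM2l // ler_pdivrMl // (le_trans h) //.
by apply: le_of_eq; ring.
Qed.

Lemma slope_le A : diag_dominant s A -> `|slope A| <= s.
Proof.
move=> [n _ b _]; rewrite /slope normrM normfV ler_pdivrMr ?normr_gt0 //.
Qed.

(** Distance from the line of slope [slope A], measured along [perp]: it is contracted by |det| /
    |m11|, which is comparable to [alpha2]. This is why images of bounded sets are tubes. *)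
Lemma tube_width A x : m11 A != 0 ->
  dot perp (A *m x) - slope A * dot th (A *m x) = \det A / m11 A * dot perp x.
Proof.
by move=> n; rewrite dot_th_mul dot_perp_mul det_coord /slope; field.
Qed.

Lemma slope_mem A : m11 A != 0 ->
  exists2 x, closed_cone s x & A *m x = th + slope A *: perp.
Proof.
move=> n; exists ((m11 A)^-1 *: th).
  rewrite /closed_cone /= !dotZr dot_perp_th mulr0 normr0 mulr_ge0 //.
  exact: ltW.
rewrite -[th in RHS]scale1r; apply: coord_inj.
  by rewrite dot_th_comb -scalemxAr dotZr -/(m11 A) mulVf.
by rewrite dot_perp_comb -scalemxAr dotZr -/(m21 A) mulrC.
Qed.

(* Solve [A x = th + y perp] by Cramer's rule. *)
Lemma slope_near_mem A (y : R) : A \in unitmx -> diag_dominant s A ->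
  `|y - slope A| <= slope_radius s A ->
  exists2 x, closed_cone s x & A *m x = th + y *: perp.
Proof.
move=> Au [n a _ _]; rewrite /slope_radius.
have d0 : \det A != 0 by rewrite unitmxE unitfE in Au.
set e := y - slope A => he.
have yE : y = slope A + e by rewrite /e addrC subrK.
exists (((m22 A - m12 A * y) / \det A) *: th + ((m11 A * y - m21 A) / \det A) *: perp).
  rewrite /closed_cone /= dot_th_comb dot_perp_comb.
  have -> : m22 A - m12 A * y = \det A / m11 A - m12 A * e.
    by rewrite yE det_coord /slope; field.
  have -> : m11 A * y - m21 A = m11 A * e by rewrite yE /slope; field.
  rewrite !normrM !normfV mulrA ler_pM2r ?invr_gt0 ?normr_gt0 //.
  have n1 : 0 < `|m11 A| by rewrite normr_gt0.
  have he' : `|e| * (2 * `|m11 A|) <= s * (`|\det A| / `|m11 A|).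
    rewrite -ler_pdivlMr ?mulr_gt0 //; apply: le_trans he _.
    rewrite -(real_normK (num_real (m11 A))).
    by apply: le_of_eq; field; rewrite gt_eqF.
  have h := lerB_dist (\det A / m11 A) (m12 A * e).
  have h2 : `|m12 A * e| <= s * `|m11 A| * `|e| by rewrite normrM ler_wpM2r.
  rewrite normrM normfV in h.
  have e0 := normr_ge0 e.
  have h3 := ler_wpM2l (ltW s0) h.
  have h4 := ler_wpM2l (ltW s0) h2.
  have h5 : s * (s * `|m11 A| * `|e|) <= `|m11 A| * `|e|.
    by rewrite !mulrA -mulrA ler_piMl ?mulr_ge0 // -expr2 exprn_ile1 // ltW.
  by lra.
rewrite -[th in RHS]scale1r; apply: coord_inj.
  rewrite dot_th_comb dot_th_mul dot_th_comb dot_perp_comb det_coord.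
  by field; rewrite -det_coord.
rewrite dot_perp_comb dot_perp_mul dot_th_comb dot_perp_comb det_coord.
by field; rewrite -det_coord.
Qed.

(** Otherwise the direction of slope [slope B] would lie in both image cones. *)
Lemma slope_separation A B : A \in unitmx -> diag_dominant s A -> diag_dominant s B ->
  (mulmx A @` closed_cone s) `&` (mulmx B @` closed_cone s) `<=` [set 0] ->
  slope_radius s A < `|slope A - slope B|.
Proof.
move=> Au aA [nB _ _ _] dis; rewrite ltNge; apply/negP; rewrite distrC => h.
have [x kx xE] := slope_near_mem Au aA h.
have [y ky yE] := slope_mem nB.
have /= z : (th + slope B *: perp) = 0.
  by apply: dis; split; [exists x|exists y].
have := congr1 (dot th) z; rewrite dotDr dotZr dot_th_th dot_th_perp mulr0 addr0.
have -> : dot th 0 = 0 by rewrite dotE !mxE !mulr0 addr0.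
by move/eqP; rewrite oner_eq0.
Qed.

Lemma slope_radius_gt0 A : A \in unitmx -> diag_dominant s A -> 0 < slope_radius s A.
Proof.
rewrite unitmxE unitfE => d [n _ _ _].
have n2 : 0 < m11 A ^+ 2 by rewrite exprn_even_gt0.
by rewrite divr_gt0 // mulr_gt0 // normr_gt0.
Qed.

(** Here 18 is half of 6^2, since |det| is at most [alpha1 A ^+ 2], hence at most 36 times the
    square of the leading entry. *)
Lemma slope_radius_le A : diag_dominant s A -> slope_radius s A <= 18.
Proof.
move=> aA; have [n _ _ _] := aA.
have n1 : 0 < m11 A ^+ 2 by rewrite exprn_even_gt0.
rewrite /slope_radius ler_pdivrMr; last exact: mulr_gt0.
have h := det_le_alpha1 A.
have h2 : alpha1 A ^+ 2 <= 36 * m11 A ^+ 2.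
  rewrite -(real_normK (num_real (m11 A))).
  have := ler_pM (alpha1_ge0 A) (alpha1_ge0 A) (dominant_alpha1 aA) (dominant_alpha1 aA).
  by rewrite !expr2; lra.
have h3 : s * `|\det A| <= `|\det A| by rewrite ler_piMl // ltW.
by lra.
Qed.

(** A vector of the cone is, up to sign, a nonnegative combination of the two boundary vectors, and
    their images lie in the same convex half of the cone. *)
Lemma half_strict_inv A : half_strict s A -> half_strict s A^T -> cone_inv s A.
Proof.
move=> [h1 h2 h3] [k1 _ _]; rewrite m21T m11T in k1 => x.
rewrite /closed_cone /= dot_th_mul dot_perp_mul.
move: (dot th x) (dot perp x) => p q.
move: (m11 A) (m12 A) (m21 A) (m22 A) h1 h2 h3 k1 => a b c d.
wlog a0 : a b c d / 0 < a.
  move=> W h1 h2 h3 h4; case: (ltrgtP a 0) => a0; last 2 first.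
  - exact: W.
  - by move: h4; rewrite a0 normr0 mulr0 ltNge normr_ge0.
  have := W (- a) (- b) (- c) (- d); rewrite !mulrN !mulNr -!opprD !normrN.
  by rewrite oppr_gt0; exact.
rewrite !(gtr0_norm a0) => h1 h2 h3 h4.
(* The bound on [b] comes from the transpose. It gives the first coordinates of both boundary images
   the sign of [a], so that the images lie in one half of the cone. *)
have hb : `|s * b| < a.
  rewrite normrM (gtr0_norm s0) (le_lt_trans (ler_piMl (normr_ge0 _) (ltW s1))) //.
  by rewrite (lt_le_trans h4) // ler_piMl // ltW.
move: hb; rewrite ltr_norml => /andP[b1 b2].
rewrite (gtr0_norm (_ : 0 < a + s * b)) in h2; last by lra.
rewrite (gtr0_norm (_ : 0 < a - s * b)) in h3; last by lra.
move: h2 h3; rewrite !ltr_norml => /andP[h2 h2'] /andP[h3 h3'].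
wlog p0 : p q / 0 <= p.
  move=> W h; case: (lerP 0 p) => p0; first exact: W.
  have := W (- p) (- q); rewrite !mulrN -!opprD !normrN oppr_ge0.
  by move=> /(_ (ltW p0) h).
rewrite (ger0_norm p0) ler_norml => /andP[q1 q2].
have u : 0 <= s * p - q by lra.
have v : 0 <= s * p + q by lra.
have i1 : 0 <= s * (a * p + b * q) - (c * p + d * q).
  rewrite -(pmulr_rge0 _ (_ : 0 < 2 * s)) ?mulr_gt0 //.
  have -> : 2 * s * (s * (a * p + b * q) - (c * p + d * q)) =
    (s * p + q) * (s * (a + s * b) - (c + s * d)) + (s * p - q) * (s * (a - s * b) - (c - s * d)) by ring.
  by rewrite addr_ge0 ?mulr_ge0 //; lra.
have i2 : 0 <= s * (a * p + b * q) + (c * p + d * q).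
  rewrite -(pmulr_rge0 _ (_ : 0 < 2 * s)) ?mulr_gt0 //.
  have -> : 2 * s * (s * (a * p + b * q) + (c * p + d * q)) =
    (s * p + q) * (s * (a + s * b) + (c + s * d)) + (s * p - q) * (s * (a - s * b) + (c - s * d)) by ring.
  by rewrite addr_ge0 ?mulr_ge0 //; lra.
have i3 : s * (a * p + b * q) <= s * `|a * p + b * q| by rewrite ler_pM2l // ler_norm.
rewrite ler_norml; apply/andP; split; lra.
Qed.

Lemma strict_cone_dominant A : A \in unitmx -> strict_cone s A ->
  [/\ cone_inv s A, cone_inv s A^T & diag_dominant s A].
Proof.
move=> Au [h hT]; have i := half_strict_inv h hT.
have iT : cone_inv s A^T by apply: half_strict_inv => //; rewrite trmxK.
by split=> //; exact: cone_inv_dominant.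
Qed.

End Dominance.
End Cone_coordinates.

(** * Sums over words *)

Section Word_sums.
Context {R : realType} {I : finType}.
Implicit Types (F : seq I -> R) (u v w : seq I) (m n : nat).

Definition wsum n F : R := \sum_(w : n.-tuple I) F w.

Lemma wsum0 F : wsum 0 F = F [::].
Proof.
rewrite /wsum (big_pred1 [tuple]) // => w /=.
by apply/esym/eqP/val_inj; rewrite [val w]size0nil ?size_tuple.
Qed.

Lemma wsumS n F : wsum n.+1 F = \sum_i wsum n (fun w => F (i :: w)).
Proof.
rewrite /wsum pair_big /=.
rewrite (reindex (fun p : I * n.-tuple I => [tuple of p.1 :: p.2])) //=.
exists (fun w : n.+1.-tuple I => (thead w, [tuple of behead w])) => [[i w] _|w _] /=.
  by congr (_, _); apply/val_inj.
by rewrite [w in RHS]tuple_eta; apply/val_inj.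
Qed.

Lemma wsumD m n F : wsum (m + n) F = wsum m (fun u => wsum n (fun v => F (u ++ v))).
Proof.
elim: m F => [|m IH] F; first by rewrite wsum0.
rewrite addSn !wsumS; apply: eq_bigr => i _; by rewrite IH.
Qed.

Lemma eq_wsum n F G : (forall w, size w = n -> F w = G w) -> wsum n F = wsum n G.
Proof. by move=> h; apply: eq_bigr => w _; rewrite h // size_tuple. Qed.

Lemma le_wsum n F G : (forall w, size w = n -> F w <= G w) -> wsum n F <= wsum n G.
Proof. by move=> h; apply: ler_sum => w _; rewrite h // size_tuple. Qed.

Lemma wsum_ge0 n F : (forall w, 0 <= F w) -> 0 <= wsum n F.
Proof. by move=> h; apply: sumr_ge0. Qed.

Lemma wsumZ n c F : wsum n (fun w => c * F w) = c * wsum n F.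
Proof. by rewrite /wsum mulr_sumr. Qed.

Lemma wsumZr n c F : wsum n (fun w => F w * c) = wsum n F * c.
Proof. by rewrite /wsum mulr_suml. Qed.

Lemma wsum_gt0 n F : (0 < #|I|)%N -> (forall w, 0 < F w) -> 0 < wsum n F.
Proof.
move=> /card_gt0P[i _] h.
rewrite /wsum (bigD1 [tuple of nseq n i]) //=.
by rewrite ltr_pwDl // sumr_ge0 // => w _; exact: ltW.
Qed.

Lemma wsumM_le m n F : (forall u v, F (u ++ v) <= F u * F v) ->
  wsum (m + n) F <= wsum m F * wsum n F.
Proof.
move=> h; rewrite wsumD -wsumZr; apply: le_wsum => u _.
by rewrite -wsumZ; apply: le_wsum => v _.
Qed.

Lemma wsumM_ge m n c F : (forall u v, c * (F u * F v) <= F (u ++ v)) ->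
  c * (wsum m F * wsum n F) <= wsum (m + n) F.
Proof.
move=> h; rewrite wsumD -wsumZr -wsumZ; apply: le_wsum => u _.
by rewrite -wsumZ -wsumZ; apply: le_wsum => v _.
Qed.

(* The words at which a branch of the tree of words first satisfies [stop],
   followed up to [n] letters beyond [u]. *)
Fixpoint stopped (stop : pred (seq I)) n u : seq (seq I) :=
  if stop u then [:: u]
  else if n is n'.+1 then flatten [seq stopped stop n' (rcons u i) | i <- enum I]
  else [:: u].

Definition diverge u v := ~~ prefix u v && ~~ prefix v u.

Variable stop : pred (seq I).

Lemma stopped_prefix n u w : w \in stopped stop n u -> prefix u w.
Proof.
elim: n u => [|n IH] u /=.
  by case: ifP => _; rewrite inE => /eqP ->; rewrite prefix_refl.
case: ifP => _; first by rewrite inE => /eqP ->; rewrite prefix_refl.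
move=> /flatten_mapP[i _ /IH]; apply: prefix_trans; exact: prefix_rcons.
Qed.

Lemma prefix_rcons_diverge u i j v w : i != j ->
  prefix (rcons u i) v -> prefix (rcons u j) w -> diverge v w.
Proof.
move=> ij /prefixP[v' ->] /prefixP[w' ->].
rewrite /diverge !cat_rcons.
by elim: u => [|k u IH] /=; rewrite ?eqxx //= (eq_sym j) (negPf ij).
Qed.

Lemma stopped_pairwise n u : pairwise diverge (stopped stop n u).
Proof.
elim: n u => [|n IH] u /=; case: ifP => _ //.
elim: (enum I) (enum_uniq I) => [//|i l IHl] /= /andP[il /IHl pl].
rewrite pairwise_cat pl IH /= !andbT.
apply/allrelP => v w vi /flatten_mapP[j jl wj].
apply: (prefix_rcons_diverge _ (stopped_prefix vi) (stopped_prefix wj)).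
by apply: contraNneq il => ->.
Qed.

Lemma stopped_uniq n u : uniq (stopped stop n u).
Proof.
have := stopped_pairwise n u; rewrite uniq_pairwise; apply: sub_pairwise => v w.
by apply: contraTneq => ->; rewrite /diverge prefix_refl.
Qed.

Lemma divergeC u v : diverge u v = diverge v u.
Proof. by rewrite /diverge andbC. Qed.

Lemma stopped_diverge n u v w : v \in stopped stop n u -> w \in stopped stop n u -> v != w ->
  diverge v w.
Proof.
have := stopped_pairwise n u; elim: (stopped _ _ _) => [//|x s IH] /=.
move=> /andP[/allP xs /IH h]; rewrite !inE.
move=> /orP[/eqP ->|vs] /orP[/eqP ->|ws] vw.
- by rewrite eqxx in vw.
- exact: xs.
- by rewrite divergeC xs.
- exact: h.
Qed.

Lemma stopped_stop n u w : (forall v, (size u + n <= size v)%N -> stop v) ->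
  w \in stopped stop n u -> stop w.
Proof.
elim: n u => [|n IH] u h /=.
  by case: ifP => [|/negP[]]; [rewrite inE => ? /eqP ->|apply: h; rewrite addn0].
case: ifP => [|_]; first by rewrite inE => ? /eqP ->.
move=> /flatten_mapP[i _]; apply: IH => v; rewrite size_rcons => hv; apply: h.
by rewrite addnS -addSn.
Qed.

Lemma stopped_parent n w : w \in stopped stop n [::] ->
  w = [::] \/ exists u i, w = rcons u i /\ ~~ stop u.
Proof.
pose P z := z = [::] \/ exists u i, z = rcons u i /\ ~~ stop u.
suff H z : P z -> w \in stopped stop n z -> P w by apply: H; left.
elim: n z => [|n IH] z hz /=.
  by case: ifP => _; rewrite mem_seq1 => /eqP ->.
case: ifP => [_|/negbT sz]; first by rewrite mem_seq1 => /eqP ->.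
by move=> /flatten_mapP[i _]; apply: IH; right; exists z, i.
Qed.

Lemma stopped_cover (T : Type) (E : seq I -> set T) n u :
  (forall v, E v `<=` \bigcup_i E (rcons v i)) ->
  E u `<=` [set x | exists2 w, w \in stopped stop n u & E w x].
Proof.
move=> hE; elim: n u => [|n IH] u x Ex /=.
  by exists u => //; case: ifP => _; rewrite inE.
case: ifP => _; first by exists u => //; rewrite inE.
have [i _ Ei] := hE _ _ Ex; have [w wi Ew] := IH _ _ Ei.
by exists w => //; apply/flatten_mapP; exists i; rewrite ?mem_enum.
Qed.

(** Extending each stopped word to full length partitions the words of length [n] beyond [u]. A
    comparison at every node, uniform in the remaining depth [m], therefore passes to the whole sum.
    With [stopped_sum_ge], it lets a sum over words of varying length be read off from one over
    words of a single length. *)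
Lemma stopped_sum_le F C n u : 0 <= C ->
  (forall v m, C * F v <= wsum m (fun w => F (v ++ w))) ->
  C * (\sum_(w <- stopped stop n u) F w) <= wsum n (fun w => F (u ++ w)).
Proof.
move=> C0 h; elim: n u => [|n IH] u /=.
  by have := h u 0%N; case: ifP; rewrite big_seq1.
case: ifP => _; first by rewrite big_seq1.
rewrite wsumS big_flatten /= big_map big_enum /= mulr_sumr.
apply: ler_sum => i _; rewrite (le_trans (IH _)) //; apply: le_wsum => w _.
by rewrite cat_rcons.
Qed.

Lemma stopped_sum_ge F C n u : 0 <= C ->
  (forall v m, wsum m (fun w => F (v ++ w)) <= C * F v) ->
  wsum n (fun w => F (u ++ w)) <= C * (\sum_(w <- stopped stop n u) F w).
Proof.
move=> C0 h; elim: n u => [|n IH] u /=.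
  by have := h u 0%N; case: ifP; rewrite big_seq1.
case: ifP => _; first by rewrite big_seq1.
rewrite wsumS big_flatten /= big_map big_enum /= mulr_sumr.
apply: ler_sum => i _; rewrite (le_trans _ (IH _)) //; apply: le_wsum => w _.
by rewrite cat_rcons.
Qed.

End Word_sums.

(** * Almost additive sequences *)

Section Quasi_additive.
Context {R : realType}.
Variables (a : nat -> R) (C : R).
Hypotheses (C0 : 0 <= C) (a0 : forall m n, a (m + n)%N <= a m + a n)
  (a1 : forall m n, a m + a n - C <= a (m + n)%N).

Let aM_le k n : (0 < k)%N -> a (k * n)%N <= k%:R * a n.
Proof.
case: k => // k _; elim: k => [|k IH]; first by rewrite mul1n mul1r.
rewrite mulSn (le_trans (a0 _ _)) // -natr1 mulrDl mul1r addrC.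
by rewrite lerD2r.
Qed.

Let aM_ge k n : (0 < k)%N -> k%:R * (a n - C) <= a (k * n)%N.
Proof.
case: k => // k _; elim: k => [|k IH]; first by rewrite mul1n mul1r lerBlDr lerDl.
by rewrite mulSn (le_trans _ (a1 _ _)) // -natr1 mulrDl mul1r addrC lerBrDr; lra.
Qed.

(** Both sides are compared with [a (m * n)], cut once into [n] blocks of length [m] and once into
    [m] blocks of length [n]. *)
Let avg_le m n : (0 < m)%N -> (0 < n)%N -> (a m - C) / m%:R <= a n / n%:R.
Proof.
move=> m0 n0; rewrite ler_pdivrMr ?ltr0n // mulrAC ler_pdivlMr ?ltr0n //.
have := aM_le m n0; have := aM_ge n m0; have := aM_ge m n0; have := aM_le n m0.
rewrite [(n * m)%N]mulnC [_ * n%:R]mulrC [_ * m%:R]mulrC.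
by move=> *; lra.
Qed.

(** Fekete's lemma with a bounded defect. The bounds for each single [n], with an error that does
    not grow, are what later allows the pressure to be tested on words of one length. *)
Lemma quasi_additive_cvg : exists P : R,
  (a n / n%:R @[n --> \oo] --> P) /\
  forall n, (0 < n)%N -> n%:R * P <= a n /\ a n <= n%:R * P + C.
Proof.
set A := [set (a n - C) / n%:R | n in [set n | (0 < n)%N]].
have An : A !=set0 by exists ((a 1 - C) / 1), 1%N.
have Au : has_ubound A by exists (a 1 / 1%:R) => _ [m m0 <-]; exact: avg_le.
have h1 n : (0 < n)%N -> sup A <= a n / n%:R.
  by move=> n0; apply: ge_sup => // _ [m m0 <-]; exact: avg_le.
have h2 n : (0 < n)%N -> (a n - C) / n%:R <= sup A.
  by move=> n0; apply: ub_le_sup => //; exists n.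
exists (sup A); split; last first.
  move=> n n0; have := h1 _ n0; have := h2 _ n0.
  rewrite ler_pdivrMr ?ltr0n // ler_pdivlMr ?ltr0n //.
  by move=> *; split; lra.
have lim : sup A + C * n.+1%:R^-1 @[n --> \oo] --> sup A.
  rewrite -[X in _ --> X]addr0 -[X in _ + X](mulr0 C).
  apply: cvgD; first exact: cvg_cst.
  by apply: cvgM; [exact: cvg_cst|exact: cvg_harmonic].
(* The shift avoids the index 0, where the averages are not controlled. *)
rewrite -(cvg_shiftS (fun n => a n / n%:R)).
apply: squeeze_cvgr lim; last exact: (cvg_cst (sup A)).
apply: nearW => n; rewrite h1 //= .
by have := h2 n.+1 isT; rewrite mulrBl lerBlDr.
Qed.

End Quasi_additive.

(** * Collisions and separated families *)

Section Finite_sums.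
Context {R : realType}.

Lemma cauchy_schwarz_sum (K : finType) (m : K -> R) :
  (\sum_k m k) ^+ 2 <= #|K|%:R * \sum_k m k ^+ 2.
Proof.
have [K0|K0] := eqVneq #|K| 0%N.
  by rewrite !big_pred0 ?K0 ?expr0n ?mul0r // => k; have := fintype0 k K0.
set S := \sum_k m k; set N : R := #|K|%:R.
have N0 : 0 < N by rewrite ltr0n lt0n.
(* The variance of [m], scaled by the number of terms to avoid a division. *)
have : 0 <= \sum_k (N * m k - S) ^+ 2 by apply: sumr_ge0 => k _; exact: sqr_ge0.
have -> : \sum_k (N * m k - S) ^+ 2 = N * (N * (\sum_k m k ^+ 2) - S ^+ 2).
  under eq_bigr do rewrite sqrrB exprMn.
  rewrite big_split sumrB /= -mulr_sumr sumr_const -/N.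
  have -> : \sum_k N * m k * S *+ 2 = N * S * S *+ 2.
    by rewrite sumrMnl -mulr_suml -mulr_sumr.
  rewrite -[S ^+ 2 *+ _]mulr_natl -/N; ring.
by rewrite pmulr_rge0 // subr_ge0.
Qed.

(* Cauchy-Schwarz, applied to the number of elements with a given key. *)
Lemma card_sqr_le_collisions (P K : finType) (A : pred P) (key : P -> K) :
  (\sum_(p | A p) 1) ^+ 2 <=
  #|K|%:R * \sum_(p | A p) \sum_(q | A q && (key p == key q)) 1 :> R.
Proof.
pose m k : R := \sum_(p | A p && (key p == k)) 1.
rewrite (partition_big key predT) //= -/m.
apply: le_trans (cauchy_schwarz_sum m) _; rewrite ler_wpM2l //.
rewrite [leRHS](partition_big key predT) //=; apply: ler_sum => k _.
rewrite expr2 {1}/m mulr_suml; apply: ler_sum => p /andP[_ /eqP pk].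
rewrite mul1r; apply/le_of_eq/eq_bigl => q; by rewrite pk eq_sym.
Qed.

(** Cordoba's argument in abstract form: [T] indexes the tubes, ['I_M] the columns, and [key]
    records where a hit is seen. Equal keys force equal columns and closeness, so collisions are
    counted by [close]: the diagonal pairs give the number of hits, the others at most [g k l]. As
    [g] is symmetric, a pair may be charged to its member with the larger [a], at the cost of the
    factor 2. *)
Lemma collision_bound (T K : finType) (M : nat) (hit : T -> 'I_M -> bool)
    (close : T -> T -> 'I_M -> bool) (key : T * 'I_M -> K) (a : T -> R)
    (g : T -> T -> R) (G : T -> R) :
  (forall k l i j, hit k i -> hit l j -> key (k, i) = key (l, j) ->
     i = j /\ close k l i) ->
  (forall k l, k != l ->
     \sum_(j | [&& hit k j, hit l j & close k l j]) 1 <= g k l) ->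
  (forall k l, 0 <= g k l) -> (forall k l, g k l = g l k) ->
  (forall k, \sum_(l | (l != k) && (a l <= a k)) g k l <= G k) ->
  (\sum_k \sum_(j | hit k j) 1) ^+ 2 <=
    #|K|%:R * (\sum_k \sum_(j | hit k j) 1 + 2 * \sum_k G k).
Proof.
move=> hk hg g0 gC hG.
pose A (p : T * 'I_M) := hit p.1 p.2.
have HE : \sum_k \sum_(j | hit k j) 1 = \sum_(p | A p) 1 :> R.
  by rewrite (pair_big_dep xpredT hit (fun _ _ => 1)).
rewrite {1}HE; apply: le_trans (card_sqr_le_collisions A key) _.
rewrite ler_wpM2l //.
pose c k l : R := \sum_(j | [&& hit k j, hit l j & close k l j]) 1.
apply: (@le_trans _ _ (\sum_k \sum_l c k l)).
  rewrite (eq_big (fun p => xpredT p.1 && hit p.1 p.2)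
    (fun p => \sum_(q | A q && (key (p.1, p.2) == key q)) 1)) //; last by case.
  rewrite -(pair_big_dep xpredT hit
    (fun k j => \sum_(q | A q && (key (k, j) == key q)) 1)) /=.
  apply: ler_sum => k _; rewrite /c.
  under [leRHS]eq_bigr => l _ do rewrite big_mkcondr /=.
  rewrite exchange_big /=; apply: ler_sum => i ki.
  rewrite (eq_bigl (fun q => xpredT q.1 &&
    (hit q.1 q.2 && (key (k, i) == key (q.1, q.2))))); last by case.
  rewrite -(pair_big_dep xpredT (fun l j => hit l j && (key (k, i) == key (l, j)))
    (fun _ _ => 1)) /=.
  apply: ler_sum => l _.
  (* A collision forces [j = i], so for each tube [l] at most one column contributes. *)
  apply: (@le_trans _ _ (\sum_(j | j == i) (if hit l i && close k l i then 1 else 0)));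
    last by rewrite big_pred1_eq.
  rewrite big_mkcond [leRHS]big_mkcond; apply: ler_sum => j _.
  case: ifP => [/andP[lj /eqP e]|_]; last by case: ifP => // _; case: ifP.
  by have [ij cl] := hk _ _ _ _ ki lj e; rewrite -ij in lj *; rewrite eqxx lj cl.
apply: (@le_trans _ _ (\sum_k (\sum_(j | hit k j) 1 + \sum_(l | l != k) g k l))).
  apply: ler_sum => k _; rewrite (bigD1 k) //=; apply: lerD.
    rewrite /c big_mkcond [leRHS]big_mkcond; apply: ler_sum => j _.
    by case: ifP => [/and3P[-> _ _]//|_]; case: ifP.
  by apply: ler_sum => l lk; apply: hg; rewrite eq_sym.
rewrite big_split lerD2l /=.
apply: (@le_trans _ _ (\sum_k \sum_(l | (l != k) && (a l <= a k)) g k l +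
    \sum_k \sum_(l | (l != k) && (a k <= a l)) g k l)).
  rewrite -big_split; apply: ler_sum => k _ /=.
  rewrite big_mkcond [X in _ <= X + _]big_mkcond [X in _ <= _ + X]big_mkcond -big_split /=.
  apply: ler_sum => l _; case: (l != k) => /=; last by rewrite addr0.
  have := le_total (a l) (a k); have := g0 k l.
  by case: (a l <= a k); case: (a k <= a l) => //= ? _; lra.
have -> : \sum_k \sum_(l | (l != k) && (a k <= a l)) g k l =
    \sum_k \sum_(l | (l != k) && (a l <= a k)) g k l.
  rewrite (exchange_big_dep xpredT) //=; apply: eq_bigr => l _.
  by apply: eq_big => k; rewrite 1?eq_sym // gC.
rewrite -mulr2n -[_ *+ 2]mulr_natl ler_pM2l //; apply: ler_sum => k _; exact: hG.
Qed.

Lemma harmonic_sum_le (n : nat) :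
  \sum_(k < n.+1) (k.+1%:R)^-1 <= 1 + ln n.+1%:R :> R.
Proof.
elim: n => [|n IH]; first by rewrite big_ord1 invr1 ln1 addr0.
rewrite big_ord_recr /= (le_trans (lerD IH (lexx _))) // -addrA lerD2l.
have n0 : 0 < n.+2%:R :> R by rewrite ltr0n.
have -> : n.+1%:R = n.+2%:R * (1 - n.+2%:R^-1) :> R.
  by rewrite mulrBr mulr1 mulfV ?gt_eqF // -[n.+2%:R]natr1 addrK.
have u : 0 < 1 - n.+2%:R^-1 :> R.
  by rewrite subr_gt0 invf_lt1 // ltr1n.
rewrite lnM ?posrE //.
have := @le_ln1Dx R (- n.+2%:R^-1); rewrite ltrN2 invf_lt1 // ltr1n => /(_ isT).
by move: (n.+2%:R^-1) => v h; move: (ln n.+2%:R) (ln (1 - v)) h => a b; lra.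
Qed.

(** Separated points are determined by their sign and by the integer part of |x| / d, so each shell
    of width [d] contains at most two of them and the sum is dominated by twice a harmonic sum. *)
Lemma recip_sum_le (T : finType) (Q : pred T) (x : T -> R) (d X : R) :
  0 < d -> d <= X ->
  (forall i, Q i -> d <= `|x i| <= X) ->
  (forall i j, Q i -> Q j -> i != j -> d <= `|x i - x j|) ->
  \sum_(i | Q i) `|x i|^-1 <= 2 / d * (1 + ln (X / d)).
Proof.
move=> d0 dX hx sep.
have Xd : 1 <= X / d by rewrite ler_pdivlMr // mul1r.
have X0 : 0 <= X / d by rewrite (le_trans _ Xd).
pose M := (Num.truncn (X / d)).-1.
have ME : M.+1 = Num.truncn (X / d) by rewrite prednK // truncn_gt0.
pose n i := Num.truncn (`|x i| / d).
have n0 i : 0 <= `|x i| / d by rewrite divr_ge0 // ltW.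
have n1 i : Q i -> (0 < n i)%N.
  by move=> /hx /andP[h _]; rewrite truncn_gt0 ler_pdivlMr // mul1r.
have nM i : Q i -> (n i <= M.+1)%N.
  by move=> /hx /andP[_ h]; rewrite ME le_truncn // ler_pM2r ?invr_gt0.
have kM i : Q i -> ((n i).-1 < M.+1)%N by move=> Qi; rewrite prednK ?nM ?n1.
(* The integer part is at least 1, and the ordinal starts at 0; hence the predecessor here and the
   successor in [g]. *)
pose key i : bool * 'I_M.+1 := (x i < 0, inord (n i).-1).
have keyinj : {in Q &, injective key}.
  move=> i j; rewrite !unfold_in => Qi Qj [sg /(congr1 val) /=].
  rewrite !inordK ?kM // => ne.
  have nE : n i = n j by rewrite -(prednK (n1 _ Qi)) ne (prednK (n1 _ Qj)).
  apply/eqP; apply: contraT => /(sep _ _ Qi Qj).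
  have /andP[a1 a2] := truncn_itv (n0 i); have /andP[b1 b2] := truncn_itv (n0 j).
  rewrite -/(n i) nE in a1 a2; rewrite -/(n j) in b1 b2.
  move: a1 a2 b1 b2; rewrite !ler_pdivlMr // !ltr_pdivrMr // -natr1 mulrDl mul1r.
  move: sg; case: (ltrP (x i) 0) => xi; case: (ltrP (x j) 0) => xj // _.
    rewrite (ltr0_norm xi) (ltr0_norm xj) => a1 a2 b1 b2.
    by rewrite leNgt => /negP[]; rewrite ltr_norml; apply/andP; split; lra.
  rewrite (ger0_norm xi) (ger0_norm xj) => a1 a2 b1 b2.
  by rewrite leNgt => /negP[]; rewrite ltr_norml; apply/andP; split; lra.
pose g (k : bool * 'I_M.+1) : R := (d * k.2.+1%:R)^-1.
have g0 k : 0 <= g k by rewrite invr_ge0 mulr_ge0 // ltW.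
apply: (@le_trans _ _ (\sum_(i | Q i) g (key i))).
  apply: ler_sum => i Qi; rewrite /g /= inordK ?kM // prednK ?n1 //.
  have x0 : 0 < `|x i| by have /andP[h _] := hx _ Qi; rewrite (lt_le_trans d0).
  rewrite lef_pV2 ?posrE // ?mulr_gt0 ?ltr0n ?n1 // mulrC -ler_pdivlMr //.
  by have /andP[] := truncn_itv (n0 i).
apply: (@le_trans _ _ (\sum_k g k)).
  rewrite -(big_imset g keyinj) /= big_mkcond; apply: ler_sum => k _.
  by case: ifP.
rewrite -(pair_bigA _ (fun (b : bool) (k : 'I_M.+1) => g (b, k))) /=.
rewrite big_bool /g /=.
have -> : \sum_(k < M.+1) (d * k.+1%:R)^-1 = d^-1 * \sum_(k < M.+1) (k.+1%:R)^-1.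
  by rewrite mulr_sumr; apply: eq_bigr => k _; rewrite invfM.
have h := harmonic_sum_le M.
have h2 : ln M.+1%:R <= ln (X / d).
  rewrite ler_ln ?posrE ?ltr0n // ?(lt_le_trans _ Xd) // ME.
  by have /andP[] := truncn_itv X0.
have di : 0 < d^-1 by rewrite invr_gt0.
rewrite -mulr2n -[_ *+ 2]mulr_natl mulrA ler_pM2l ?mulr_gt0 //.
exact: le_trans h (lerD _ _).
Qed.

Lemma card_ord_diam_le (M : nat) (A : pred 'I_M) (L : R) : 0 <= L ->
  (forall i j, A i -> A j -> `|(i : nat)%:R - (j : nat)%:R| <= L) ->
  \sum_(i | A i) 1 <= L + 1.
Proof.
move=> L0 h.
have [i0 Ai0|none] := pickP A; last by rewrite big_pred0 // addr_ge0.
case: (arg_minnP (fun i : 'I_M => (i : nat)) Ai0) => i1 Ai1 min1.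
case: (arg_maxnP (fun i : 'I_M => (i : nat)) Ai0) => i2 Ai2 max2.
rewrite sumr_const.
have c : (#|A| <= (i2 - i1).+1)%N.
  rewrite -[leqRHS]card_ord.
  apply: (@leq_card_in _ _ (fun i : 'I_M => inord (i - i1) : 'I_(i2 - i1).+1)) => i j.
  rewrite !unfold_in => Ai Aj; move/(congr1 val) => /=.
  rewrite !inordK ?ltnS ?leq_sub2r //; [|exact: max2|exact: max2] => e.
  by apply/val_inj => /=; rewrite -(subnK (min1 _ Ai)) e subnK // min1.
apply: (@le_trans _ _ (i2 - i1).+1%:R); first by rewrite ler_nat.
rewrite -natr1 lerD2r natrB ?min1 //.
by apply: le_trans (h _ _ Ai2 Ai1); exact: ler_norm.
Qed.

Lemma measure_finite_cover (P : set R) (T : choiceType) (s : seq T) (c l : T -> R) :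
  measurable P -> (forall i, 0 <= l i) ->
  P `<=` [set x | exists2 i, i \in s & `|x - c i| <= l i] ->
  (lebesgue_measure P <= (\sum_(i <- s) 2 * l i)%:E)%E.
Proof.
move=> mP l0 hP.
pose J i : set R := `[c i - l i, c i + l i]%classic.
have mJ (r : seq T) : measurable (\big[setU/set0]_(i <- r) J i).
  by apply: bigsetU_measurable => i _; exact: measurable_itv.
have hJ : (lebesgue_measure (\big[setU/set0]_(i <- s) J i) <= (\sum_(i <- s) 2 * l i)%:E)%E.
  elim: s {hP} => [|i s IH]; first by rewrite !big_nil measure0.
  rewrite !big_cons EFinD.
  apply: (@le_trans _ _ (lebesgue_measure (J i) +
      lebesgue_measure (\big[setU/set0]_(j <- s) J j))%E).
    by apply: measureU2; [exact: measurable_itv|exact: mJ].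
  apply: leeD IH; rewrite lebesgue_measure_itv /= lte_fin.
  case: ifP => _; last by rewrite lee_fin mulr_ge0.
  by rewrite -EFinB lee_fin; have := l0 i; lra.
have sub : P `<=` \big[setU/set0]_(i <- s) J i; last first.
  by apply: le_trans hJ; apply: le_measure; rewrite ?inE //; exact: mJ.
move=> x /hP[i si xi]; rewrite -bigcup_seq; exists i => //.
by rewrite /J /= in_itv /=; move: xi; rewrite ler_norml; lra.
Qed.

(** The intervals of length [rho i] centred at [x i] are disjoint, because the distance of two
    centres exceeds neither radius condition: it is at least both [rho i] and [rho j], hence at
    least their mean. They all lie in an interval of length [2 + L]. *)
Lemma separated_sum_le (T : finType) (x rho : T -> R) (L : R) :
  (forall i, `|x i| <= 1) -> (forall i, 0 < rho i <= L) -> 0 <= L ->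
  (forall i j, i != j -> rho i <= `|x i - x j|) ->
  \sum_i rho i <= 2 + L.
Proof.
move=> x1 r L0 sep.
pose J i : set R := `]x i - rho i / 2, x i + rho i / 2[%classic.
have mJ (s : seq T) : measurable (\big[setU/set0]_(i <- s) J i).
  by apply: bigsetU_measurable => i _; exact: measurable_itv.
have hJ (s : seq T) : uniq s ->
    lebesgue_measure (\big[setU/set0]_(i <- s) J i) = (\sum_(i <- s) rho i)%:E.
  elim: s => [|i s IH]; first by rewrite !big_nil measure0.
  move=> /andP[si us]; rewrite !big_cons EFinD -IH //.
  have -> : (rho i)%:E = lebesgue_measure (J i).
    rewrite lebesgue_measure_itv /= lte_fin; have /andP[ri _] := r i.
    by rewrite ifT; [rewrite -EFinB; congr EFin; field|lra].
  apply: measureU; first exact: measurable_itv.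
    exact: mJ.
  rewrite -subset0 => y [] /= yi; rewrite -bigcup_seq => -[j /= sj].
  move: yi; rewrite /J /= !in_itv /= => /andP[i1 i2] /andP[j1 j2].
  have ij : i != j by apply: contraNneq si => ->.
  have := sep _ _ ij; rewrite eq_sym in ij; have := sep _ _ ij.
  have : `|x i - x j| < (rho i + rho j) / 2 by rewrite ltr_norml; lra.
  by rewrite distrC; lra.
have := hJ (index_enum T) (index_enum_uniq T).
set U := \big[setU/set0]_(i <- _) _ => e.
pose V : set R := `[- (1 + L / 2), 1 + L / 2]%classic.
have : (lebesgue_measure U <= lebesgue_measure V)%E.
  apply: le_measure; rewrite ?inE; [exact: mJ|exact: measurable_itv|].
  move=> y; rewrite /U -bigcup_seq => -[i _].
  rewrite /J /V /= !in_itv /= => /andP[i1 i2].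
  by have := x1 i; have := r i; rewrite ler_norml; lra.
rewrite e lebesgue_measure_itv /= lte_fin ifT; last by lra.
by rewrite -EFinB lee_fin; lra.
Qed.

End Finite_sums.

(** * Products of matrices preserving a cone *)

Section Words.
Context {R : realType} {kappa : nat}.
Variable f : affine_maps R kappa.
Implicit Types (u v w : seq 'I_kappa) (p q : R).

Lemma word_mx0 : word_mx f [::] = 1%:M.
Proof. by rewrite /word_mx big_nil. Qed.

Lemma word_mx_cons i w : word_mx f (i :: w) = linpart f i *m word_mx f w.
Proof. by rewrite /word_mx big_cons. Qed.

Lemma word_mx1 i : word_mx f [:: i] = linpart f i.
Proof. by rewrite word_mx_cons word_mx0 mulmx1. Qed.

Lemma word_mx_cat u v : word_mx f (u ++ v) = word_mx f u *m word_mx f v.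
Proof. by rewrite /word_mx big_cat. Qed.

(** The quantitative content of the cone condition, phrased so that nearby systems satisfy it with
    the same [th] and [s]. *)
Definition cone_ifs th s abar := [/\ enorm th = 1, 0 < s, s < 1, abar < 1 &
  forall i, [/\ linpart f i \in unitmx, alpha1 (linpart f i) <= abar &
                strict_cone th s (linpart f i)]].

Variables (th : 'cV[R]_2) (s abar : R).
Hypothesis cif : cone_ifs th s abar.

Let K := closed_cone th s.

Definition cone_const := (1 - s ^+ 2) / 36.

(* [(p, q)] equal to [(t, 0)], [(2 - t, t - 1)] and [(0, t / 2)] gives the three
   regimes of [sing_val_fun t]. *)
Definition psi (p q : R) w := alpha1 (word_mx f w) `^ p * `|\det (word_mx f w)| `^ q.

Lemma word_unit w : word_mx f w \in unitmx.
Proof.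
have [_ _ _ _ h] := cif; elim: w => [|i w IH]; first by rewrite word_mx0 unitmx1.
by rewrite word_mx_cons unitmx_mul IH andbT; have [] := h i.
Qed.

Lemma word_cone_inv w : cone_inv th s (word_mx f w) /\ cone_inv th s (word_mx f w)^T.
Proof.
have [th1 s0 s1 _ h] := cif; elim: w => [|i w [IH IH']].
  by rewrite word_mx0 trmx1; split=> x; rewrite mul1mx.
have [Au _ Ac] := h i; have [ci ciT _] := strict_cone_dominant th1 s0 s1 Au Ac.
rewrite word_mx_cons trmx_mul; split=> x Kx; rewrite -mulmxA.
  exact/ci/IH.
exact/IH'/ciT.
Qed.

Lemma word_dominant w : diag_dominant th s (word_mx f w).
Proof.
have [th1 s0 s1 _ h] := cif; have [c c'] := word_cone_inv w.
exact: (cone_inv_dominant th1 s0 s1 (word_unit w)).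
Qed.

Lemma alpha1_word_gt0 w : 0 < alpha1 (word_mx f w).
Proof. exact/alpha1_gt0/word_unit. Qed.

Lemma det_word_gt0 w : 0 < `|\det (word_mx f w)|.
Proof. by rewrite normr_gt0 -unitfE -unitmxE word_unit. Qed.

Lemma alpha1_word_cat u v :
  alpha1 (word_mx f (u ++ v)) <= alpha1 (word_mx f u) * alpha1 (word_mx f v).
Proof. by rewrite word_mx_cat alpha1M. Qed.

Lemma alpha1_word_cat_ge u v :
  cone_const * (alpha1 (word_mx f u) * alpha1 (word_mx f v)) <= alpha1 (word_mx f (u ++ v)).
Proof.
have [th1 s0 s1 _ _] := cif.
by rewrite word_mx_cat; apply: (dominant_alpha1M th1 s0 s1); exact: word_dominant.
Qed.

Lemma det_word_cat u v : `|\det (word_mx f (u ++ v))| =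
  `|\det (word_mx f u)| * `|\det (word_mx f v)|.
Proof. by rewrite word_mx_cat det_mulmx normrM. Qed.

Lemma cone_const_gt0 : 0 < cone_const.
Proof.
by have [_ s0 s1 _ _] := cif; rewrite divr_gt0 // subr_gt0 exprn_ilt1 // ltW.
Qed.

Lemma cone_const_le1 : cone_const <= 1.
Proof. by rewrite /cone_const; have := sqr_ge0 s; lra. Qed.

Lemma alpha1_word_le_exp w : alpha1 (word_mx f w) <= abar ^+ size w.
Proof.
have [_ _ _ _ h] := cif; elim: w => [|i w IH]; first by rewrite word_mx0 alpha1_1.
rewrite word_mx_cons exprS (le_trans (alpha1M _ _)) //.
by apply: ler_pM; rewrite ?alpha1_ge0 //; have [] := h i.
Qed.

Lemma abar_gt0 (i : 'I_kappa) : 0 < abar.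
Proof. by have [_ _ _ _ /(_ i) [/alpha1_gt0 ai b _]] := cif; rewrite (lt_le_trans ai). Qed.

Lemma alpha1_word_le1 w : alpha1 (word_mx f w) <= 1.
Proof.
case: w => [|i w]; first by rewrite word_mx0 alpha1_1.
have [_ _ _ ab _] := cif; have a0 := abar_gt0 i.
by rewrite (le_trans (alpha1_word_le_exp _)) // exprn_ile1 // ltW.
Qed.

Lemma det_word_le w : `|\det (word_mx f w)| <= alpha1 (word_mx f w) ^+ 2.
Proof. exact: det_le_alpha1. Qed.

Lemma det_word_le_alpha1 w : `|\det (word_mx f w)| <= alpha1 (word_mx f w).
Proof.
rewrite (le_trans (det_word_le w)) // expr2 ler_piMl ?alpha1_ge0 //.
exact: alpha1_word_le1.
Qed.

Lemma det_word_le1 w : `|\det (word_mx f w)| <= 1.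
Proof. exact: le_trans (det_word_le_alpha1 w) (alpha1_word_le1 w). Qed.

Lemma psi_gt0 p q w : 0 < psi p q w.
Proof. by rewrite mulr_gt0 ?powR_gt0 ?alpha1_word_gt0 ?det_word_gt0. Qed.

Lemma psi_ge0 p q w : 0 <= psi p q w.
Proof. exact/ltW/psi_gt0. Qed.

Lemma psi_cat_le p q u v : 0 <= p -> psi p q (u ++ v) <= psi p q u * psi p q v.
Proof.
move=> p0; rewrite /psi det_word_cat powRM // mulrACA ler_pM2r; last first.
  by rewrite mulr_gt0 ?powR_gt0 ?det_word_gt0.
rewrite -powRM ?alpha1_ge0 // ge0_ler_powR ?nnegrE ?mulr_ge0 ?alpha1_ge0 //.
exact: alpha1_word_cat.
Qed.

(** The determinant is multiplicative, so a constant is lost only in the power of [alpha1]; since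
    [p <= 1] and [cone_const <= 1], the loss is at most [cone_const], uniformly in [p] and [q]. *)
Lemma psi_cat_ge p q u v : 0 <= p -> p <= 1 ->
  cone_const * (psi p q u * psi p q v) <= psi p q (u ++ v).
Proof.
move=> p0 p1; have c0 := cone_const_gt0; have c1 := cone_const_le1.
have h := alpha1_word_cat_ge u v; move: cone_const c0 c1 h => c c0 c1 h.
rewrite /psi det_word_cat [in leRHS]powRM // [X in c * X]mulrACA [leLHS]mulrA.
rewrite ler_pM2r; last by rewrite mulr_gt0 ?powR_gt0 ?det_word_gt0.
rewrite -powRM ?alpha1_ge0 //.
apply: (@le_trans _ _ ((c * (alpha1 (word_mx f u) * alpha1 (word_mx f v))) `^ p)).
  rewrite [leRHS]powRM ?mulr_ge0 ?alpha1_ge0 ?(ltW c0) // ler_wpM2r ?powR_ge0 //.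
  by rewrite -[leLHS]powRr1 ?(ltW c0) //; apply: ger_powR => //; rewrite c0.
by rewrite ge0_ler_powR ?nnegrE ?mulr_ge0 ?alpha1_ge0 ?(ltW c0).
Qed.

Section Pressure.
Hypothesis k0 : (0 < kappa)%N.

Lemma wsum_psi_gt0 p q n : 0 < wsum n (psi p q).
Proof. by apply: wsum_gt0; [rewrite card_ord|move=> w; exact: psi_gt0]. Qed.

Lemma psi_pressure p q : 0 <= p -> p <= 1 -> exists P : R,
  (ln (wsum n (psi p q)) / n%:R @[n --> \oo] --> P) /\
  forall n, (0 < n)%N -> n%:R * P <= ln (wsum n (psi p q)) /\
    ln (wsum n (psi p q)) <= n%:R * P - ln cone_const.
Proof.
move=> p0 p1; apply: (@quasi_additive_cvg _ (fun n => ln (wsum n (psi p q))) (- ln cone_const)).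
- by rewrite oppr_ge0 ln_le0 // cone_const_le1.
- move=> m n; rewrite -lnM ?posrE ?wsum_psi_gt0 //.
  rewrite ler_ln ?posrE ?mulr_gt0 ?wsum_psi_gt0 //.
  by apply: wsumM_le => u v; exact: psi_cat_le.
- move=> m n; rewrite opprK.
  have := @wsumM_ge _ _ m n _ _ (fun u v => @psi_cat_ge p q u v p0 p1).
  have := cone_const_gt0; move: cone_const => c c0 h.
  rewrite addrC -!lnM ?posrE ?mulr_gt0 ?wsum_psi_gt0 //.
  by rewrite ler_ln ?posrE ?mulr_gt0 ?wsum_psi_gt0.
Qed.

End Pressure.

Hypothesis dis : forall i j, i != j ->
  (mulmx (linpart f i) @` K) `&` (mulmx (linpart f j) @` K) `<=` [set 0].

(** The common prefix is invertible and cancels; at the first differing letter the tails still map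
    the cone into itself, so the disjointness for single letters applies. *)
Lemma word_cone_disjoint u v : diverge u v ->
  (mulmx (word_mx f u) @` K) `&` (mulmx (word_mx f v) @` K) `<=` [set 0].
Proof.
elim: u v => [|i u IH] [|j v]; rewrite /diverge /= ?eqxx //=.
move=> h z [[x Kx xz] [y Ky yz]].
rewrite !word_mx_cons -!mulmxA in xz yz.
have [ij|ij] := eqVneq i j; last first.
  apply: (dis ij); split.
    by exists (word_mx f u *m x) => //; exact: (word_cone_inv u).1.
  by exists (word_mx f v *m y) => //; exact: (word_cone_inv v).1.
rewrite -ij in yz h; rewrite eqxx /= in h.
have [_ _ _ _ /(_ i) [Au _ _]] := cif.
have e : word_mx f u *m x = word_mx f v *m y by rewrite -[LHS](mulKmx Au) xz -yz mulKmx.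
have /= -> : z = linpart f i *m (word_mx f u *m x) by [].
have /= -> : word_mx f u *m x = 0; last by rewrite mulmx0.
by apply: (IH v h); split; [exists x|exists y].
Qed.

Lemma word_slope_separation u v : diverge u v ->
  slope_radius th s (word_mx f u) < `|slope th (word_mx f u) - slope th (word_mx f v)|.
Proof.
move=> h; have [th1 s0 s1 _ _] := cif.
apply: (slope_separation th1 s0 s1) (word_unit u) (word_dominant u) (word_dominant v) _.
exact: word_cone_disjoint.
Qed.

Lemma size_diverge u v : size u = size v -> u != v -> diverge u v.
Proof.
elim: u v => [|i u IH] [|j v] //= [e]; rewrite /diverge /= eqseq_cons (eq_sym j).
by case: eqP => //= _; exact: IH.
Qed.

Lemma slope_radius_word_ge w :
  s / 2 * (`|\det (word_mx f w)| / alpha1 (word_mx f w) ^+ 2) <= slope_radius th s (word_mx f w).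
Proof.
have [th1 s0 s1 _ _] := cif; have [n _ _ _] := word_dominant w.
have h : m11 th (word_mx f w) ^+ 2 <= alpha1 (word_mx f w) ^+ 2.
  by rewrite -(real_normK (num_real (m11 _ _))) ler_pXn2r ?nnegrE ?alpha1_ge0 // m11_le.
have n2 : 0 < m11 th (word_mx f w) ^+ 2 by rewrite exprn_even_gt0.
rewrite (_ : slope_radius _ _ _ =
  s / 2 * (`|\det (word_mx f w)| / m11 th (word_mx f w) ^+ 2)); last first.
  by rewrite /slope_radius; field.
have s2 : 0 < s / 2 by rewrite divr_gt0.
rewrite ler_pM2l // ler_pM2l ?det_word_gt0 //.
by rewrite lef_pV2 ?posrE // exprn_gt0 // alpha1_word_gt0.
Qed.

(** The slopes of the words of length [n] lie in an interval of length 2 and are separated by their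
    [slope_radius], so these radii have bounded sum; each is at least [s / 2] times |det| /
    alpha1^2, and [alpha1] is at most [abar ^+ n]. *)
Lemma wsum_det_le n : wsum n (fun w => `|\det (word_mx f w)|) <= 40 / s * (abar ^+ 2) ^+ n.
Proof.
have [th1 s0 s1 _ _] := cif.
pose r (w : n.-tuple 'I_kappa) := slope_radius th s (word_mx f w).
have h : \sum_w r w <= 2 + 18.
  apply: (@separated_sum_le R _ (fun w : n.-tuple 'I_kappa => slope th (word_mx f w))) => //.
  - by move=> w; rewrite (le_trans (slope_le (word_dominant w))) // ltW.
  - move=> w; rewrite (slope_radius_gt0 s0 (word_unit w) (word_dominant w)).
    by rewrite andTb /r (slope_radius_le th1 s1 (word_dominant w)).
  - move=> u v uv; apply/ltW/word_slope_separation/size_diverge; first by rewrite !size_tuple.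
    by rewrite -val_eqE in uv.
(* The empty word is treated apart, since positivity of [abar] is obtained from a letter. *)
case: n @r h => [|n] r h.
  rewrite wsum0 expr0 mulr1 (le_trans (det_word_le1 _)) // ler_pdivlMr //.
  by lra.
apply: (@le_trans _ _ (\sum_w r w * (2 / s * (abar ^+ 2) ^+ n.+1))).
  apply: ler_sum => w _; have := slope_radius_word_ge w; rewrite -/(r w).
  have k : alpha1 (word_mx f w) ^+ 2 <= (abar ^+ 2) ^+ n.+1.
    rewrite exprAC ler_pXn2r ?nnegrE ?alpha1_ge0 //; last first.
      by rewrite exprn_ge0 // ltW // (abar_gt0 (thead w)).
    by have := alpha1_word_le_exp w; rewrite size_tuple.
  have a0 : 0 < alpha1 (word_mx f w) ^+ 2 by rewrite exprn_gt0 // alpha1_word_gt0.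
  have s2 : 0 < s / 2 by rewrite divr_gt0.
  rewrite -ler_pdivlMl // ler_pdivrMr // => h2.
  apply: le_trans h2 _; rewrite invf_div -[leLHS]mulrA [leRHS]mulrCA.
  rewrite ler_pM2l ?divr_gt0 // ler_wpM2l //.
  exact/ltW/(slope_radius_gt0 s0 (word_unit w) (word_dominant w)).
rewrite -mulr_suml mulrA ler_wpM2r ?(exprn_ge0 _ (sqr_ge0 _)) //.
rewrite mulrA ler_pM2r ?invr_gt0 //; lra.
Qed.

End Words.

(** * Coverings of the invariant set *)

Lemma coverable_seq {R : realType} (E : set 'cV[R]_2) (r : R) (cs : seq 'cV[R]_2) :
  E `<=` [set x | exists2 c, c \in cs & enorm (x - c) <= r] -> coverable E r (size cs).
Proof.
move=> h; exists (fun i => nth 0 cs i) => x /h[c ci xc].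
have ic : (index c cs < size cs)%N by rewrite index_mem.
by exists (Ordinal ic); rewrite /= nth_index.
Qed.

Lemma dot_continuous {R : realType} (v : 'cV[R]_2) : continuous (dot v).
Proof.
have c i : continuous (fun y : 'cV[R]_2 => v i 0 * y i 0).
  by move=> x; apply: continuousM; [exact: cst_continuous|exact: coord_continuous].
have -> : dot v = ((fun y : 'cV[R]_2 => v 0 0 * y 0 0 : R^o) + (fun y : 'cV[R]_2 => v 1 0 * y 1 0 : R^o)).
  by apply/funext => y; rewrite dotE.
by move=> x; apply: continuousD; exact: c.
Qed.

Lemma eq_of_modn4 (i j : nat) : (i < j + 3)%N -> (j < i + 3)%N -> (i %% 4 = j %% 4)%N -> i = j.
Proof. by lia. Qed.

(** For [x] and [y] the values of [alpha1] on two tubes, [q] the determinant of the shorter one and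
    [e = d0 * r]: the slope radius of a shorter tube is bounded below in terms of the longer. *)
Lemma ratio_le_of_le {R : realType} (s e x y q : R) : 0 < s -> 0 < e -> 0 < x -> x <= y ->
  e * x <= q -> s * e / (2 * y) <= s / 2 * (q / x ^+ 2).
Proof.
move=> s0 e0 x0 xy h; have y0 := lt_le_trans x0 xy.
have -> : s * e / (2 * y) = s / 2 * (e / y) by field; rewrite gt_eqF.
rewrite ler_pM2l ?divr_gt0 // ler_pdivlMr ?exprn_gt0 //.
apply: le_trans h; rewrite expr2 mulrA ler_pM2r // mulrAC ler_pdivrMr //.
by rewrite ler_pM2l.
Qed.

(** The quadratic inequality of the counting argument, divided by the number of hits [H] once [V] is
    absorbed into it. Here [N] is the number of balls and 4 the number of column residues. *)
Lemma le_of_sqr_le_linear {R : realType} (H V N B c L : R) : 0 <= H -> 0 <= N -> 0 <= B -> 0 <= c ->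
  1 <= L -> V <= c * H -> H ^+ 2 <= N * 4 * (H + B * L * V) ->
  V <= 4 * c * (1 + B * c) * L * N.
Proof.
move=> H0 N0 B0 c0 L1 hV hH.
have L0 : 0 <= L by rewrite (le_trans _ L1).
have K0 : 0 <= 4 * N * ((1 + B * c) * L) by rewrite !mulr_ge0 // addr_ge0 // mulr_ge0.
suff h : H <= 4 * N * ((1 + B * c) * L).
  by apply: le_trans hV _; apply: le_trans (ler_wpM2l c0 h) _; apply: le_of_eq; ring.
have [->//|H1] := eqVneq H 0.
have {}H1 : 0 < H by rewrite lt_def H1.
rewrite -(ler_pM2r H1) -expr2; apply: le_trans hH _.
have h1 : B * L * V <= B * L * (c * H) by rewrite ler_wpM2l // mulr_ge0.
have h2 : H <= L * H by rewrite ler_peMl.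
apply: (@le_trans _ _ (N * 4 * (L * H + B * L * (c * H)))).
  by rewrite ler_wpM2l ?mulr_ge0 // lerD.
by apply: le_of_eq; ring.
Qed.

(** * Coverings by the tubes of the stopped words *)

Section Attractor.
Context {R : realType} {kappa : nat}.
Variables (f : affine_maps R kappa) (th : 'cV[R]_2) (s abar : R).
Hypothesis cif : cone_ifs f th s abar.
Variables (E : set 'cV[R]_2) (D d0 : R).
Hypotheses (Einv : is_invariant_set f E) (D1 : 1 <= D)
  (ED : forall x, E x -> enorm x <= D / 2) (d00 : 0 < d0) (d01 : d0 <= 1)
  (d0le : forall i, d0 <= `|\det (linpart f i)|).
Implicit Types (u v w : seq 'I_kappa) (x y : 'cV[R]_2) (r : R).

Definition act w x := foldr (fun i y => linpart f i *m y + transpart f i) x w.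

Lemma act_cat u v x : act (u ++ v) x = act u (act v x).
Proof. by rewrite /act foldr_cat. Qed.

Lemma actB w x y : act w x - act w y = word_mx f w *m (x - y).
Proof.
elim: w => [|i w IH]; first by rewrite word_mx0 mul1mx.
rewrite word_mx_cons -mulmxA -IH /= mulmxBr.
by rewrite opprD addrACA subrr addr0.
Qed.

Lemma act_mem w x : E x -> E (act w x).
Proof.
have [_ _ e] := Einv; move=> Ex; elim: w => [//|i w IH] /=.
by rewrite e; exists i => //; exists (act w x).
Qed.

Lemma act_cover w : (act w @` E) `<=` \bigcup_i (act (rcons w i) @` E).
Proof.
have [_ _ e] := Einv; move=> _ [x + <-]; rewrite {1}e => -[i _ [y Ey <-]].
by exists i => //; exists y => //; rewrite -cats1 act_cat.
Qed.

Lemma E_diam x y : E x -> E y -> enorm (x - y) <= D.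
Proof.
move=> /ED hx /ED hy; rewrite (le_trans (enormD _ _)) // enormN.
lra.
Qed.

(* That is, [alpha2 <= r]. *)
Definition stop r : pred (seq 'I_kappa) :=
  fun w => `|\det (word_mx f w)| <= r * alpha1 (word_mx f w).

Lemma stop_eventually r : 0 < r -> exists n, forall w, (n <= size w)%N -> stop r w.
Proof.
(* Without letters there is no word of positive length. *)
move=> r0; case: (pselect (exists i : 'I_kappa, True)) => [[i _]|none]; last first.
  by exists 1%N => -[|i w] //; case: none; exists i.
have a0 := abar_gt0 cif i; have [_ _ _ a1 _] := cif.
have : abar ^+ n @[n --> \oo] --> 0 by apply: cvg_expr; rewrite gtr0_norm.
move/cvgrPdist_lt => /(_ _ r0)[n _ hn]; exists n => w hw.
have := hn _ hw; rewrite /= sub0r normrN ger0_norm ?exprn_ge0 ?(ltW a0) // => h.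
rewrite /stop (le_trans (det_word_le _ _)) // expr2 ler_wpM2r ?alpha1_ge0 //.
exact: le_trans (alpha1_word_le_exp cif w) (ltW h).
Qed.

Section Radius.
Variables (r : R) (n : nat).
Hypotheses (r0 : 0 < r) (r1 : r < 1) (hn : forall w, (n <= size w)%N -> stop r w).

Let S := stopped (stop r) n [::].

Local Notation a w := (alpha1 (word_mx f w)).

Let a_gt0 w : 0 < a w. Proof. exact: (alpha1_word_gt0 cif). Qed.

Lemma stopped_det_le w : w \in S -> `|\det (word_mx f w)| <= r * a w.
Proof. by move=> wS; have := stopped_stop _ wS; rewrite /stop; apply; rewrite add0n. Qed.

(** The parent of a stopped word is not stopped, and one more letter costs the determinant at most
    the factor [d0] while [alpha1] does not grow. As [r < 1], the empty word is never stopped. *)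
Lemma stopped_det_ge w : w \in S -> (0 < size w)%N /\ d0 * r * a w <= `|\det (word_mx f w)|.
Proof.
move=> wS; case: (stopped_parent wS) => [w0|[u [i [-> su]]]].
  have := stopped_det_le wS; rewrite w0 word_mx0 det1 alpha1_1 normr1 mulr1.
  by rewrite leNgt r1.
split; first by rewrite size_rcons.
rewrite -cats1 (det_word_cat f) word_mx1.
move: su; rewrite /stop -ltNge => su.
apply: (@le_trans _ _ (`|\det (word_mx f u)| * d0)); last by rewrite ler_wpM2l.
rewrite (mulrC d0) mulrAC; apply: (ler_wpM2r (ltW d00)).
apply: le_trans (ltW su); apply: (ler_wpM2l (ltW r0)).
rewrite (le_trans (alpha1_word_cat f u [:: i])) //.
by rewrite ler_piMr ?alpha1_ge0 // (alpha1_word_le1 cif).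
Qed.

Lemma stopped_alpha1_ge w : w \in S -> d0 * r <= a w.
Proof.
move=> wS; have [_ h] := stopped_det_ge wS.
have := le_trans h (det_word_le f w).
by rewrite expr2 ler_pM2r.
Qed.

(** By [tube_width] the contraction across the tube is |det| / |m11|, at most [r] times alpha1 /
    |m11|; the last quotient is at most 6. *)
Lemma stopped_tube w x : w \in S ->
  `|dot (perp th) (word_mx f w *m x) - slope th (word_mx f w) * dot th (word_mx f w *m x)|
    <= 6 * r * enorm x.
Proof.
move=> wS; have [th1 s0 s1 _ _] := cif; have aA := word_dominant cif w; have [m0 _ _ _] := aA.
rewrite (tube_width th1) // normrM; apply: ler_pM => //; last exact: dot_perp_le.
rewrite normrM normfV ler_pdivrMr ?normr_gt0 //.
rewrite (le_trans (stopped_det_le wS)) // (_ : 6 * r * _ = r * (6 * `|m11 th (word_mx f w)|)); last by ring.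
by rewrite ler_pM2l // (dominant_alpha1 th1 s1 aA).
Qed.

(** For two points of a tube in one column. The axis coordinate contributes [r], the tube width
    [6 * r * D] and the slope another [r]; [1 <= D] absorbs them into [8 * D * r]. *)
Lemma stopped_enorm w x : w \in S -> enorm x <= D -> `|dot th (word_mx f w *m x)| <= r ->
  enorm (word_mx f w *m x) <= 8 * D * r.
Proof.
move=> wS xD h; have [th1 s0 s1 _ _] := cif.
have t := stopped_tube x wS; have sl := slope_le (word_dominant cif w).
rewrite (le_trans (enorm_le_coord th1 _)) //.
set z := _ *m x in h t *.
have h2 : `|dot (perp th) z| <= 6 * r * enorm x + r.
  rewrite -[dot (perp th) z](subrK (slope th (word_mx f w) * dot th z)).
  rewrite (le_trans (ler_normD _ _)) // lerD // normrM -[leRHS]mul1r.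
  by apply: ler_pM => //; rewrite (le_trans sl) // ltW.
have k : 6 * r * enorm x <= 6 * r * D by rewrite ler_wpM2l // mulr_ge0 // ltW.
have : r <= D * r by rewrite ler_peMl // ltW.
by lra.
Qed.

Lemma stopped_cover_invariant : E `<=` [set x | exists2 w, w \in S & (act w @` E) x].
Proof.
move=> x Ex; apply: (@stopped_cover _ _ _ (fun w => act w @` E) n [::] act_cover).
by exists x.
Qed.

(** Each tube is covered by balls centred at steps of [r] along its line. The one extra ball per
    tube is absorbed by [d0^-1], because [alpha1] of a stopped word is at least [d0 * r]. *)
Lemma cover_upper : exists2 N, coverable E (8 * D * r) N &
  N%:R <= (2 * D + d0^-1) * (\sum_(w <- S) a w / r).
Proof.
have [th1 s0 s1 _ _] := cif; have [[x0 Ex0] _ _] := Einv.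
pose sg w := slope th (word_mx f w).
pose m w := (Num.truncn (2 * a w * D / r)).+1.
(* The centres start at axis distance [a w * D] behind the image of [x0], as far as the tube can
   reach. *)
pose cen w (k : nat) := act w x0 + (k%:R * r - a w * D) *: (th + sg w *: perp th).
exists (size [seq cen w k | w <- S, k <- iota 0 (m w)]).
  apply: coverable_seq => p /stopped_cover_invariant[w wS [x Ex <-]].
  set u := dot th (word_mx f w *m (x - x0)).
  have hu : `|u| <= a w * D.
    rewrite (le_trans (dot_th_le th1 _)) // (le_trans (enorm_mulmx _ _)) //.
    by rewrite ler_wpM2l ?alpha1_ge0 // E_diam.
  have := hu; rewrite ler_norml => /andP[hu1 hu2].
  pose k := Num.truncn ((u + a w * D) / r).
  have p0 : 0 <= (u + a w * D) / r by rewrite divr_ge0 ?(ltW r0) //; lra.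
  have /andP[k1 k2] := truncn_itv p0.
  exists (cen w k).
    apply/allpairsPdep; exists w, k; split=> //.
    rewrite mem_iota /= add0n ltnS le_truncn // ler_pM2r ?invr_gt0 //; lra.
  rewrite /cen opprD addrA actB.
  move: k1 k2; rewrite -/k ler_pdivlMr // ltr_pdivrMr // -natr1 mulrDl mul1r => k1 k2.
  set q := k%:R * r - a w * D.
  have q1 : `|u - q| <= r by rewrite /q ler_norml; apply/andP; split; lra.
  rewrite (le_trans (enorm_le_coord th1 _)) // !dotBr !dotZr !dotDr !dotZr.
  rewrite dot_th_th // dot_th_perp dot_perp_th // dot_perp_perp // !mulr0 addr0 add0r !mulr1.
  rewrite -/u.
  have t := stopped_tube (x - x0) wS; rewrite -/u -/(sg w) in t.
  have sl : `|sg w| <= 1 by rewrite (le_trans (slope_le (word_dominant cif w))) // ltW.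
  set z := dot (perp th) _ in t *.
  have h2 : `|z - q * sg w| <= 6 * r * D + r.
    have -> : z - q * sg w = (z - sg w * u) + sg w * (u - q) by ring.
    rewrite (le_trans (ler_normD _ _)) // lerD //.
      by rewrite (le_trans t) // ler_wpM2l ?mulr_ge0 ?(ltW r0) // E_diam.
    by rewrite normrM -[leRHS]mul1r ler_pM.
  have : r <= D * r by rewrite ler_peMl // ltW.
  by lra.
rewrite size_allpairs_dep sumnE big_map natr_sum mulr_sumr.
rewrite big_seq [leRHS]big_seq; apply: ler_sum => w wS.
rewrite size_iota /m -natr1.
have h1 : 1 <= d0^-1 * (a w / r).
  by rewrite mulrA ler_pdivlMr // mul1r ler_pdivlMl // stopped_alpha1_ge.
have q0 : 0 <= 2 * a w * D / r.
  by rewrite divr_ge0 ?(ltW r0) // !mulr_ge0 ?alpha1_ge0 // (le_trans _ D1).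
have /andP[t1 _] := truncn_itv q0.
rewrite [leRHS]mulrDl; apply: lerD => //.
by apply: le_trans t1 _; apply: le_of_eq; ring.
Qed.

(** * Lower bound for the covering number *)

Section Lower_bound.
Variable rho : R.
Hypotheses (rho0 : 0 < rho) (proj : forall w, (0 < size w)%N ->
  [/\ enorm (theta1 (word_mx f w)) = 1,
      (word_mx f w)^T *m word_mx f w *m theta1 (word_mx f w) =
        alpha1 (word_mx f w) ^+ 2 *: theta1 (word_mx f w) &
      (rho%:E <= lebesgue_measure [set dot (theta1 (word_mx f w)) x | x in E])%E]).

Let M := (Num.truncn (2 * D / r)).+1.

(* The plane is cut into columns of width [r] orthogonal to [th]. *)
Definition column w x := Num.truncn ((dot th (act w x) + D) / r).

Definition hit w (j : 'I_M) := `[< exists2 x, E x & column w x = j >].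

(** A point of [E] before the action: it is its image under [act w] that lies in column [j]. The
    value is meaningful when [w] hits [j]. *)
Definition column_pt w (j : 'I_M) := xget 0 [set x | E x /\ column w x = j].

Lemma column_ptP w j : hit w j -> E (column_pt w j) /\ column w (column_pt w j) = j.
Proof.
move=> /asboolP[x Ex xj]; rewrite /column_pt.
by case: xgetP => [y -> []//|/(_ x)]; case.
Qed.

Lemma column_itv w x : E x ->
  (column w x)%:R * r <= dot th (act w x) + D < (column w x)%:R * r + r.
Proof.
move=> Ex; have [th1 _ _ _ _] := cif.
have := le_trans (dot_th_le th1 _) (ED (act_mem w Ex)).
rewrite ler_norml => /andP[h1 h2].
have p0 : 0 <= (dot th (act w x) + D) / r by rewrite divr_ge0 ?(ltW r0) //; have := D1; lra.
have := truncn_itv p0; rewrite -/(column w x).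
by rewrite ler_pdivlMr // ltr_pdivrMr // -natr1 mulrDl mul1r.
Qed.

Lemma column_lt w x : E x -> (column w x < M)%N.
Proof.
move=> Ex; have [th1 _ _ _ _] := cif.
have := le_trans (dot_th_le th1 _) (ED (act_mem w Ex)).
rewrite ler_norml => /andP[h1 h2].
by rewrite ltnS le_truncn // ler_pM2r ?invr_gt0 //; have := D1; lra.
Qed.

Lemma hit_column w x (Ex : E x) : hit w (Ordinal (column_lt w Ex)).
Proof. by apply/asboolP; exists x. Qed.

Lemma E_proj_measurable (v : 'cV[R]_2) : measurable [set dot v x | x in E].
Proof.
have [_ cE _] := Einv; apply: measurable_realfun.compact_measurable.
apply: continuous_compact cE; apply: continuous_subspaceT => x.
exact: dot_continuous.
Qed.

(** It is [E] itself that is projected, along the most expanded direction. Points sent into one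
    column have images within [8 * D * r], so their projections are within [8 * D * r / a w]; one
    such interval per hit column covers a set of measure at least [rho]. *)
Lemma hit_count_ge w : w \in S -> rho * (a w / r) <= 16 * D * (\sum_(j | hit w j) 1).
Proof.
move=> wS; have [wpos _] := stopped_det_ge wS; have [v1 vE vm] := proj wpos.
have [th1 s0 s1 _ _] := cif.
set v := theta1 _ in v1 vE vm.
have a0 := a_gt0 w.
have := @measure_finite_cover R _ 'I_M [seq j <- enum 'I_M | hit w j]
  (fun j => dot v (column_pt w j)) (fun=> 8 * D * r / a w) (E_proj_measurable v).
move=> /(_ _ _)/(le_trans vm).
have -> : \sum_(j <- [seq j <- enum 'I_M | hit w j]) 2 * (8 * D * r / a w)
    = (16 * D * r / a w) * \sum_(j | hit w j) 1.
  rewrite big_filter big_enum_cond /= mulr_sumr; apply: eq_bigr => j _.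
  by field; rewrite gt_eqF.
rewrite lee_fin => h.
have D0 : 0 <= D by rewrite (le_trans _ D1).
have {}h : rho <= 16 * D * r / a w * \sum_(j | hit w j) 1.
  apply: h; first by move=> _; rewrite divr_ge0 ?mulr_ge0 ?(ltW r0) ?(ltW a0).
  move=> _ [x Ex <-]; pose j := Ordinal (column_lt w Ex).
  have hj : hit w j := hit_column w Ex.
  exists j; first by rewrite mem_filter hj mem_enum.
  have [Ey yj] := column_ptP hj; set y := column_pt w j in Ey yj *.
  have c1 := column_itv w Ex; have c2 := column_itv w Ey.
  rewrite yj /= in c2.
  have hz : `|dot th (word_mx f w *m (x - y))| <= r.
    by rewrite -actB dotBr ler_norml; apply/andP; split; lra.
  have hz2 := stopped_enorm wS (E_diam Ex Ey) hz.
  (* Multiplied by [a w ^+ 2], the product with [v] becomes that of the images of [v] and [x - y],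
     since [v] is an eigenvector of the Gram matrix. *)
  rewrite -dotBr ler_pdivlMr // -(ler_pM2r a0) -[leLHS]mulrA -expr2.
  rewrite -[X in _ * X]gtr0_norm ?exprn_gt0 // -normrM mulrC -dotZl.
  rewrite -vE -mulmxA -dot_mulmx.
  rewrite (le_trans (dot_le _ _)) //.
  rewrite mulrC; apply: ler_pM; rewrite ?enorm_ge0 //.
  by have := enorm_mulmx (word_mx f w) v; rewrite v1 mulr1.
move: h; rewrite mulrAC ler_pdivlMr // mulrA ler_pdivrMr //.
by move=> h; apply: le_trans h _; apply: le_of_eq; ring.
Qed.

Hypothesis dis : forall i j, i != j ->
  (mulmx (linpart f i) @` closed_cone th s) `&` (mulmx (linpart f j) @` closed_cone th s)
    `<=` [set 0].

Let sg w := slope th (word_mx f w).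

Definition close w v j :=
  enorm (act w (column_pt w j) - act v (column_pt v j)) <= 2 * r.

(** Points at distance [2 * r], such as two points of one ball, lie in columns less than 3 apart, so
    the residue modulo 4 determines the column. *)
Lemma column_close w v x y : E x -> E y -> enorm (act w x - act v y) <= 2 * r ->
  (column w x %% 4 = column v y %% 4)%N -> column w x = column v y.
Proof.
move=> Ex Ey h; have [th1 _ _ _ _] := cif.
have := le_trans (dot_th_le th1 _) h; rewrite dotBr ler_norml => /andP[h1 h2].
have /andP[c1 c2] := column_itv w Ex; have /andP[c3 c4] := column_itv v Ey.
move: (column w x) (column v y) c1 c2 c3 c4 => i j c1 c2 c3 c4.
have ij : (i < j + 3)%N.
  by rewrite -(ltr_nat R) -(ltr_pM2r r0) natrD mulrDl; lra.
have ji : (j < i + 3)%N.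
  by rewrite -(ltr_nat R) -(ltr_pM2r r0) natrD mulrDl; lra.
exact: eq_of_modn4.
Qed.

(** Each tube follows a line, so where two tubes are close the difference of two affine functions is
    small; [b] is the difference of the intercepts, corrected for the shift by [D] in the numbering
    of columns. The errors are [2 * r] for closeness, [r] twice for the column and [6 * r * D] twice
    for the tubes. *)
Lemma close_line w v : w \in S -> v \in S -> exists b : R, forall j,
  hit w j -> hit v j -> close w v j ->
  `|(sg w - sg v) * ((j : nat)%:R * r) + b| <= 16 * D * r.
Proof.
move=> wS vS; have [th1 s0 s1 _ _] := cif; have [[x0 Ex0] _ _] := Einv.
pose c w' := dot (perp th) (act w' x0) - sg w' * dot th (act w' x0).
exists (c w - c v - (sg w - sg v) * D) => j hw hv; rewrite /close.
have [Ex xj] := column_ptP hw; have [Ey yj] := column_ptP hv.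
move: (column_pt w j) (column_pt v j) Ex xj Ey yj => x y Ex xj Ey yj h.
have /andP[c1 c2] := column_itv w Ex; have /andP[c3 c4] := column_itv v Ey.
rewrite xj in c1 c2; rewrite yj in c3 c4.
have h2 := le_trans (dot_perp_le th1 _) h; rewrite dotBr in h2.
have tube w' z : w' \in S -> E z ->
    `|dot (perp th) (act w' z) - sg w' * dot th (act w' z) - c w'| <= 6 * r * D.
  move=> w'S Ez; have := stopped_tube (z - x0) w'S; rewrite -actB !dotBr => t.
  rewrite (_ : _ - _ - c w' = dot (perp th) (act w' z) - dot (perp th) (act w' x0) -
    sg w' * (dot th (act w' z) - dot th (act w' x0))); last by rewrite /c; ring.
  by rewrite (le_trans t) // ler_wpM2l ?mulr_ge0 ?(ltW r0) // E_diam.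
have tw := tube _ _ wS Ex; have tv := tube _ _ vS Ey.
set X := (j : nat)%:R * r in c1 c2 c3 c4 *.
have sl w' e : `|e| <= r -> `|sg w' * e| <= r.
  move=> he; rewrite normrM -[leRHS]mul1r ler_pM //.
  by rewrite (le_trans (slope_le (word_dominant cif w'))) // ltW.
have e1 : `|dot th (act w x) + D - X| <= r by rewrite ler_norml; apply/andP; split; lra.
have e2 : `|dot th (act v y) + D - X| <= r by rewrite ler_norml; apply/andP; split; lra.
have {e1} := sl w _ e1; have {e2} := sl v _ e2.
set p1 := dot th (act w x) in tw *; set p2 := dot th (act v y) in tv *.
set q1 := dot (perp th) (act w x) in h2 tw *; set q2 := dot (perp th) (act v y) in h2 tv *.
have rD : r <= D * r by rewrite ler_peMl // ltW.
rewrite (_ : (sg w - sg v) * X + _ = (q1 - q2) - sg w * (p1 + D - X) + sg v * (p2 + D - X)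
   - (q1 - sg w * p1 - c w) + (q2 - sg v * p2 - c v)); last by ring.
move: (q1 - q2) (sg w * (p1 + D - X)) (sg v * (p2 + D - X)) (q1 - sg w * p1 - c w)
  (q2 - sg v * p2 - c v) h2 tw tv => z1 z2 z3 z4 z5.
rewrite !ler_norml => /andP[? ?] /andP[? ?] /andP[? ?] /andP[? ?] /andP[? ?].
by apply/andP; split; lra.
Qed.

(** By [close_line] the common columns lie in a range of length 32 D over the difference of slopes.
    The extra 1 of the count is absorbed because that difference is at most 2; hence 34. *)
Lemma close_count_le w v : w \in S -> v \in S -> w != v ->
  \sum_(j | [&& hit w j, hit v j & close w v j]) 1 <= 34 * D * `|sg w - sg v|^-1.
Proof.
move=> wS vS wv; have [th1 s0 s1 _ _] := cif.
have [b hb] := close_line wS vS.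
have D0 : 0 < D by rewrite (lt_le_trans _ D1).
have d1 : 0 < `|sg w - sg v|.
  apply: lt_trans (word_slope_separation cif dis (stopped_diverge wS vS wv)).
  exact: (slope_radius_gt0 s0 (word_unit cif w) (word_dominant cif w)).
have d2 : `|sg w - sg v| <= 2.
  rewrite (le_trans (ler_normB _ _)) //.
  apply: le_trans (lerD (slope_le (word_dominant cif w)) (slope_le (word_dominant cif v))) _.
  exact: (lerD (ltW s1) (ltW s1)).
apply: (@le_trans _ _ (32 * D / `|sg w - sg v| + 1)); last first.
  rewrite -[X in _ + X](mulfV (lt0r_neq0 d1)) -mulrDl ler_pM2r ?invr_gt0 //.
  by have := D1; lra.
apply: card_ord_diam_le; first by rewrite divr_ge0 ?mulr_ge0 ?(ltW D0).
move=> i j /and3P[iw iv ic] /and3P[jw jv jc].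
have h1 := hb _ iw iv ic; have h2 := hb _ jw jv jc.
rewrite ler_pdivlMr // -(ler_pM2r r0) -{1}(gtr0_norm r0) -!normrM.
rewrite (_ : _ * r = ((sg w - sg v) * ((i : nat)%:R * r) + b) -
  ((sg w - sg v) * ((j : nat)%:R * r) + b)); last by ring.
by rewrite (le_trans (ler_normB _ _)) //; lra.
Qed.

Let L := 1 + ln (4 / (s * d0 * r)).

(** The slope radius of a tube not longer than that of [wd k] is at least [d], so these slopes are
    [d]-separated and the sum of reciprocals is harmonic. Bounding [a (wd k)] by 1 inside the
    logarithm makes [L] the same for all tubes. *)
Lemma recip_slopes_le (T : finType) (wd : T -> seq 'I_kappa) k :
  (forall l, wd l \in S) -> injective wd ->
  \sum_(l | (l != k) && (a (wd l) <= a (wd k))) `|sg (wd k) - sg (wd l)|^-1 <=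
  4 / (s * d0) * (a (wd k) / r) * L.
Proof.
move=> wS inj; have [th1 s0 s1 _ _] := cif.
pose d := s * d0 * r / (2 * a (wd k)).
have d1 : 0 < d by rewrite divr_gt0 ?mulr_gt0.
have d2 : d <= 2.
  rewrite /d ler_pdivrMr ?mulr_gt0 // -mulrA.
  have h := stopped_alpha1_ge (wS k); have ak := a_gt0 (wd k).
  have : s * (d0 * r) <= 1 * a (wd k).
    by apply: ler_pM => //; rewrite ?(ltW s0) ?(ltW s1) // mulr_ge0 // ltW.
  by lra.
have sep l m : a (wd l) <= a (wd k) -> l != m -> d <= `|sg (wd l) - sg (wd m)|.
  move=> lk lm.
  have dv : diverge (wd l) (wd m) by apply: (stopped_diverge (wS l) (wS m)); rewrite (inj_eq inj).
  apply: le_trans (ltW (word_slope_separation cif dis dv)).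
  apply: le_trans (slope_radius_word_ge cif (wd l)).
  have [_ h] := stopped_det_ge (wS l).
  rewrite /d -[s * d0 * r]mulrA.
  exact: ratio_le_of_le s0 (mulr_gt0 d00 r0) (a_gt0 _) lk h.
have := @recip_sum_le R T (fun l => (l != k) && (a (wd l) <= a (wd k)))
  (fun l => sg (wd k) - sg (wd l)) d 2 d1 d2.
move=> /(_ _ _) h; apply: le_trans (h _ _) _.
- move=> l /andP[lk al]; rewrite {1}distrC sep //=.
  rewrite (le_trans (ler_normB _ _)) //.
  apply: le_trans (lerD (slope_le (word_dominant cif (wd k))) (slope_le (word_dominant cif (wd l)))) _.
  exact: (lerD (ltW s1) (ltW s1)).
- move=> i j /andP[ik ai] /andP[jk aj] ij.
  by rewrite (_ : _ - _ = - (sg (wd i) - sg (wd j))) ?normrN ?sep //; ring.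
have ak := a_gt0 (wd k).
have -> : 2 / d = 4 / (s * d0) * (a (wd k) / r).
  rewrite /d; move: (a (wd k)) ak => z z0.
  by field; rewrite !gt_eqF.
have p1 : 0 < s * d0 by rewrite mulr_gt0.
have p2 : 0 < s * d0 * r by rewrite mulr_gt0.
have p3 : 0 < a (wd k) / r by rewrite divr_gt0.
have p4 : 0 < 4 / (s * d0) * (a (wd k) / r) by rewrite mulr_gt0 // divr_gt0.
rewrite ler_pM2l // /L lerD2l ler_ln ?posrE // ?divr_gt0 //.
have -> : 4 / (s * d0) * (a (wd k) / r) = 4 / (s * d0 * r) * a (wd k).
  move: (a (wd k)) ak => z z0.
  by field; rewrite !gt_eqF.
by rewrite ler_piMr ?(alpha1_word_le1 cif) // divr_ge0 // ltW.
Qed.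

Lemma cover_lower N : coverable E r N ->
  \sum_(w <- S) a w / r <=
  64 * D / rho * (1 + 272 * D / (s * d0) * (16 * D / rho)) * L * N%:R.
Proof.
move=> [c hc]; have [th1 s0 s1 _ _] := cif; have [[x0 Ex0] _ _] := Einv.
have [i0 _] := hc _ Ex0.
have [kf kfP] : {kf : 'cV[R]_2 -> 'I_N & forall p, E p -> enorm (p - c (kf p)) <= r}.
  apply: (@choice _ _ (fun p i => E p -> enorm (p - c i) <= r)) => p.
  by have [/hc[i hi]|nE] := pselect (E p); [exists i|exists i0].
pose wd (k : 'I_(size S)) := nth [::] S k.
have wdS k : wd k \in S by exact: mem_nth.
have wdI : injective wd.
  by move=> k l /eqP; rewrite nth_uniq ?stopped_uniq // => /eqP/val_inj.
(* The ball containing the representative point, and the column modulo 4. *)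
pose key (p : 'I_(size S) * 'I_M) : 'I_N * 'I_4 :=
  (kf (act (wd p.1) (column_pt (wd p.1) p.2)), inord (p.2 %% 4)).
pose g k l := 34 * D * `|sg (wd k) - sg (wd l)|^-1.
pose G k := 34 * D * (4 / (s * d0) * (a (wd k) / r) * L).
have D0 : 0 < D by rewrite (lt_le_trans _ D1).
pose H : R := \sum_k \sum_(j | hit (wd k) j) 1.
have VE : \sum_(w <- S) a w / r = \sum_k a (wd k) / r.
  by rewrite (big_nth [::]) big_mkord.
have hV : \sum_(w <- S) a w / r <= 16 * D / rho * H.
  rewrite VE /H mulr_sumr; apply: ler_sum => k _.
  by rewrite mulrAC ler_pdivlMr // mulrC; exact: hit_count_ge.
have L1 : 1 <= L.
  rewrite /L lerDl ln_ge0 // ler_pdivlMr ?mulr_gt0 // mul1r.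
  apply: (@le_trans _ _ 1); last by rewrite ler1n.
  by rewrite !mulr_ile1 ?mulr_ge0 ?(ltW s0) ?(ltW d00) ?(ltW r0) ?(ltW s1) ?(ltW r1).
(* The constant 16 D / rho compares the tube sum with the hits; 272 is 2 times 34 times 4, from the
   symmetry of pairs, the count of close columns and the sum of reciprocals. *)
rewrite (_ : 64 * D / rho = 4 * (16 * D / rho)); last by ring.
apply: (@le_of_sqr_le_linear _ H); rewrite ?divr_ge0 ?mulr_ge0 ?(ltW D0) ?(ltW s0) ?(ltW d00) ?(ltW rho0) //.
  by apply: sumr_ge0 => k _; apply: sumr_ge0.
have := @collision_bound R _ _ M (fun k j => hit (wd k) j)
  (fun k l j => close (wd k) (wd l) j) key (fun k => a (wd k)) g G.
rewrite card_prod !card_ord natrM -/H => h; apply: le_trans (h _ _ _ _ _) _.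
- move=> k l i j ki lj; rewrite /key /= => -[kE /(congr1 val) /=].
  rewrite !inordK ?ltn_pmod // => m4.
  have [Ei ci] := column_ptP ki; have [Ej cj] := column_ptP lj.
  have cl : enorm (act (wd k) (column_pt (wd k) i) - act (wd l) (column_pt (wd l) j)) <= 2 * r.
    rewrite (le_trans (enormB_le _ (c (kf (act (wd k) (column_pt (wd k) i)))) _)) //.
    rewrite mulr_natl mulr2n lerD //; first by apply: kfP; exact: act_mem.
    by rewrite {1}kE -enormN opprB; apply: kfP; exact: act_mem.
  have ij : i = j.
    apply/val_inj; rewrite /= -ci -cj; apply: (column_close Ei Ej cl).
    by rewrite ci cj.
  by split=> //; rewrite /close {2}ij.
- move=> k l kl; apply: close_count_le; rewrite ?wdS //.
  by rewrite (inj_eq wdI).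
- by move=> k l; rewrite !mulr_ge0 ?invr_ge0 // ltW.
- by move=> k l; rewrite /g distrC.
- move=> k; rewrite /g /G -mulr_sumr ler_wpM2l ?mulr_ge0 ?(ltW D0) //.
  exact: (recip_slopes_le k wdS wdI).
have -> : \sum_k G k = 34 * D * (4 / (s * d0)) * L * \sum_k a (wd k) / r.
  by rewrite mulr_sumr; apply: eq_bigr => k _; rewrite /G; ring.
by rewrite ler_wpM2l // lerD2l VE; apply: le_of_eq; ring.
Qed.

End Lower_bound.
End Radius.
End Attractor.

(** * Pressure and dimension *)

Section Real_lemmas.
Context {R : realType}.

Lemma expr_small (b e : R) : 0 <= b -> b < 1 -> 0 < e -> exists n, b ^+ n.+1 < e.
Proof.
move=> b0 b1 e0.
have : b ^+ n @[n --> \oo] --> 0 by apply: cvg_expr; rewrite ger0_norm.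
move/cvgrPdist_lt => /(_ _ e0)[n _ hn]; exists n.
by have := hn n.+1 (leqnSn n); rewrite /= sub0r normrN ger0_norm ?exprn_ge0.
Qed.

Lemma le_of_natmul (x y C : R) : (forall n : nat, (0 < n)%N -> n%:R * x <= n%:R * y + C) -> x <= y.
Proof.
move=> h; rewrite leNgt; apply/negP => xy.
have d0 : 0 < x - y by rewrite subr_gt0.
have k := truncnS_gt (`|C| / (x - y)).
set m := (Num.truncn _).+1 in k.
have := h m isT; rewrite leNgt => /negP; apply.
rewrite -ltrBrDl -mulrBr (le_lt_trans (ler_norm C)) //.
by rewrite -ltr_pdivrMr.
Qed.

(** An intermediate value argument at the supremum of the points with nonnegative value; the
    Lipschitz bound supplies the continuity. *)
Lemma decreasing_zero (P : R -> R) (a b L : R) : 0 < L -> a <= b ->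
  (forall x y, a <= x -> x <= y -> y <= b -> P y <= P x /\ P x <= P y + L * (y - x)) ->
  0 <= P a -> P b < 0 -> exists2 t, a <= t < b & P t = 0.
Proof.
move=> L0 ab lip Pa Pb.
set A := [set t | a <= t <= b /\ 0 <= P t].
have Aa : A a by rewrite /A /= lexx ab.
have Aub : ubound A b by move=> t [/andP[]].
have hub : has_ubound A by exists b.
have s1 : a <= sup A by apply: ub_le_sup.
have s2 : sup A <= b by apply: ge_sup => //; exists a.
have P0 : P (sup A) = 0.
  apply/eqP; rewrite eq_le; apply/andP; split; rewrite leNgt; apply/negP => h.
    have sb : sup A < b.
      by rewrite lt_def s2 andbT; apply: contraTneq h => <-; rewrite -leNgt ltW.
    pose t := Num.min b (sup A + P (sup A) / L).
    have st : sup A < t.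
      by rewrite lt_min sb ltrDl divr_gt0.
    have tb : t <= b by rewrite ge_min lexx.
    have [_ h2] := lip _ _ s1 (ltW st) tb.
    have : L * (t - sup A) <= P (sup A).
      rewrite mulrC -ler_pdivlMr // lerBlDl; rewrite /t ge_min lexx orbT //.
    move=> h3.
    have At : A t by split; [rewrite tb (le_trans s1 (ltW st))|lra].
    by have := ub_le_sup hub At; rewrite leNgt st.
  have e0 : 0 < - P (sup A) / L by rewrite divr_gt0 // oppr_gt0.
  have [t [tab Pt] ht] : exists2 t, A t & sup A - (- P (sup A) / L) < t.
    by apply: sup_adherent => //; split => //; exists a.
  have ts : t <= sup A by apply: ub_le_sup.
  have /andP[ta _] := tab.
  have [_ h2] := lip _ _ ta ts s2.
  have : L * (sup A - t) < - P (sup A).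
    by rewrite mulrC -ltr_pdivlMr //; lra.
  by lra.
exists (sup A) => //; rewrite s1 lt_def s2 andbT.
by apply: contraTneq Pb => ->; rewrite P0 ltxx.
Qed.

(** With [e] arbitrarily small, this makes the logarithm of the logarithmic factor negligible
    against [- ln r]. *)
Lemma ln_le_linear (e y : R) : 0 < e -> 0 < y -> ln y <= e * y - ln e.
Proof.
move=> e0 y0; rewrite lerBrDr -lnM ?posrE // mulrC.
have := @le_ln1Dx R (e * y - 1); rewrite (_ : 1 + (e * y - 1) = e * y); last by ring.
move=> h; rewrite (le_trans (h _)) ?lerBlDr ?lerDl // ltrBrDr addNr.
exact: mulr_gt0.
Qed.

Lemma covering_number_le (E : set 'cV[R]_2) r N : coverable E r N ->
  covering_number E r <= N%:R.
Proof.
by move=> h; apply: ge_inf; [exists 0 => _ [n _ <-]|exists N].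
Qed.

Lemma covering_number_ge (E : set 'cV[R]_2) r (x : R) :
  (exists N, coverable E r N) -> (forall N, coverable E r N -> x <= N%:R) ->
  x <= covering_number E r.
Proof.
move=> [N hN] h; apply: lb_le_inf; first by exists N%:R, N.
by move=> _ [n hn <-]; exact: h.
Qed.

Lemma minkowski_of_bounds (E : set 'cV[R]_2) (t C1 C2 C3 C4 : R) :
  0 <= t -> 1 <= C1 -> 0 < C2 -> 0 < C3 -> 1 <= C4 ->
  (forall r : R, 0 < r -> r < 1 -> exists2 N, coverable E (C1 * r) N & N%:R <= C2 * r `^ (- t)) ->
  (forall r : R, 0 < r -> r < 1 -> forall N, coverable E r N ->
     r `^ (- t) <= C3 * (1 + ln (C4 / r)) * N%:R) ->
  minkowski_ratio E r @[r --> 0^'+] --> t.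
Proof.
move=> t0 C11 C20 C30 C41 up low.
have C10 : 0 < C1 by rewrite (lt_le_trans _ C11).
have C40 : 0 < C4 by rewrite (lt_le_trans _ C41).
apply/cvgrPdist_le => e e0.
pose K := 1 + ln C4.
have K1 : 1 <= K by rewrite /K lerDl ln_ge0.
(* Chosen so that [u * C3] is [e / 2]; one half of [e] pays for the logarithmic factor, the other,
   through [A], for the constants. *)
pose u := e / (2 * C3).
have u0 : 0 < u by rewrite divr_gt0 // mulr_gt0.
pose B1 := ln (C2 * C1 `^ t).
pose B2 := e / 2 * K - ln u.
pose A := (`|B1| + `|B2|) * 2 / e.
have A0 : 0 <= A by rewrite divr_ge0 ?mulr_ge0 ?addr_ge0 // ltW.
near=> r.
have r0 : 0 < r by near: r; exact: nbhs_right_gt.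
have r1 : r < 1 by near: r; exact: nbhs_right_lt.
have rA : r < expR (- A) by near: r; apply: nbhs_right_lt; exact: expR_gt0.
pose l := - ln r.
have l0 : 0 < l by rewrite oppr_gt0 ln_lt0 // r0.
have lA : A <= l.
  rewrite lerNr; apply/ltW; rewrite -(@expRK R (- A)) ltr_ln ?posrE ?expR_gt0 //.
have Pl : 0 < K + l by rewrite addr_gt0 // (lt_le_trans _ K1).
have lnC4 : 1 + ln (C4 / r) = K + l.
  by rewrite ln_div ?posrE // /K /l addrA.
have rC1 : r / C1 < 1 by rewrite ltr_pdivrMr // mul1r (lt_le_trans r1).
have [N hN hN2] := up (r / C1) (divr_gt0 r0 C10) rC1.
rewrite mulrC divfK ?gt_eqF // in hN.
have c1 : covering_number E r <= C2 * C1 `^ t * r `^ (- t).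
  apply: le_trans (covering_number_le hN) _; apply: le_trans hN2 _.
  rewrite powRM ?invr_ge0 ?(ltW r0) ?(ltW C10) //.
  have -> : C1^-1 `^ (- t) = C1 `^ t.
    by rewrite -powR_inv1 ?(ltW C10) // -powRrM mulN1r opprK.
  by apply: le_of_eq; ring.
have c2 : r `^ (- t) / (C3 * (K + l)) <= covering_number E r.
  apply: covering_number_ge; first by exists N.
  move=> M hM; rewrite ler_pdivrMr ?mulr_gt0 // mulrC -lnC4.
  exact: low.
have p0 : 0 < r `^ (- t) by rewrite powR_gt0.
have c0 : 0 < covering_number E r.
  by rewrite (lt_le_trans _ c2) // divr_gt0 // mulr_gt0.
have lp : ln (r `^ (- t)) = t * l by rewrite ln_powR /l mulNr mulrN.
have b1 : ln (covering_number E r) <= B1 + t * l.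
  rewrite -lp -lnM ?posrE ?mulr_gt0 ?powR_gt0 // ler_ln ?posrE //.
  by rewrite !mulr_gt0 ?powR_gt0.
have b2 : t * l - ln (C3 * (K + l)) <= ln (covering_number E r).
  rewrite -lp -ln_div ?posrE ?mulr_gt0 // ler_ln ?posrE //.
  by rewrite divr_gt0 // mulr_gt0.
have b3 : ln (C3 * (K + l)) <= B2 + e / 2 * l.
  apply: le_trans (ln_le_linear u0 (mulr_gt0 C30 Pl)) _.
  by apply: le_of_eq; rewrite /B2 /u; field; rewrite gt_eqF.
have b4 : `|B1| + `|B2| <= e / 2 * l.
  rewrite (_ : e / 2 * l = l * (e / 2)); last by ring.
  rewrite -ler_pdivrMr ?divr_gt0 // (le_trans _ lA) // /A.
  by apply: le_of_eq; field; rewrite gt_eqF.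
rewrite /minkowski_ratio -/l ler_norml.
have n1 := ler_norm B1; have n2 := ler_norm B2.
have n3 := normr_ge0 B1; have n4 := normr_ge0 B2.
apply/andP; split.
  rewrite lerBrDl -lerBrDr opprK ler_pdivrMr // mulrDl.
  have : 0 <= e * l by rewrite mulr_ge0 // ltW.
  by lra.
rewrite lerBlDl -lerBlDr ler_pdivlMr // mulrBl.
by lra.
Unshelve. all: by end_near.
Qed.

(** At stopping time [q] is about [r * a], so a^(2-t) q^(t-1) is about a r^(t-1), the number [a / r]
    of balls in the tube times r^t. This is how the singular value function counts coverings. *)
Lemma psi_stop_bounds (a q r t d : R) : 0 < a -> 0 < r -> 0 < d -> 1 <= t -> t <= 2 ->
  q <= r * a -> d * r * a <= q ->
  a `^ (2 - t) * q `^ (t - 1) <= a / r * r `^ t /\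
  a / r * (d `^ (t - 1) * r `^ t) <= a `^ (2 - t) * q `^ (t - 1).
Proof.
move=> a0 r0 d0 t1 t2 h1 h2.
have q0 : 0 < q by rewrite (lt_le_trans _ h2) // !mulr_gt0.
have e1 : a `^ (2 - t) * a `^ (t - 1) = a.
  rewrite -powRD; last by rewrite (gt_eqF a0) implybT.
  by rewrite (_ : 2 - t + (t - 1) = 1) ?powRr1 ?(ltW a0) //; ring.
have e2 : r `^ (t - 1) = r `^ t / r.
  rewrite powRD; last by rewrite (gt_eqF r0) implybT.
  by rewrite powR_inv1 // ltW.
have p : 0 < a `^ (2 - t) by rewrite powR_gt0.
split.
  apply: (@le_trans _ _ (a `^ (2 - t) * (r * a) `^ (t - 1))).
    rewrite ler_pM2l // ge0_ler_powR ?nnegrE ?subr_ge0 ?(ltW q0) ?mulr_ge0 ?(ltW a0) ?(ltW r0) //.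
  rewrite powRM ?(ltW a0) ?(ltW r0) // mulrCA e1 e2.
  by apply: le_of_eq; ring.
apply: (@le_trans _ _ (a `^ (2 - t) * (d * r * a) `^ (t - 1))).
  rewrite !powRM ?mulr_ge0 ?(ltW a0) ?(ltW r0) ?(ltW d0) // [leRHS]mulrCA e1 e2.
  by apply: le_of_eq; ring.
rewrite ler_pM2l // ge0_ler_powR ?nnegrE ?subr_ge0 ?(ltW q0) ?mulr_ge0 ?(ltW a0) ?(ltW r0) ?(ltW d0) //.
Qed.

Lemma powR_exprn (x y : R) (n : nat) : 0 <= x -> (x ^+ n) `^ y = (x `^ y) ^+ n.
Proof.
by move=> x0; rewrite -!powR_mulrn ?powR_ge0 // -!powRrM mulrC.
Qed.

End Real_lemmas.

Lemma le_shifted_trans {R : realType} (a b c d e g k : R) :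
  a <= b -> c <= d - k -> e + b <= c -> - e <= g -> a <= d + g - k.
Proof. by lra. Qed.

(** * The dimension as the zero of the pressure *)

Section Attractor_dimension.
Context {R : realType} {kappa : nat}.
Variables (f : affine_maps R kappa) (th : 'cV[R]_2) (s abar : R).
Hypothesis cif : cone_ifs f th s abar.
Hypothesis k0 : (0 < kappa)%N.

Let c0 : R := cone_const s.

Implicit Types (w : seq 'I_kappa) (p q t : R) (n : nat).

Lemma sing_val_fun_lt1 (t : R) w : t < 1 -> sing_val_fun t (word_mx f w) = psi f t 0 w.
Proof. by move=> t1; rewrite /sing_val_fun t1 /psi powRr0 mulr1. Qed.

Lemma sing_val_fun_lt2 (t : R) w : 1 <= t -> t < 2 ->
  sing_val_fun t (word_mx f w) = psi f (2 - t) (t - 1) w.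
Proof.
move=> t1 t2; rewrite /sing_val_fun ltNge t1 /= t2 /psi.
have a0 := alpha1_word_gt0 cif w.
rewrite -alpha1M2 powRM ?alpha1_ge0 ?alpha2_ge0 // mulrA -powRD; last first.
  by rewrite (gt_eqF a0) implybT.
by rewrite (_ : 2 - t + (t - 1) = 1) ?powRr1 ?(ltW a0) //; ring.
Qed.

Lemma sing_val_fun_ge2 (t : R) w : 2 <= t ->
  sing_val_fun t (word_mx f w) = psi f 0 (t / 2) w.
Proof.
move=> t2; rewrite /sing_val_fun !ltNge t2 /= (le_trans _ t2) ?ler1n //.
by rewrite /psi powRr0 mul1r.
Qed.

Lemma psi_nil p q : psi f p q [::] = 1.
Proof. by rewrite /psi word_mx0 alpha1_1 det1 normr1 !powR1 mulr1. Qed.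

Lemma wsum_psi_bounds p q : 0 <= p -> p <= 1 ->
  limn (fun n => ln (wsum n (psi f p q)) / n%:R) = 0 ->
  forall n, 1 <= wsum n (psi f p q) <= c0^-1.
Proof.
move=> p0 p1 lim0 n; have c1 := cone_const_gt0 cif.
case: n => [|n].
  by rewrite wsum0 psi_nil lexx /= -invr1 lef_pV2 ?posrE // cone_const_le1.
(* The averages converge, so the hypothesis on [limn] concerns a genuine limit. *)
have [P [cP bP]] := psi_pressure cif k0 q p0 p1.
have P0 : P = 0 by rewrite -lim0; apply/esym; exact: cvg_lim cP.
have := bP n.+1 isT; rewrite P0 !mulr0 add0r => -[h1 h2].
have w0 := wsum_psi_gt0 cif k0 p q n.+1.
apply/andP; split; rewrite -ler_ln ?posrE ?invr_gt0 //; first by rewrite ln1.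
by rewrite lnV ?posrE.
Qed.

(** The quotient of the determinant by [alpha1] is [alpha2]. *)
Lemma psi_shift t t' w : psi f (2 - t') (t' - 1) w =
  psi f (2 - t) (t - 1) w *
    (`|\det (word_mx f w)| / alpha1 (word_mx f w)) `^ (t' - t).
Proof.
have a0 := alpha1_word_gt0 cif w; have d0 := det_word_gt0 cif w.
rewrite /psi; set x := alpha1 _ in a0 *; set y := `|_| in d0 *.
have -> : x `^ (2 - t') = x `^ (2 - t) * x^-1 `^ (t' - t).
  rewrite -powR_inv1 ?(ltW a0) // -powRrM mulN1r -powRD ?(gt_eqF a0) ?implybT //.
  by congr powR; ring.
have -> : y `^ (t' - 1) = y `^ (t - 1) * y `^ (t' - t).
  rewrite -powRD ?(gt_eqF d0) ?implybT //.
  by congr powR; ring.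
rewrite powRM ?invr_ge0 ?(ltW a0) ?(ltW d0) //; ring.
Qed.

Lemma wsum_psi_decay t t' n : t <= t' ->
  wsum n (psi f (2 - t') (t' - 1)) <= (abar ^+ n) `^ (t' - t) * wsum n (psi f (2 - t) (t - 1)).
Proof.
move=> tt; rewrite -wsumZ; apply: le_wsum => w wn.
have a0 := alpha1_word_gt0 cif w; have d0 := det_word_gt0 cif w.
have i0 : 0 < abar by exact: (abar_gt0 cif (Ordinal k0)).
rewrite (psi_shift t) mulrC ler_pM2r; last exact: psi_gt0 cif _ _ w.
rewrite ge0_ler_powR ?nnegrE ?subr_ge0 ?divr_ge0 ?exprn_ge0 ?(ltW a0) ?(ltW d0) ?(ltW i0) //.
rewrite ler_pdivrMr // (le_trans (det_word_le _ _)) // expr2 ler_pM2r // -wn.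
exact: alpha1_word_le_exp cif w.
Qed.

Lemma wsum_psi_le t t' n : t <= t' ->
  wsum n (psi f (2 - t') (t' - 1)) <= wsum n (psi f (2 - t) (t - 1)).
Proof.
move=> tt; apply: le_trans (wsum_psi_decay n tt) _.
have i0 : 0 < abar by exact: (abar_gt0 cif (Ordinal k0)).
have [_ _ _ a1 _] := cif.
rewrite ler_piMl ?wsum_ge0 //; first by move=> w; exact: psi_ge0 cif _ _ w.
rewrite -(powRr0 (abar ^+ n)); apply: ger_powR; last by rewrite subr_ge0.
by rewrite exprn_gt0 // exprn_ile1 // ltW.
Qed.

Lemma wsum_psi0_det n : wsum n (psi f 0 1) = wsum n (fun w => `|\det (word_mx f w)|).
Proof. by apply: eq_wsum => w _; rewrite /psi powRr0 mul1r powRr1. Qed.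

Lemma wsum_psi1_alpha1 n : wsum n (psi f 1 0) = wsum n (fun w => alpha1 (word_mx f w)).
Proof. by apply: eq_wsum => w _; rewrite /psi powRr0 mulr1 powRr1 ?alpha1_ge0. Qed.

Variables (E : set 'cV[R]_2) (D d0 rho : R).
Hypotheses (Einv : is_invariant_set f E) (D1 : 1 <= D)
  (ED : forall x, E x -> enorm x <= D / 2) (d00 : 0 < d0) (d01 : d0 <= 1)
  (d0le : forall i, d0 <= `|\det (linpart f i)|)
  (dis : forall i j, i != j ->
    (mulmx (linpart f i) @` closed_cone th s) `&` (mulmx (linpart f j) @` closed_cone th s)
    `<=` [set 0])
  (rho0 : 0 < rho) (proj : forall w, (0 < size w)%N ->
  [/\ enorm (theta1 (word_mx f w)) = 1,
      (word_mx f w)^T *m word_mx f w *m theta1 (word_mx f w) =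
        alpha1 (word_mx f w) ^+ 2 *: theta1 (word_mx f w) &
      (rho%:E <= lebesgue_measure [set dot (theta1 (word_mx f w)) x | x in E])%E]).

(** The projection of [E] on the direction of a one-letter word has measure at least [rho] and is
    covered by the projections of the pieces of level [n], each of radius at most [alpha1] times
    [D]. *)
Lemma wsum_alpha1_ge n : rho <= 2 * D * wsum n (fun w => alpha1 (word_mx f w)).
Proof.
have [v1 _ vm] := @proj [:: Ordinal k0] isT.
set v := theta1 _ in v1 vm.
have [[x0 Ex0] _ _] := Einv.
have cov m x : E x -> exists2 w, size w = m & (act f w @` E) x.
  move=> Ex; elim: m => [|m [w wm aw]]; first by exists [::] => //; exists x.
  have [i _ ai] := act_cover Einv aw.
  by exists (rcons w i) => //; rewrite size_rcons wm.
have := @measure_finite_cover R _ (n.-tuple 'I_kappa) (index_enum _)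
  (fun w : n.-tuple 'I_kappa => dot v (act f w x0))
  (fun w : n.-tuple 'I_kappa => alpha1 (word_mx f w) * D) (E_proj_measurable Einv v).
move=> /(_ _ _)/(le_trans vm); rewrite lee_fin => h.
have D0 : 0 <= D by rewrite (le_trans _ D1).
rewrite /wsum mulr_sumr (eq_bigr (fun w : n.-tuple 'I_kappa => 2 * (alpha1 (word_mx f w) * D))); last first.
  by move=> w _; ring.
apply: h; first by move=> w; rewrite mulr_ge0 ?alpha1_ge0.
move=> _ [x Ex <-]; have [w wn [y Ey <-]] := cov n x Ex.
have wn' : size w == n by rewrite wn.
exists (Tuple wn'); first by rewrite mem_index_enum.
rewrite /= -dotBr actB (le_trans (dot_le _ _)) // v1 mul1r.
rewrite (le_trans (enorm_mulmx _ _)) // ler_wpM2l ?alpha1_ge0 //.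
exact: E_diam ED _ _ Ey Ex0.
Qed.

Lemma dimension_of_bounds t : 1 <= t -> t < 2 ->
  (forall n, 1 <= wsum n (psi f (2 - t) (t - 1)) <= c0^-1) ->
  minkowski_ratio E r @[r --> 0^'+] --> t.
Proof.
move=> t1 t2 hb; have [th1 s0 s1 _ _] := cif; have c00 := cone_const_gt0 cif.
have c0i : 0 < c0^-1 by rewrite invr_gt0.
pose F := psi f (2 - t) (t - 1).
have t0 : 0 <= 2 - t by rewrite subr_ge0 ltW.
have t3 : 2 - t <= 1 by lra.
have F0 w : 0 < F w by exact: psi_gt0 cif _ _ w.
have D0 : 0 < D by rewrite (lt_le_trans _ D1).
pose V r n := \sum_(w <- stopped (stop f r) n [::]) alpha1 (word_mx f w) / r.
(* The tube sum is comparable to r^(-t): times r^t it is comparable to the sum of [F] over the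
   stopped words, and that sum to the one over words of length [n], which is between 1 and
   [c0^-1]. *)
have Vb (r : R) (n : nat) : 0 < r -> r < 1 -> (forall w, (n <= size w)%N -> stop f r w) ->
    c0 <= V r n * r `^ t /\ V r n * (d0 `^ (t - 1) * r `^ t) <= c0^-1 ^+ 2.
  move=> r0 r1 hn.
  have stp (w : seq 'I_kappa) : w \in stopped (stop f r) n [::] ->
      F w <= alpha1 (word_mx f w) / r * r `^ t /\
      alpha1 (word_mx f w) / r * (d0 `^ (t - 1) * r `^ t) <= F w.
    move=> wS; apply: psi_stop_bounds => //; first exact: alpha1_word_gt0 cif w.
    - exact: ltW.
    - exact: (stopped_det_le hn wS).
    - by have [] := stopped_det_ge cif d00 d0le r0 r1 hn wS.
  have u1 : c0 * \sum_(w <- stopped (stop f r) n [::]) F w <= wsum n (fun w => F ([::] ++ w)).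
    apply: stopped_sum_le; first exact: ltW.
    move=> v m; apply: (@le_trans _ _ (c0 * (F v * wsum m F))).
      by rewrite ler_wpM2l ?(ltW c00) // ler_peMr ?(ltW (F0 v)) //; have /andP[] := hb m.
    rewrite -wsumZ -wsumZ; apply: le_wsum => w _; exact: (psi_cat_ge cif).
  have u2 : wsum n (fun w => F ([::] ++ w)) <= c0^-1 * \sum_(w <- stopped (stop f r) n [::]) F w.
    apply: stopped_sum_ge; first exact: ltW.
    move=> v m; apply: (@le_trans _ _ (F v * wsum m F)).
      rewrite -wsumZ; apply: le_wsum => w _; exact: (psi_cat_le cif).
    by rewrite mulrC ler_wpM2r ?(ltW (F0 v)) //; have /andP[] := hb m.
  have /andP[b1 b2] := hb n.
  split.
    apply: (@le_trans _ _ (\sum_(w <- stopped (stop f r) n [::]) F w)).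
      by have := le_trans b1 u2; rewrite ler_pdivlMl // mulr1.
    rewrite /V mulr_suml big_seq [leRHS]big_seq; apply: ler_sum => w wS.
    by have [] := stp w wS.
  apply: (@le_trans _ _ (\sum_(w <- stopped (stop f r) n [::]) F w)).
    rewrite /V mulr_suml big_seq [leRHS]big_seq; apply: ler_sum => w wS.
    by have [] := stp w wS.
  by have := le_trans u1 b2; rewrite -ler_pdivlMl // -expr2.
have powK (r : R) : 0 < r -> r `^ t * r `^ (- t) = 1.
  by move=> r0; rewrite powRN mulfV // gt_eqF // powR_gt0.
have p1 : 0 < s * d0 by rewrite mulr_gt0.
pose B := 272 * D / (s * d0) * (16 * D / rho).
have B0 : 0 <= B by rewrite mulr_ge0 ?divr_ge0 ?mulr_ge0 // ltW.
apply: (@minkowski_of_bounds R E t (8 * D) ((2 * D + d0^-1) * (c0^-1 ^+ 2 / d0 `^ (t - 1)))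
  (64 * D / rho * (1 + B) / c0) (4 / (s * d0))).
- by rewrite (le_trans _ t1).
- by rewrite (le_trans D1) // ler_peMl ?(ltW D0) // ler1n.
- by rewrite mulr_gt0 ?addr_gt0 ?mulr_gt0 ?invr_gt0 ?exprn_gt0 ?powR_gt0.
- by rewrite !mulr_gt0 ?invr_gt0 // ltr_pwDl.
- rewrite ler_pdivlMr // mul1r (@le_trans _ _ 1) ?ler1n //.
  by rewrite mulr_ile1 ?(ltW s0) ?(ltW d00) ?(ltW s1).
- move=> r r0 r1; have [n hn] := stop_eventually cif r0.
  have [N hN hN2] := cover_upper cif Einv D1 ED d00 d0le r0 r1 hn.
  exists N => //; apply: le_trans hN2 _.
  rewrite -[leRHS]mulrA ler_pM2l; last by rewrite addr_gt0 ?mulr_gt0 ?invr_gt0.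
  have [_ h] := Vb r n r0 r1 hn.
  rewrite -/(V r n) powRN -mulrA -invfM ler_pdivlMr //.
  by rewrite mulr_gt0 ?powR_gt0.
- move=> r r0 r1 N hN; have [n hn] := stop_eventually cif r0.
  have h := cover_lower cif Einv D1 ED d00 d01 d0le r0 r1 hn rho0 proj dis hN.
  have [h2 _] := Vb r n r0 r1 hn.
  have e : r `^ (- t) <= V r n / c0.
    rewrite ler_pdivlMr // -(ler_pM2r (powR_gt0 t r0)) mulrAC [X in X * c0]mulrC powK // mul1r.
    exact: h2.
  apply: le_trans e _; rewrite ler_pdivrMr //; apply: le_trans h _.
  rewrite -/B -[4 / (s * d0) / r]mulrA -invfM.
  by apply: le_of_eq; field; rewrite !gt_eqF.
Qed.

Lemma det_word_ge w : d0 ^+ size w <= `|\det (word_mx f w)|.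
Proof.
elim: w => [|i w IH]; first by rewrite word_mx0 det1 normr1.
rewrite word_mx_cons det_mulmx normrM exprS.
by apply: ler_pM => //; [exact: ltW|rewrite exprn_ge0 // ltW].
Qed.

Lemma wsum_psi_shift_ge t t' n : t <= t' ->
  (d0 ^+ n) `^ (t' - t) * wsum n (psi f (2 - t) (t - 1)) <= wsum n (psi f (2 - t') (t' - 1)).
Proof.
move=> tt; rewrite -wsumZ; apply: le_wsum => w wn.
have a0 := alpha1_word_gt0 cif w; have dw := det_word_gt0 cif w.
rewrite (psi_shift t t') [leLHS]mulrC ler_pM2l; last exact: psi_gt0 cif _ _ w.
rewrite ge0_ler_powR ?nnegrE ?subr_ge0 ?divr_ge0 ?exprn_ge0 ?(ltW a0) ?(ltW dw) ?(ltW d00) //.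
rewrite ler_pdivlMr // -wn; apply: le_trans (det_word_ge w).
by rewrite ler_piMr ?exprn_ge0 ?(ltW d00) // (alpha1_word_le1 cif).
Qed.

Lemma wsum_alpha1_not_small (u C : R) : 0 < u -> u < 1 ->
  ~ forall n, wsum n (fun w => alpha1 (word_mx f w)) <= C * u ^+ n.
Proof.
move=> u0 u1 h; have D0 : 0 < D by rewrite (lt_le_trans _ D1).
have C1 : 0 < 1 + `|C| by rewrite ltr_pwDl.
have e0 : 0 < rho / (2 * D * (1 + `|C|)) by rewrite divr_gt0 // !mulr_gt0.
have [n hn] := expr_small (ltW u0) u1 e0.
have := wsum_alpha1_ge n.+1; rewrite leNgt => /negP; apply.
rewrite ltr_pdivlMr ?mulr_gt0 // in hn.
apply: le_lt_trans hn.
have D2 : 0 <= 2 * D by rewrite mulr_ge0 // ltW.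
apply: (@le_trans _ _ (2 * D * (C * u ^+ n.+1))); first by rewrite ler_wpM2l // h.
rewrite [leRHS]mulrC -[leRHS]mulrA ler_wpM2l // ler_wpM2r ?exprn_ge0 ?(ltW u0) //.
by rewrite (le_trans (ler_norm C)) // lerDr.
Qed.

Lemma wsum_det_small : exists n, wsum n (fun w => `|\det (word_mx f w)|) < 1.
Proof.
have [th1 s0 s1 a1 _] := cif; have a0 := abar_gt0 cif (Ordinal k0).
have b1 : abar ^+ 2 < 1 by rewrite exprn_ilt1 // ltW.
have e0 : 0 < s / 40 by rewrite divr_gt0.
have [n hn] := expr_small (sqr_ge0 abar) b1 e0.
exists n.+1; apply: le_lt_trans (wsum_det_le cif dis n.+1) _.
rewrite -ltr_pdivlMl ?divr_gt0 // mulr1 invf_div.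
exact: hn.
Qed.

Lemma pressure_lt1 t : t < 1 ->
  pressure f t = limn (fun n => ln (wsum n (psi f t 0)) / n%:R).
Proof.
move=> t1; congr (limn _); apply/funext => n; congr (ln _ / _).
by apply: eq_bigr => w _; exact: sing_val_fun_lt1.
Qed.

Lemma pressure_lt2 t : 1 <= t -> t < 2 ->
  pressure f t = limn (fun n => ln (wsum n (psi f (2 - t) (t - 1))) / n%:R).
Proof.
move=> t1 t2; congr (limn _); apply/funext => n; congr (ln _ / _).
by apply: eq_bigr => w _; exact: sing_val_fun_lt2.
Qed.

Lemma pressure_ge2 t : 2 <= t ->
  pressure f t = limn (fun n => ln (wsum n (psi f 0 (t / 2))) / n%:R).
Proof.
move=> t2; congr (limn _); apply/funext => n; congr (ln _ / _).
by apply: eq_bigr => w _; exact: sing_val_fun_ge2.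
Qed.

(** For [t < 1] one has alpha1 = alpha1^(1-t) alpha1^t with the first factor exponentially small, so
    bounded sums of alpha1^t would make the sums of [alpha1] decay. *)
Lemma zero_pressure_ge1 t : 0 <= t -> pressure f t = 0 -> 1 <= t.
Proof.
move=> t0 p0; rewrite leNgt; apply/negP => t1; rewrite pressure_lt1 // in p0.
have hb := wsum_psi_bounds t0 (ltW t1) p0.
have [_ _ _ a1 _] := cif; have a0 := abar_gt0 cif (Ordinal k0).
have u0 : 0 < 1 - t by rewrite subr_gt0.
apply: (@wsum_alpha1_not_small (abar `^ (1 - t)) c0^-1); first exact: powR_gt0.
  by rewrite -ltr_ln ?posrE ?powR_gt0 // ln1 ln_powR pmulr_rlt0 // ln_lt0 // a0.
move=> n; have /andP[_ h] := hb n; rewrite mulrC.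
apply: (@le_trans _ _ ((abar `^ (1 - t)) ^+ n * wsum n (psi f t 0))); last first.
  by rewrite ler_pM2l // exprn_gt0 // powR_gt0.
rewrite -wsumZ; apply: le_wsum => w wn.
have aw := alpha1_word_gt0 cif w.
rewrite /psi powRr0 mulr1 -powR_exprn ?(ltW a0) //.
apply: (@le_trans _ _ (alpha1 (word_mx f w) `^ (1 - t) * alpha1 (word_mx f w) `^ t)).
  rewrite -powRD ?(gt_eqF aw) ?implybT // subrK powRr1 //; exact: ltW.
rewrite ler_pM2r ?powR_gt0 // ge0_ler_powR ?nnegrE ?exprn_ge0 ?(ltW aw) ?(ltW a0) ?(ltW u0) //.
by rewrite -wn; exact: alpha1_word_le_exp cif w.
Qed.

Lemma zero_pressure_lt2 t : pressure f t = 0 -> t < 2.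
Proof.
move=> p0; rewrite ltNge; apply/negP => t2; rewrite pressure_ge2 // in p0.
have hb := wsum_psi_bounds (lexx 0) ler01 p0.
have [n hn] := wsum_det_small.
have /andP[h _] := hb n.
suff h2 : wsum n (psi f 0 (t / 2)) <= wsum n (fun w => `|\det (word_mx f w)|).
  by have := le_lt_trans (le_trans h h2) hn; rewrite ltxx.
apply: le_wsum => w _; rewrite /psi powRr0 mul1r -[leRHS]powRr1 //.
by apply: ger_powR; [rewrite (det_word_gt0 cif) (det_word_le1 cif)|rewrite ler_pdivlMr ?mul1r].
Qed.

Lemma attractor_dimension t : 0 <= t -> pressure f t = 0 ->
  [/\ has_minkowski_dim E, minkowski_dim E = t & 1 <= t < 2].
Proof.
move=> t0 p0; have t1 := zero_pressure_ge1 t0 p0; have t2 := zero_pressure_lt2 p0.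
have p0' := p0; rewrite pressure_lt2 // in p0'.
have q0 : 0 <= 2 - t by rewrite subr_ge0 ltW.
have q1 : 2 - t <= 1 by lra.
have lim := dimension_of_bounds t1 t2 (wsum_psi_bounds q0 q1 p0').
split; last by rewrite t1.
  by apply/cvg_ex; exists t.
exact: cvg_lim lim.
Qed.

(** Continuity of the dimension needs a zero for every system. On [1, 2] the pressure is Lipschitz;
    at 1 it is nonnegative, as the sums of [alpha1] do not decay, and at 2 negative, as some sum of
    determinants is below 1. *)
Lemma zero_pressure_exists : exists2 t, 1 <= t < 2 & pressure f t = 0.
Proof.
have c00 := cone_const_gt0 cif.
pose P t := limn (fun n => ln (wsum n (psi f (2 - t) (t - 1))) / n%:R).
have PP t : 1 <= t -> t <= 2 -> forall n, (0 < n)%N ->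
    n%:R * P t <= ln (wsum n (psi f (2 - t) (t - 1))) /\
    ln (wsum n (psi f (2 - t) (t - 1))) <= n%:R * P t - ln c0.
  move=> t1 t2; have q0 : 0 <= 2 - t by rewrite subr_ge0.
  have q1 : 2 - t <= 1 by lra.
  have [p [cp bp]] := psi_pressure cif k0 (t - 1) q0 q1.
  by have -> : P t = p by exact: cvg_lim cp.
have w0 p q n : 0 < wsum n (psi f p q) by exact: (wsum_psi_gt0 cif k0).
(* The Lipschitz constant: [- ln d0] bounds the decay of [alpha2] per letter, and 1 keeps it
   positive. *)
have L0 : 0 < 1 - ln d0 by rewrite subr_gt0 (le_lt_trans (ln_le0 d01)).
have [t t12 Pt] : exists2 t, 1 <= t < 2 & P t = 0.
  apply: (decreasing_zero L0); first by rewrite ler1n.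
  - move=> x y x1 xy y2; have x2 := le_trans xy y2; have y1 := le_trans x1 xy.
    split; apply: (@le_of_natmul _ _ _ (- ln c0)) => n n0.
      have [h1 _] := PP y y1 y2 n n0; have [_ h2] := PP x x1 x2 n n0.
      apply: le_trans h1 (le_trans _ h2).
      by rewrite ler_ln ?posrE //; exact: wsum_psi_le.
    have [h1 _] := PP x x1 x2 n n0; have [_ h2] := PP y y1 y2 n n0.
    have dn : 0 < d0 ^+ n by rewrite exprn_gt0.
    have := wsum_psi_shift_ge n xy.
    rewrite -ler_ln ?posrE ?mulr_gt0 ?powR_gt0 // lnM ?posrE ?powR_gt0 //.
    rewrite ln_powR lnXn // => h3.
    have h4 : (y - x) * (n%:R * (1 - ln d0)) >= - ((y - x) * (ln d0 *+ n)).
      rewrite -mulrN -mulr_natl ler_wpM2l ?subr_ge0 // mulrBr mulr1.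
      by rewrite mulr1 -[ln d0 *+ n]mulr_natl lerDr ler0n.
    rewrite mulrDr (_ : n%:R * ((1 - ln d0) * (y - x)) = (y - x) * (n%:R * (1 - ln d0))); last by ring.
    exact: le_shifted_trans h1 h2 h3 h4.
  - rewrite leNgt; apply/negP => P1.
    have hP : forall n, wsum n (psi f 1 0) <= (1 + c0^-1) * expR (P 1) ^+ n.
      move=> [|n].
        by rewrite wsum0 psi_nil expr0 mulr1 lerDl invr_ge0 ltW.
      have [_] := PP 1 (lexx _) (ler1n _ 2) n.+1 isT.
      rewrite subrr (_ : 2 - 1 = 1); last by ring.
      move=> h; rewrite -ler_ln ?posrE // ?mulr_gt0 ?exprn_gt0 ?expR_gt0 ?addr_gt0 ?invr_gt0 //.
      rewrite lnM ?posrE ?exprn_gt0 ?expR_gt0 ?addr_gt0 ?invr_gt0 //.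
      rewrite lnXn ?expR_gt0 // expRK -[P 1 *+ _]mulr_natl addrC; apply: le_trans h _.
      rewrite lerD2l -lnV ?posrE // ler_ln ?posrE ?invr_gt0 ?addr_gt0 ?invr_gt0 //.
      by rewrite lerDr.
    apply: (@wsum_alpha1_not_small (expR (P 1)) (1 + c0^-1)); first exact: expR_gt0.
      by rewrite expR_lt1.
    by move=> n; rewrite -wsum_psi1_alpha1.
  - rewrite ltNge; apply/negP => P2.
    have [n hn] := wsum_det_small.
    case: n hn => [|n hn]; first by rewrite wsum0 word_mx0 det1 normr1 ltxx.
    have [h _] := PP 2 (ler1n _ 2) (lexx _) n.+1 isT.
    move: h; rewrite subrr (_ : 2 - 1 = 1); last by ring.
    rewrite wsum_psi0_det leNgt => /negP; apply.
    apply: lt_le_trans (_ : 0 <= _); last by rewrite mulr_ge0.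
    by rewrite ln_lt0 // hn andbT -wsum_psi0_det.
by exists t => //; have /andP[t1 t2] := t12; rewrite pressure_lt2.
Qed.

End Attractor_dimension.

(** * Systems of Kakeya type *)

Section Cone_of_angle.
Context {R : realType}.
Variable beta : R.
Hypotheses (b0 : 0 < beta) (b1 : beta < pi / 2).

Definition half_tan : R := sin (beta / 2) / cos (beta / 2).

Let pi0 : 0 < pi :> R. Proof. exact: pi_gt0. Qed.

Let cb : 0 < cos (beta / 2).
Proof.
by apply: cos_gt0_pihalf; have := pi0; have := b0; have := b1; lra.
Qed.

Let sb : 0 < sin (beta / 2).
Proof.
by apply: sin_gt0_pihalf; have := pi0; have := b0; have := b1; lra.
Qed.

Lemma half_tan_gt0 : 0 < half_tan.
Proof. exact: divr_gt0. Qed.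

(** The difference of the squares of cosine and sine is [cos beta], positive for [beta < pi / 2].
    The bound 1 is what excludes cancellation in [dominant_m11M]. *)
Lemma half_tan_lt1 : half_tan < 1.
Proof.
rewrite ltr_pdivrMr // mul1r -(ltr_pXn2r (_ : 0 < 2)%N) ?nnegrE ?(ltW cb) ?(ltW sb) //.
rewrite -subr_gt0 !expr2 -cosD (_ : beta / 2 + beta / 2 = beta); last by field.
by apply: cos_gt0_pihalf; have := b0; have := b1; lra.
Qed.

Variable th : 'cV[R]_2.
Hypothesis th1 : enorm th = 1.

Lemma coneE x : cone th beta x <-> `|dot (perp th) x| < half_tan * `|dot th x|.
Proof.
have key : x != 0 -> (cos (beta / 2) < `|dot th x| / enorm x) =
    (`|dot (perp th) x| < half_tan * `|dot th x|).
  move=> x0; have n0 : 0 < enorm x by rewrite enorm_gt0.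
  rewrite ltr_pdivlMr // /half_tan mulrAC ltr_pdivlMr //.
  rewrite -(ltr_pXn2r (_ : 0 < 2)%N) ?nnegrE ?mulr_ge0 ?(ltW cb) ?(ltW n0) //.
  rewrite -[RHS](ltr_pXn2r (_ : 0 < 2)%N) ?nnegrE ?mulr_ge0 ?(ltW cb) ?(ltW sb) //.
  rewrite !exprMn (sqr_enorm_coord th1) !real_normK ?num_real //.
  have := cos2Dsin2 (beta / 2).
  move: (cos _ ^+ 2) (sin _ ^+ 2) (dot th x ^+ 2) (dot (perp th) x ^+ 2) => c q u v e.
  have -> : c = 1 - q by lra.
  by rewrite -subr_gt0 -[RHS]subr_gt0; congr (0 < _); ring.
split=> [[x0]|h]; first by rewrite key.
have x0 : x != 0.
  apply: contraTneq h => ->; rewrite -leNgt.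
  have -> : dot th 0 = 0 by rewrite dotE !mxE !mulr0 addr0.
  by rewrite normr0 mulr0.
by split; rewrite ?key.
Qed.

(** A small move along the axis, on the side where [x] lies, increases the axis coordinate and fixes
    the other, so it leads strictly inside the cone. *)
Lemma closed_cone_sub_closure : closed_cone th half_tan `<=` closure (cone th beta).
Proof.
move=> x Kx B Bx.
pose v : 'cV[R]_2 := (if 0 <= dot th x then 1 else -1) *: th.
have lim : (fun e : R => x + e *: v) @ (0 : R) --> x.
  rewrite -[X in _ --> X]addr0 -(scale0r v).
  apply: cvgD; first exact: cvg_cst.
  by apply: cvgZr_tmp; exact: cvg_id.
have lim' : (fun e : R => x + e *: v) @ (0 : R)^'+ --> x by exact: cvg_at_right_filter.
have [e [e0 Be]] : exists e : R, 0 < e /\ B (x + e *: v).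
  by apply: (@filter_ex _ (0 : R)^'+); apply: filterI; [exact: nbhs_right_gt|exact: lim'].
exists (x + e *: v); split => //; apply/coneE.
rewrite !dotDr !dotZr dot_perp_th dot_th_th // !mulr0 addr0 mulr1.
apply: le_lt_trans Kx _; rewrite ltr_pM2l ?half_tan_gt0 //.
case: (lerP 0 (dot th x)) => h.
  by rewrite mulr1 !ger0_norm // ?ltrDl // addr_ge0 // ltW.
rewrite mulrN1 !ltr0_norm //; lra.
Qed.

End Cone_of_angle.

Lemma half_strict_of_inv {R : realType} (th : 'cV[R]_2) (s : R) (A : 'M[R]_2) :
  enorm th = 1 -> 0 < s ->
  (forall x, closed_cone th s x -> x != 0 ->
     `|dot (perp th) (A *m x)| < s * `|dot th (A *m x)|) ->
  half_strict th s A.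
Proof.
move=> th1 s0 h.
have h' e : `|e| <= s -> `|m21 th A + e * m22 th A| < s * `|m11 th A + e * m12 th A|.
  move=> es; have := h (1 *: th + e *: perp th).
  rewrite /closed_cone /= dot_th_comb // dot_perp_comb // normr1 mulr1 => /(_ es).
  rewrite (dot_th_mul th1) (dot_perp_mul th1) (dot_th_comb th1) (dot_perp_comb th1) !mulr1.
  rewrite ![_ * e]mulrC; apply.
  apply: contraTneq isT => z; have := congr1 (dot th) z.
  rewrite dot_th_comb // dotE !mxE !mulr0 addr0 => /eqP; by rewrite oner_eq0.
split.
- by have := h' 0; rewrite normr0 !mul0r !addr0 => /(_ (ltW s0)).
- by apply: h'; rewrite gtr0_norm.
- by have := h' (- s); rewrite normrN gtr0_norm // !mulNr => /(_ (lexx _)).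
Qed.

Section Kakeya_data.
Context {R : realType} {kappa : nat}.
Variable f : affine_maps R kappa.

Lemma kakeya_cone : affine_IFS f -> cone_condition f ->
  exists th s abar, cone_ifs f th s abar /\
    forall i j, i != j ->
    (mulmx (linpart f i) @` closed_cone th s) `&` (mulmx (linpart f j) @` closed_cone th s)
    `<=` [set 0].
Proof.
move=> [abar a1 hA] [th [beta [th1 /andP[b0 b1] hX hXT hd]]].
have s0 := half_tan_gt0 b0 b1; have s1 := half_tan_lt1 b0 b1.
have sub := closed_cone_sub_closure b0 b1 th1.
exists th, (half_tan beta), abar; split.
  split => // i; have [Au Aa] := hA i; split => //.
    exact: le_trans (alpha1_le_opnorm _) Aa.
  split; apply: half_strict_of_inv => // x Kx x0; apply/coneE => //.
    by apply: (hX i); exists x => //; split; [exact: sub|exact/eqP].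
  by apply: (hXT i); exists x => //; split; [exact: sub|exact/eqP].
move=> i j ij z [[x Kx xz] [y Ky yz]]; rewrite -(hd i j ij).
by split; [exists x|exists y] => //; exact: sub.
Qed.

Lemma measure_sub_set1 (P : set R) : P `<=` [set 0] -> lebesgue_measure P = 0%E.
Proof. by move=> /subset_set1[] ->; rewrite ?measure0 ?lebesgue_measure_set1. Qed.

(* A vanishing [theta1] or an empty [invariant_set], the junk values, would
   give projections of measure zero. *)
Lemma kakeya_projection (k0 : (0 < kappa)%N) : projection_condition f ->
  is_invariant_set f (invariant_set f) /\
  exists2 rho, 0 < rho & forall w : seq 'I_kappa, (0 < size w)%N ->
  [/\ enorm (theta1 (word_mx f w)) = 1,
      (word_mx f w)^T *m word_mx f w *m theta1 (word_mx f w) =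
        alpha1 (word_mx f w) ^+ 2 *: theta1 (word_mx f w) &
      (rho%:E <= lebesgue_measure
         [set dot (theta1 (word_mx f w)) x | x in invariant_set f])%E].
Proof.
move=> [rho rho0 h].
have not0 (P : set R) : (rho%:E <= lebesgue_measure P)%E -> ~ P `<=` [set 0].
  by move=> + /measure_sub_set1 e; rewrite e lee_fin leNgt rho0.
split.
  have := not0 _ (h [:: Ordinal k0] isT); rewrite /invariant_set.
  by case: xgetP => [y -> //|_ []]; rewrite image_set0.
exists rho => // w wpos; have hw := h w wpos; split => //.
  have := not0 _ hw; rewrite /theta1; case: xgetP => [y -> [//]|_ []].
  by move=> _ [x _ <-]; rewrite dotE !mxE !mul0r addr0.
have := not0 _ hw; rewrite /theta1; case: xgetP => [y -> [//]|_ []].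
by move=> _ [x _ <-]; rewrite dotE !mxE !mul0r addr0.
Qed.

Lemma compact_enorm_bound (E : set 'cV[R]_2) : compact E ->
  exists2 D, 1 <= D & forall x, E x -> enorm x <= D / 2.
Proof.
move=> cE.
have bd v : exists M : R, forall x, E x -> `|dot v x| <= M.
  have cv : compact (dot v @` E).
    by apply: continuous_compact cE; apply: continuous_subspaceT; exact: dot_continuous.
  have [M [_ hM]] := compact_bounded cv.
  exists (`|M| + 1) => x Ex; apply: hM; last by exists x.
  by rewrite (le_lt_trans (ler_norm M)) // ltrDl.
pose e1 : 'cV[R]_2 := \col_i (i == 0)%:R.
have e11 : enorm e1 = 1 by rewrite /enorm dotE !mxE /= mulr1 mulr0 addr0 sqrtr1.
have [M1 h1] := bd e1; have [M2 h2] := bd (perp e1).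
exists (1 + 2 * (`|M1| + `|M2|)); first by rewrite lerDl.
move=> x Ex; apply: le_trans (enorm_le_coord e11 x) _.
have := h1 x Ex; have := h2 x Ex; have := ler_norm M1; have := ler_norm M2.
by lra.
Qed.

(** The product of all the determinants serves as the bound, since each factor is at most 1. *)
Lemma det_lower_bound : (forall i, linpart f i \in unitmx) ->
  (forall i, `|\det (linpart f i)| <= 1) ->
  exists d0, [/\ 0 < d0, d0 <= 1 & forall i, d0 <= `|\det (linpart f i)|].
Proof.
move=> hu h1; have p0 i : 0 < `|\det (linpart f i)|.
  by rewrite normr_gt0 -unitfE -unitmxE hu.
have pr (Q : pred 'I_kappa) : 0 <= \prod_(i | Q i) `|\det (linpart f i)| <= 1.
  apply: (big_ind (fun x => 0 <= x <= 1)) => [|x y /andP[x0 x1] /andP[y0 y1]|i _].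
  - by rewrite ler01 lexx.
  - by rewrite mulr_ge0 // mulr_ile1.
  - by rewrite (ltW (p0 i)) h1.
exists (\prod_i `|\det (linpart f i)|); split.
- by apply: prodr_gt0 => i _.
- by have /andP[] := pr xpredT.
- move=> i; rewrite (bigD1 i) //= ler_piMr //.
  by have /andP[] := pr (fun j => j != i).
Qed.

End Kakeya_data.

Section Kakeya_dimension.
Context {R : realType} {kappa : nat}.
Variable f : affine_maps R kappa.
Hypotheses (k0 : (0 < kappa)%N) (kf : kakeya_type f).

Lemma kakeya_dimension :
  (forall t : R, 0 <= t -> pressure f t = 0 ->
    [/\ has_minkowski_dim (invariant_set f), minkowski_dim (invariant_set f) = t &
        1 <= t < 2]) /\
  exists2 t : R, 1 <= t < 2 & pressure f t = 0.
Proof.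
have [fa fc fp] := kf.
have [th [s [abar [cif dis]]]] := kakeya_cone fa fc.
have [Einv [rho rho0 proj]] := kakeya_projection k0 fp.
have [D D1 ED] : exists2 D, 1 <= D & forall x, invariant_set f x -> enorm x <= D / 2.
  by have [_ cE _] := Einv; exact: compact_enorm_bound.
have [d0 [d00 d01 d0le]] : exists d0, [/\ 0 < d0, d0 <= 1 & forall i, d0 <= `|\det (linpart f i)|].
  apply: det_lower_bound => i; first by rewrite -word_mx1 (word_unit cif).
  by rewrite -word_mx1 (det_word_le1 cif).
split; last exact: (zero_pressure_exists cif k0 Einv D1 ED d00 d01 d0le dis rho0 proj).
move=> t t0 p0.
exact: (attractor_dimension cif k0 Einv D1 ED d00 d01 d0le dis rho0 proj t0 p0).
Qed.

End Kakeya_dimension.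

(** * Continuity of the dimension *)

Section Continuity.
Context {R : realType} {T : topologicalType}.
Implicit Types (g h : T -> R) (x : T).

Lemma cont_sum (I : Type) (r : seq I) (F : I -> T -> R) x :
  (forall i, F i y @[y --> x] --> F i x) ->
  \sum_(i <- r) F i y @[y --> x] --> \sum_(i <- r) F i x.
Proof.
move=> hF; elim: r => [|i r IH].
  rewrite big_nil (_ : (fun y => _) = fun=> 0); first exact: cvg_cst.
  by apply/funext => y; rewrite big_nil.
rewrite big_cons (_ : (fun y => _) = fun y => F i y + \sum_(j <- r) F j y).
  exact: cvgD (hF i) IH.
by apply/funext => y; rewrite big_cons.
Qed.

Lemma near_lt g h x : g y @[y --> x] --> g x -> h y @[y --> x] --> h x -> g x < h x ->
  \forall y \near x, g y < h y.
Proof.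
move=> cg ch gh.
have c : h y - g y @[y --> x] --> h x - g x by exact: cvgB ch cg.
have : \forall y \near x, 0 < h y - g y.
  by apply: (cvgr_gt _ c); rewrite subr_gt0.
by apply: filterS => y; rewrite subr_gt0.
Qed.

Lemma near_lt_cst g x c : g y @[y --> x] --> g x -> g x < c -> \forall y \near x, g y < c.
Proof. by move=> cg; apply: (@near_lt g (fun=> c)) => //; exact: cvg_cst. Qed.

Lemma near_gt_cst g x c : g y @[y --> x] --> g x -> c < g x -> \forall y \near x, c < g y.
Proof. by move=> cg; apply: (@near_lt (fun=> c) g) => //; exact: cvg_cst. Qed.

Lemma near_forall (I : finType) (P : I -> T -> Prop) x :
  (forall i, \forall y \near x, P i y) -> \forall y \near x, forall i, P i y.
Proof. exact: filter_forall. Qed.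

Variable A : T -> 'M[R]_2.
Hypothesis cA : forall i j, continuous (fun x => A x i j).

Lemma cont_mulmx (B : T -> 'M[R]_2) : (forall i j, continuous (fun x => B x i j)) ->
  forall i j, continuous (fun x => (A x *m B x) i j).
Proof.
move=> cB i j x.
rewrite (_ : (fun x => _) = fun y => A y i 0 * B y 0 j + A y i 1 * B y 1 j).
  have h : A y i 0 * B y 0 j + A y i 1 * B y 1 j @[y --> x] -->
      A x i 0 * B x 0 j + A x i 1 * B x 1 j.
    by apply: cvgD; apply: cvgM; [exact: cA|exact: cB|exact: cA|exact: cB].
  exact: h.
by apply/funext => y; rewrite mulmx2.
Qed.

Lemma cont_dot_mul (u v : 'cV[R]_2) : continuous (fun x => dot u (A x *m v)).
Proof.
move=> x; pose F y :=
  u 0 0 * (A y 0 0 * v 0 0 + A y 0 1 * v 1 0) + u 1 0 * (A y 1 0 * v 0 0 + A y 1 1 * v 1 0).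
rewrite (_ : (fun x => _) = F); last by apply/funext => y; rewrite dotE !mulmxv2.
have h : F y @[y --> x] --> F x.
  by apply: cvgD; (apply: cvgM; first exact: cvg_cst); apply: cvgD; apply: cvgM;
    (exact: cvg_cst || exact: cA).
exact: h.
Qed.

Lemma cont_det : continuous (fun x => \det (A x)).
Proof.
move=> x; pose F y := A y 0 0 * A y 1 1 - A y 0 1 * A y 1 0.
rewrite (_ : (fun x => _) = F); last by apply/funext => y; rewrite det2.
have h : F y @[y --> x] --> F x by apply: cvgB; apply: cvgM; exact: cA.
exact: h.
Qed.

Lemma cont_trace_gram : continuous (fun x => \tr ((A x)^T *m A x)).
Proof.
move=> x; pose F y :=
  (A y 0 0 * A y 0 0 + A y 1 0 * A y 1 0) + (A y 0 1 * A y 0 1 + A y 1 1 * A y 1 1).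
rewrite (_ : (fun x => _) = F).
  have h : F y @[y --> x] --> F x by apply: cvgD; apply: cvgD; apply: cvgM; exact: cA.
  exact: h.
by apply/funext => y; rewrite mxtrace2 !mulmx2 ![_^T _ _]mxE.
Qed.

Lemma cont_alpha1 : continuous (fun x => alpha1 (A x)).
Proof.
move=> x; pose tr y := \tr ((A y)^T *m A y).
have ct : tr y @[y --> x] --> tr x by exact: cont_trace_gram.
have cd : \det (A y) @[y --> x] --> \det (A x) by exact: cont_det.
pose F y := Num.sqrt ((tr y +
    1 * Num.sqrt (tr y * tr y - 4 * (\det (A y) * \det (A y)))) / 2).
rewrite (_ : (fun x => _) = F); last first.
  by apply/funext => y; rewrite alpha1E /gram_root /gram_disc !expr2.
have h : F y @[y --> x] --> F x; last exact: h.
apply: (@continuous_cvg _ _ _ _ _ _ Num.sqrt); first exact: sqrt_continuous.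
apply: cvgM; last exact: cvg_cst.
apply: cvgD; first exact: ct.
apply: cvgM; first exact: cvg_cst.
apply: (@continuous_cvg _ _ _ _ _ _ Num.sqrt); first exact: sqrt_continuous.
apply: cvgB; first exact: (cvgM ct ct).
by apply: cvgM; [exact: cvg_cst|exact: (cvgM cd cd)].
Qed.

Lemma near_half_strict (th : 'cV[R]_2) s x : half_strict th s (A x) ->
  \forall y \near x, half_strict th s (A y).
Proof.
move=> [h1 h2 h3].
have c11 : continuous (fun x => m11 th (A x)) by exact: cont_dot_mul.
have c12 : continuous (fun x => m12 th (A x)) by exact: cont_dot_mul.
have c21 : continuous (fun x => m21 th (A x)) by exact: cont_dot_mul.
have c22 : continuous (fun x => m22 th (A x)) by exact: cont_dot_mul.
have n1 : \forall y \near x, `|m21 th (A y)| < s * `|m11 th (A y)|.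
  apply: near_lt h1; first by apply: cvg_norm; exact: c21.
  by apply: cvgM; [exact: cvg_cst|apply: cvg_norm; exact: c11].
have n2 : \forall y \near x, `|m21 th (A y) + s * m22 th (A y)| <
    s * `|m11 th (A y) + s * m12 th (A y)|.
  apply: near_lt h2.
    apply: cvg_norm; apply: cvgD; first exact: c21.
    by apply: cvgM; [exact: cvg_cst|exact: c22].
  apply: cvgM; first exact: cvg_cst.
  apply: cvg_norm; apply: cvgD; first exact: c11.
  by apply: cvgM; [exact: cvg_cst|exact: c12].
have n3 : \forall y \near x, `|m21 th (A y) - s * m22 th (A y)| <
    s * `|m11 th (A y) - s * m12 th (A y)|.
  apply: near_lt h3.
    apply: cvg_norm; apply: cvgB; first exact: c21.
    by apply: cvgM; [exact: cvg_cst|exact: c22].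
  apply: cvgM; first exact: cvg_cst.
  apply: cvg_norm; apply: cvgB; first exact: c11.
  by apply: cvgM; [exact: cvg_cst|exact: c12].
by apply: filterS3 n1 n2 n3 => y *; split.
Qed.

(* [psi] in a form whose continuity only uses that of [ln] and [expR]. *)
Definition exp_psi (p q : R) (M : 'M[R]_2) := expR (p * ln (alpha1 M) + q * ln `|\det M|).

Lemma cont_exp_psi p q x : A x \in unitmx ->
  exp_psi p q (A y) @[y --> x] --> exp_psi p q (A x).
Proof.
move=> Au; have a0 := alpha1_gt0 Au.
have d0 : 0 < `|\det (A x)| by rewrite normr_gt0 -unitfE -unitmxE.
have ca : alpha1 (A y) @[y --> x] --> alpha1 (A x) by exact: cont_alpha1.
have cd : `|\det (A y)| @[y --> x] --> `|\det (A x)| by apply: cvg_norm; exact: cont_det.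
rewrite /exp_psi.
apply: (@continuous_cvg _ _ _ _ _ _ expR); first exact: continuous_expR.
apply: cvgD; (apply: cvgM; first exact: cvg_cst).
  by apply: (@continuous_cvg _ _ _ _ _ _ (@ln R)); [exact: continuous_ln|exact: ca].
by apply: (@continuous_cvg _ _ _ _ _ _ (@ln R)); [exact: continuous_ln|exact: cd].
Qed.

End Continuity.

(** * Stability of the zero of the pressure *)

Section Kakeya_continuity.
Context {R : realType} {kappa : nat}.
Implicit Types (f : affine_maps R kappa).

Lemma cont_eval i : continuous (fun f => f i).
Proof. exact: proj_continuous. Qed.

Lemma cont_linpart_mx i : continuous (fun f => linpart f i).
Proof.
move=> f; apply: (@continuous_comp _ _ _ (fun f => f i) fst f); first exact: cont_eval.
exact: cvg_fst.
Qed.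

Lemma cont_linpart i a b : continuous (fun f => linpart f i a b).
Proof.
move=> f.
apply: (@continuous_comp _ _ _ (fun f => linpart f i) (fun A : 'M[R]_2 => A a b) f).
  exact: cont_linpart_mx.
exact: coord_continuous.
Qed.

Lemma cont_word_mx w a b : continuous (fun f => word_mx f w a b).
Proof.
elim: w a b => [|i w IH] a b.
  rewrite (_ : (fun f => _) = fun=> (1%:M : 'M[R]_2) a b); first exact: cst_continuous.
  by apply/funext => f; rewrite word_mx0.
rewrite (_ : (fun f => _) = fun f => (linpart f i *m word_mx f w) a b).
  by apply: cont_mulmx => // c d; exact: cont_linpart.
by apply/funext => f; rewrite word_mx_cons.
Qed.

Definition exp_wsum n (p q : R) f := \sum_(w : n.-tuple 'I_kappa) exp_psi p q (word_mx f w).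

Lemma exp_wsumE n p q f th s abar : cone_ifs f th s abar ->
  exp_wsum n p q f = wsum n (psi f p q).
Proof.
move=> cif; apply: eq_bigr => w _.
have a0 := alpha1_word_gt0 cif w; have d0 := det_word_gt0 cif w.
by rewrite /psi /powR !gt_eqF // -expRD.
Qed.

Lemma cont_exp_wsum n p q f th s abar : cone_ifs f th s abar ->
  exp_wsum n p q g @[g --> f] --> exp_wsum n p q f.
Proof.
move=> cif; apply: cont_sum => w.
apply: cont_exp_psi; last exact: (word_unit cif).
by move=> a b; exact: cont_word_mx.
Qed.

Lemma near_strict_cone f th s abar : cone_ifs f th s abar ->
  \forall g \near f, forall i, strict_cone th s (linpart g i).
Proof.
move=> [_ _ _ _ h].
apply: near_forall => i; have [_ _ [h1 h2]] := h i.
have n1 : \forall g \near f, half_strict th s (linpart g i).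
  by apply: (@near_half_strict _ _ (fun g => linpart g i)) h1 => a b; exact: cont_linpart.
have n2 : \forall g \near f, half_strict th s (linpart g i)^T.
  apply: (@near_half_strict _ _ (fun g => (linpart g i)^T)) h2 => a b.
  rewrite (_ : (fun g => _) = fun g => linpart g i b a); first exact: cont_linpart.
  by apply/funext => g; rewrite mxE.
by apply: filterS2 n1 n2 => g *; split.
Qed.

Hypothesis k0 : (0 < kappa)%N.

Lemma zero_pressure_wsum f th s abar t : cone_ifs f th s abar ->
  1 <= t -> t < 2 -> pressure f t = 0 ->
  forall n, 1 <= wsum n (psi f (2 - t) (t - 1)) <= (cone_const s)^-1.
Proof.
move=> cif t1 t2; rewrite (pressure_lt2 cif) // => p0.
by apply: (wsum_psi_bounds cif k0 _ _ p0); lra.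
Qed.

(* Quasimultiplicativity of [psi] locates the zero of the pressure, up to [e], by
   two strict inequalities on words of one fixed length; these are stable. *)
Lemma near_zero_pressure f th s abar t (e : R) : cone_ifs f th s abar ->
  1 <= t -> t < 2 -> pressure f t = 0 -> 0 < e ->
  \forall g \near f, forall abar' t' : R, cone_ifs g th s abar' ->
    1 <= t' -> t' < 2 -> pressure g t' = 0 -> `|t - t'| < e.
Proof.
move=> cif t1 t2 p0 e0.
have [_ s0 s1 abar1 _] := cif.
have bt := zero_pressure_wsum cif t1 t2 p0.
have c0 := cone_const_gt0 cif.
have a0 : 0 < abar := abar_gt0 cif (Ordinal k0).
have b1 : abar `^ e < 1.
  by rewrite /powR gt_eqF // -expR0 ltr_expR pmulr_rlt0 // ln_lt0 // a0.
(* The length is taken so large that moving the exponent by [e] outweighs the constant of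
   quasimultiplicativity. *)
have [n hn] := expr_small (powR_ge0 abar e) b1 c0.
have {}hn : (abar ^+ n.+1) `^ e < cone_const s by rewrite powR_exprn // ltW.
have q0 : 0 < (abar ^+ n.+1) `^ e by rewrite powR_gt0 // exprn_gt0.
have /andP[lo hi] := bt n.+1.
have up : exp_wsum n.+1 (2 - (t + e)) (t + e - 1) f < 1.
  rewrite (exp_wsumE _ _ _ cif).
  have te : t <= t + e by rewrite lerDl ltW.
  apply: le_lt_trans (wsum_psi_decay cif k0 n.+1 te) _.
  rewrite (_ : t + e - t = e); last by ring.
  apply: le_lt_trans (ler_wpM2l (ltW q0) hi) _.
  by rewrite ltr_pdivrMr // mul1r.
have dn : (cone_const s)^-1 < exp_wsum n.+1 (2 - (t - e)) (t - e - 1) f.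
  rewrite (exp_wsumE _ _ _ cif).
  have te : t - e <= t by rewrite gerBl ltW.
  have := wsum_psi_decay cif k0 n.+1 te.
  rewrite (_ : t - (t - e) = e); last by ring.
  move=> /(le_trans lo); rewrite -ler_pdivrMl // mulr1; apply: lt_le_trans.
  by rewrite ltf_pV2.
have nup : \forall g \near f, exp_wsum n.+1 (2 - (t + e)) (t + e - 1) g < 1.
  exact: near_lt_cst (cont_exp_wsum cif) up.
have ndn : \forall g \near f, (cone_const s)^-1 < exp_wsum n.+1 (2 - (t - e)) (t - e - 1) g.
  exact: near_gt_cst (cont_exp_wsum cif) dn.
apply: filterS2 nup ndn => g gup gdn abar' t' cig t1' t2' p0'.
have /andP[lo' hi'] := zero_pressure_wsum cig t1' t2' p0' n.+1.
move: gup gdn; rewrite !(exp_wsumE _ _ _ cig) => gup gdn.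
rewrite ltr_distlC; apply/andP; split; rewrite ltNge; apply/negP => h.
  by have := le_lt_trans (le_trans (wsum_psi_le cig k0 n.+1 h) hi') gdn; rewrite ltxx.
by have := lt_le_trans gup (le_trans lo' (wsum_psi_le cig k0 n.+1 h)); rewrite ltxx.
Qed.

End Kakeya_continuity.

Unset Implicit Arguments.

Theorem theorem3p3 (R : realType) (kappa : nat) (hkappa : (2 <= kappa)%N) :
  (forall (f : affine_maps R kappa) (t : R),
      kakeya_type f -> 0 <= t -> pressure f t = 0 ->
      [/\ has_minkowski_dim (invariant_set f),
          minkowski_dim (invariant_set f) = t &
          1 <= t]) /\
  {within [set f : affine_maps R kappa | kakeya_type f],
     continuous (fun f => minkowski_dim (invariant_set f))}.
Proof.
have k0 : (0 < kappa)%N by exact: leq_trans hkappa.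
split=> [f t kf t0 p0|].
  by have [/(_ _ t0 p0)[? ? /andP[? _]] _] := kakeya_dimension k0 kf.
apply/subspace_continuousP => f kf; apply/cvgrPdist_lt => e e0; rewrite near_withinE.
have [hf [t /andP[t1 t2] p0]] := kakeya_dimension k0 kf.
have [_ ft _] := hf t (le_trans ler01 t1) p0.
have [fa fc _] := kf; have [th [s [abar [cif _]]]] := kakeya_cone fa fc.
suff : \forall g \near f, kakeya_type g ->
    `|minkowski_dim (invariant_set f) - minkowski_dim (invariant_set g)| < e by [].
rewrite ft; apply: filterS2 (near_zero_pressure k0 cif t1 t2 p0 e0) (near_strict_cone cif).
move=> g hg sg kg; have [hdg [t' /andP[t1' t2'] p0']] := kakeya_dimension k0 kg.
have [_ -> _] := hdg t' (le_trans ler01 t1') p0'.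
(* The cone of [f] is used for [g] as well, so both zeros are compared with the same constant; the
   contraction bound is that of [g]. *)
have [[abar' a1 hA] _ _] := kg; have [th1 s0 s1 _ _] := cif.
apply: (hg abar' t') => //; split=> // i; have [Au Aa] := hA i.
by split; [exact: Au|exact: le_trans (alpha1_le_opnorm _) Aa|exact: sg].
Qed.
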